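(* Let $R(\mathbf{x},\mathbf{x}')$ be a balanced difference bounds constraint over $N$ variables. Define $S_{fw}(\mathbf{x}) := \exists\mathbf{x}'.\,R^{N^2}(\mathbf{x},\mathbf{x}')$, $S_{bw}(\mathbf{x}') := \exists\mathbf{x}.\,R^{N^2}(\mathbf{x},\mathbf{x}')$, $R_s(\mathbf{x},\mathbf{x}') := R(\mathbf{x},\mathbf{x}')\wedge S_{fw}(\mathbf{x})\wedge S_{bw}(\mathbf{x}')$; let $R_{fw}$ be the conjunction of all atoms $x_i-x_j'\le c$ ($1\le i,j\le N$, $c\in\mathbb{Z}$) implied by $R_s$, and $R_{bw}$ the conjunction of all atoms $x_i'-x_j\le c$ implied by $R_s$. Let $\widehat{R}_{fw}(\ell,\mathbf{x},\mathbf{x}')$ and $\widehat{R}_{bw}(\ell,\mathbf{x},\mathbf{x}')$ be closed forms of $R_{fw}$ and $R_{bw}$, and set $\phi(\ell,\mathbf{x},\mathbf{x}') := \widehat{R}_{fw}(\ell,\mathbf{x},\mathbf{x}')\wedge\widehat{R}_{bw}(\ell,\mathbf{x},\mathbf{x}')\wedge S_{fw}(\mathbf{x})\wedge S_{bw}(\mathbf{x}')$, $\psi(\ell,\mathbf{x},\mathbf{x}') := \exists\mathbf{y},\mathbf{z}.\,R^{N^2}(\mathbf{x},\mathbf{y})\wedge\phi(\ell,\mathbf{y},\mathbf{z})\wedge R^{N^2}(\mathbf{z},\mathbf{x}')$, $\widehat{R}(k,\mathbf{x},\mathbf{x}') := \bigvee_{i=1}^{2N^2}\big(k=i\wedge R^i(\mathbf{x},\mathbf{x}')\big)\vee\exists\ell\ge1.\,\big(k=2N^2+\ell\wedge\psi(\ell,\mathbf{x},\mathbf{x}')\big)$.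 Then $\widehat{R}$ is a closed form of $R$. Moreover, $\widehat{R}_{fw},\widehat{R}_{bw}$ can be chosen so that $\widehat{R}$ is a formula in the existential fragment of Presburger arithmetic computable in time polynomial in the binary size of $R$.
   Context: Variables range over $\mathbb{Z}$; $\mathbf{x}=\{x_1,\dots,x_N\}$, $\mathbf{x}'$ its primed copy, $\mathbf{y},\mathbf{z}$ further fresh copies. A difference bounds (DB) constraint is a finite conjunction of atoms $u-v\le c$, $c\in\mathbb{Z}$. $R(\mathbf{x},\mathbf{x}')$ is balanced if for all $i,j,c$: $x_i-x_j\le c$ is an atom of $R$ iff $x_i'-x_j'\le c$ is an atom of $R$. $R^n(\mathbf{x},\mathbf{x}')$ denotes a formula defining the $n$-fold composition of $R$. A closed form of a relation $R$ is a formula $\widehat{R}(k,\mathbf{x},\mathbf{x}')$, with $k$ a fresh integer variable, such that for every $n\ge1$, $\widehat{R}[n/k]$ defines $R^n$. *)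

(* Defs.v *)
From mathcomp Require Import all_boot all_order all_algebra.

Set Implicit Arguments.
Unset Strict Implicit.
Unset Printing Implicit Defensive.

Import Order.TTheory GRing.Theory Num.Theory.

Definition sumf {A B C : Type} (f : A -> C) (g : B -> C) (u : A + B) : C :=
  match u with inl a => f a | inr b => g b end.

(** * Relations over integer valuations *)

Definition vec (N : nat) := {ffun 'I_N -> int}.

Definition vrel (N : nat) := vec N -> vec N -> Prop.

Fixpoint rpow N (R : vrel N) (n : nat) : vrel N :=
  match n with
  | 0 => fun x x' => x = x'
  | m.+1 => fun x x' => exists y, R x y /\ rpow R m y x'
  end.

(** * Difference bounds constraints *)

(* [inl i] stands for x_i and [inr i] for x'_i. *)
Definition dvar (N : nat) : Type := ('I_N + 'I_N)%type.

(* The triple (u, v, c) is the atom u - v <= c. *)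
Definition atom (N : nat) : Type := (dvar N * dvar N * int)%type.

(* A conjunction is the list of its atoms. *)
Definition dbc (N : nat) : Type := seq (atom N).

Definition dbrel N (R : dbc N) : vrel N := fun x x' =>
  forall u v c, (u, v, c) \in R -> (sumf x x' u - sumf x x' v <= c)%R.

Definition balanced N (R : dbc N) : Prop :=
  forall (i j : 'I_N) (c : int),
    ((inl i, inl j, c) \in R) <-> ((inr i, inr j, c) \in R).

Definition Sfw_set N (R : vrel N) (x : vec N) : Prop :=
  exists x', rpow R (N ^ 2) x x'.

Definition Sbw_set N (R : vrel N) (x' : vec N) : Prop :=
  exists x, rpow R (N ^ 2) x x'.

Definition Rs N (R : vrel N) : vrel N := fun x x' =>
  R x x' /\ Sfw_set R x /\ Sbw_set R x'.

Definition Rfw N (R : vrel N) : vrel N := fun x x' =>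
  forall (i j : 'I_N) (c : int),
    (forall y y', Rs R y y' -> (y i - y' j <= c)%R) -> (x i - x' j <= c)%R.

Definition Rbw N (R : vrel N) : vrel N := fun x x' =>
  forall (i j : 'I_N) (c : int),
    (forall y y', Rs R y y' -> (y' i - y j <= c)%R) -> (x' i - x j <= c)%R.

(** * Presburger arithmetic *)

(* [lterm V] and [fml V] are the terms and formulas whose free variables
   belong to [V]. *)
Inductive lterm (V : Type) : Type :=
| TVar of V
| TCst of int
| TAdd of lterm V & lterm V
| TMul of int & lterm V.

(* [FEx n f] and [FAll n f] quantify a block of [n] integer variables, which
   are the variables [inr i] of [f]. *)
Inductive fml (V : Type) : Type :=
| FLe of lterm V & lterm V
| FAnd of fml V & fml V
| FOr of fml V & fml V
| FNot of fml V
| FEx (n : nat) of fml (V + 'I_n)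
| FAll (n : nat) of fml (V + 'I_n).

Arguments TCst {V} c.

Fixpoint teval V (t : lterm V) (e : V -> int) : int :=
  match t with
  | TVar v => e v
  | TCst c => c
  | TAdd t u => (teval t e + teval u e)%R
  | TMul c t => (c * teval t e)%R
  end.

Fixpoint sat V (f : fml V) : (V -> int) -> Prop :=
  match f with
  | FLe t u => fun e => (teval t e <= teval u e)%R
  | FAnd f g => fun e => sat f e /\ sat g e
  | FOr f g => fun e => sat f e \/ sat g e
  | FNot f => fun e => ~ sat f e
  | FEx n f => fun e => exists y : vec n, sat f (sumf e y)
  | FAll n f => fun e => forall y : vec n, sat f (sumf e y)
  end.

Definition FEq V (t u : lterm V) : fml V := FAnd (FLe t u) (FLe u t).

Fixpoint tren V W (r : V -> W) (t : lterm V) : lterm W :=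
  match t with
  | TVar v => TVar (r v)
  | TCst c => TCst c
  | TAdd t u => TAdd (tren r t) (tren r u)
  | TMul c t => TMul c (tren r t)
  end.

Fixpoint fren V (f : fml V) : forall W, (V -> W) -> fml W :=
  match f with
  | FLe t u => fun W r => FLe (tren r t) (tren r u)
  | FAnd f g => fun W r => FAnd (fren f r) (fren g r)
  | FOr f g => fun W r => FOr (fren f r) (fren g r)
  | FNot f => fun W r => FNot (fren f r)
  | FEx n f => fun W r => FEx (fren f (sumf (inl \o r) inr))
  | FAll n f => fun W r => FAll (fren f (sumf (inl \o r) inr))
  end.

Fixpoint qfree V (f : fml V) : bool :=
  match f with
  | FLe _ _ => true
  | FAnd f g | FOr f g => qfree f && qfree g
  | FNot f => qfree f
  | FEx _ _ | FAll _ _ => false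
  end.

(* Existential fragment, up to prenexing: existential quantifiers may occur
   below conjunctions and disjunctions, but not below a negation. *)
Fixpoint existential V (f : fml V) : bool :=
  match f with
  | FLe _ _ => true
  | FAnd f g | FOr f g => existential f && existential g
  | FNot f => qfree f
  | FEx _ f => existential f
  | FAll _ _ => false
  end.

Definition defines N (F : fml (dvar N)) (R : vrel N) : Prop :=
  forall x x' : vec N, sat F (sumf x x') <-> R x x'.

(* Variables of a formula F(k, x, x'), where k is [None]. *)
Definition kvar (N : nat) : Type := option (dvar N).

Definition kenv N (k : int) (x x' : vec N) : kvar N -> int :=
  oapp (sumf x x') k.

Definition closed_form N (R : vrel N) (F : fml (kvar N)) : Prop :=
  forall n : nat, 0 < n ->
  forall x x' : vec N, sat F (kenv (Posz n) x x') <-> rpow R n x x'.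

(** * The formula of the statement

    [P n] is the chosen formula defining the n-fold composition of R, and
    [Ffw], [Fbw] are the chosen closed forms. *)

Section Construction.

Variables (N : nat) (P : nat -> fml (dvar N)) (Ffw Fbw : fml (kvar N)).

Definition Sfw_form : fml ('I_N) := FEx (fren (P (N ^ 2)) id).

Definition Sbw_form : fml ('I_N) := FEx (fren (P (N ^ 2)) (sumf inr inl)).

Definition phi_form : fml (kvar N) :=
  FAnd (FAnd Ffw Fbw)
       (FAnd (fren Sfw_form (Some \o inl)) (fren Sbw_form (Some \o inr))).

Definition psi_form : fml (kvar N) :=
  let V := (kvar N + 'I_N + 'I_N)%type in
  let l : V := inl (inl None) in
  let x (i : 'I_N) : V := inl (inl (Some (inl i))) in
  let x' (i : 'I_N) : V := inl (inl (Some (inr i))) in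
  let y (i : 'I_N) : V := inl (inr i) in
  let z (i : 'I_N) : V := inr i in
  FEx (FEx
    (FAnd (FAnd (fren (P (N ^ 2)) (sumf x y))
                (fren phi_form (oapp (sumf y z) l)))
          (fren (P (N ^ 2)) (sumf z x')))).

Definition Rhat_step (i : nat) : fml (kvar N) :=
  FAnd (FEq (TVar None) (TCst (Posz i))) (fren (P i) Some).

Definition Rhat_tail : fml (kvar N) :=
  let V := (kvar N + 'I_1)%type in
  let k : V := inl None in
  let l : V := inr ord0 in
  let x (u : dvar N) : V := inl (Some u) in
  FEx (FAnd (FLe (TCst 1) (TVar l))
      (FAnd (FEq (TVar k) (TAdd (TCst (Posz (2 * N ^ 2))) (TVar l)))
            (fren psi_form (oapp x l)))).

Definition Rhat : fml (kvar N) :=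
  foldr (fun i f => FOr (Rhat_step i) f) Rhat_tail (iota 1 (2 * N ^ 2)).

End Construction.

(** * Encodings as sequences of integers *)

Definition dvar_code N (u : dvar N) : nat :=
  sumf (fun i : 'I_N => val i) (fun i : 'I_N => N + i) u.

Definition enc_dbc N (R : dbc N) : seq int :=
  [:: Posz N, Posz (size R) &
    flatten [seq [:: Posz (dvar_code a.1.1); Posz (dvar_code a.1.2); a.2] | a <- R]].

Fixpoint enc_term V (g : V -> nat) (t : lterm V) : seq int :=
  match t with
  | TVar v => [:: 0%Z; Posz (g v)]
  | TCst c => [:: 1%Z; c]
  | TAdd t u => 2%Z :: enc_term g t ++ enc_term g u
  | TMul c t => [:: 3%Z, c & enc_term g t]
  end.

(* Prefix notation; [g] numbers the variables in scope, with numbers below [d].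
   A block of [n] quantifiers is written as [n] quantifier tokens and binds
   the variables numbered d, ..., d + n - 1. *)
Fixpoint enc_form V (d : nat) (g : V -> nat) (f : fml V) : seq int :=
  match f with
  | FLe t u => 4%Z :: enc_term g t ++ enc_term g u
  | FAnd f h => 5%Z :: enc_form d g f ++ enc_form d g h
  | FOr f h => 6%Z :: enc_form d g f ++ enc_form d g h
  | FNot f => 7%Z :: enc_form d g f
  | FEx n f => nseq n 8%Z ++ enc_form (d + n) (sumf g (fun i => d + val i)) f
  | FAll n f => nseq n 9%Z ++ enc_form (d + n) (sumf g (fun i => d + val i)) f
  end.

Definition enc_kform N (f : fml (kvar N)) : seq int :=
  enc_form (2 * N).+1 (oapp (fun u => (dvar_code u).+1) 0) f.

(* Sign bit and binary digits of the absolute value. *)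
Definition bits (z : int) : nat := (trunc_log 2 `|z|%N).+2.

(* The summand [N] accounts for the declaration of the variables x_1, ..., x_N,
   some of which may have no occurrence in the atoms of R. *)
Definition bin_size N (R : dbc N) : nat := N + \sum_(z <- enc_dbc R) bits z.

(** * Polynomial time

    Structured programs over a random access machine with an input tape and an
    output tape, under the logarithmic cost criterion: memory cells hold
    arbitrary integers, and every operation is charged the bit lengths of the
    addresses and values that it handles. *)

Inductive expr : Type :=
| ECst of int
| EMem of expr
| EAdd of expr & expr
| ESub of expr & expr
| EMul of expr & expr.

Inductive cmd : Type :=
| CSkip
| CAssign of expr & expr
| CRead of expr
| CWrite of expr
| CSeq of cmd & cmd
| CIf of expr & cmd & cmd
| CWhile of expr & cmd.

Record state : Type :=
  State { st_mem : int -> int; st_inp : seq int; st_out : seq int }.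

Fixpoint eval (m : int -> int) (e : expr) : int :=
  match e with
  | ECst c => c
  | EMem e => m (eval m e)
  | EAdd e f => (eval m e + eval m f)%R
  | ESub e f => (eval m e - eval m f)%R
  | EMul e f => (eval m e * eval m f)%R
  end.

Fixpoint cost (m : int -> int) (e : expr) : nat :=
  bits (eval m e) +
  match e with
  | ECst _ => 0
  | EMem e => cost m e
  | EAdd e f | ESub e f | EMul e f => cost m e + cost m f
  end.

Definition upd (m : int -> int) (a v : int) : int -> int :=
  fun b => if b == a then v else m b.

(* [exec p s t s']: started in [s], the program [p] halts in [s'] after time
   [t]. [CAssign a e] writes the value of [e] at address [a]; tests succeed on
   positive values; reading past the end of the input yields 0. *)
Inductive exec : cmd -> state -> nat -> state -> Prop :=
| ExSkip s : exec CSkip s 1 s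
| ExAssign a e s :
    exec (CAssign a e) s (1 + cost (st_mem s) a + cost (st_mem s) e)
      (State (upd (st_mem s) (eval (st_mem s) a) (eval (st_mem s) e))
             (st_inp s) (st_out s))
| ExRead a s :
    exec (CRead a) s (1 + cost (st_mem s) a + bits (head 0%Z (st_inp s)))
      (State (upd (st_mem s) (eval (st_mem s) a) (head 0%Z (st_inp s)))
             (behead (st_inp s)) (st_out s))
| ExWrite e s :
    exec (CWrite e) s (1 + cost (st_mem s) e)
      (State (st_mem s) (st_inp s) (rcons (st_out s) (eval (st_mem s) e)))
| ExSeq p q s t s' t' s'' :
    exec p s t s' -> exec q s' t' s'' -> exec (CSeq p q) s (1 + t + t') s''
| ExIfTrue e p q s t s' :
    (0 < eval (st_mem s) e)%R -> exec p s t s' ->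
    exec (CIf e p q) s (1 + cost (st_mem s) e + t) s'
| ExIfFalse e p q s t s' :
    (eval (st_mem s) e <= 0)%R -> exec q s t s' ->
    exec (CIf e p q) s (1 + cost (st_mem s) e + t) s'
| ExWhileTrue e p s t s' t' s'' :
    (0 < eval (st_mem s) e)%R -> exec p s t s' -> exec (CWhile e p) s' t' s'' ->
    exec (CWhile e p) s (1 + cost (st_mem s) e + t + t') s''
| ExWhileFalse e p s :
    (eval (st_mem s) e <= 0)%R ->
    exec (CWhile e p) s (1 + cost (st_mem s) e) s.

(* The formula [F N R] is computable from the balanced constraint [R] in time
   polynomial in the binary size of [R], uniformly in [N]. *)
Definition polytime (F : forall N, dbc N -> fml (kvar N)) : Prop :=
  exists (p : cmd) (c d : nat),
  forall (N : nat) (R : dbc N), balanced R ->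
  exists (t : nat) (s : state),
    [/\ exec p (State (fun=> 0%Z) (enc_dbc R) [::]) t s,
        st_out s = enc_kform (F N R) &
        t <= c * (bin_size R ^ d + 1)].

(* Main.v *)
(* Read an atom u - v <= c as an edge of weight c. By balancedness the unfolding
   of R^n is the part of a graph invariant under translation that lies in the
   layers 0, ..., n. Consider a path that leaves a layer, goes forward more than
   N^2 layers, and comes back. At two of the layers that it crosses, the pair of
   its crossing points is the same. Cutting out the part between these layers
   gives a shallower path; if that makes the path heavier, then repeating the
   part makes it lighter, and it can be prolonged to any depth. Hence excursions
   of depth N^2, which R_s sees, and paths that cross the whole unfolding, which
   the powers of R_fw and R_bw see, account for all the constraints of R^n. A
   solution between y and z is then built layer by layer.

   No weight has to be computed for the second part. The least c for which R_s
   implies x_i - x'_j <= c, if there is one, is attained by a solution of R_s, so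
   R_fw(x, x') states that for all i and j some solution (y, y') of R_s has
   x_i - x'_j <= y_i - y'_j. A walk of length l can be replaced by one that is no
   heavier and iterates a single cycle of length at most N, with a prefix and a
   suffix shorter than N^2. The weight of b rounds of a cycle is bounded through R with its constants multiplied by the variable b;
   this is linear in b, and faithful because rounding up maps the solutions of
   the multiplied constraint to solutions of R. The resulting existential formula
   consists of nested conjunctions over the indices and the atoms of R, which
   nested loops print directly. *)

Require Import Defs.
From mathcomp Require Import all_boot all_order all_algebra zify.
From Stdlib Require Import Classical FunctionalExtensionality.

Set Implicit Arguments.
Unset Strict Implicit.
Unset Printing Implicit Defensive.

Import Order.TTheory GRing.Theory Num.Theory.

(** * Weighted relations *)

(** Shortest weights would live in the integers with two infinities: a bound may be absent, and an
    unsatisfiable [R] makes weights unbounded below. A path relation is therefore kept as the set of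
    the bounds it supports, and a least weight is formed only where a valuation, or a solution of
    [R_s], bounds the set from below. The deformation of excursions is asymmetric. Ahead of a layer,
    a path that cannot stay shallow only has to be pushed as far as [z]. Behind [z] it may overshoot
    [y], and beyond [y] only N^2 layers are guaranteed. This suffices because N^2, the number of
    pairs of crossing points, also bounds the depth of the repeated part, hence the overshoot. In
    the closed forms no optimal cycle has to be recognised. Every shape of a lasso (cycle length,
    base point, lengths of prefix and suffix) yields a consequence of the power, so the formula
    lists all shapes; the existence of a good one is used only to show that the conjunction is
    strong enough. *)

Lemma int_set_min (S : int -> Prop) (m : int) :
  (exists a, S a) -> (forall a, S a -> (m <= a)%R) ->
  exists2 a, S a & forall b, S b -> (a <= b)%R.
Proof.
move=> [a Sa] Sm.
have [n le_n] : exists n : nat, (a <= m + Posz n)%R by exists `|a - m|%N; lia.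
elim: n a Sa le_n => [|n IHn] a Sa le_n.
  by exists a => // b /Sm; lia.
case: (classic (exists2 b, S b & (b < a)%R)) => [[b Sb lt_ba]|no_b].
  by apply: (IHn b) => //; lia.
exists a => // b Sb; case: (lerP a b) => // lt_ba.
by case: no_b; exists b.
Qed.

Lemma nat_pigeonhole (T : finType) (n : nat) (f : nat -> T) : #|T| <= n ->
  exists a b, [/\ a < b, b <= n & f a = f b].
Proof.
move=> leTn.
have: ~~ injectiveb (fun i : 'I_n.+1 => f i).
  apply/injectiveP => /leq_card; rewrite card_ord; lia.
case/injectivePn => i [j neq_ij eq_f].
have [lt_ij|lt_ji|/val_inj eq_ij] := ltngtP i j; last by rewrite eq_ij eqxx in neq_ij.
- by exists i, j; split=> //; rewrite -ltnS.
- by exists j, i; split=> //; rewrite -ltnS.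
Qed.

Section WeightedRelations.

Local Open Scope ring_scope.

Variable T : finType.

(* [X i j w] reads: there is an X-path from i to j of weight at most w. *)
Definition wrel := T -> T -> int -> Prop.

Implicit Types X Y Z A B C : wrel.

Definition wsub X Y := forall i j w, X i j w -> Y i j w.

Definition upc X := forall i j w w', X i j w -> w <= w' -> X i j w'.

Definition wid : wrel := fun i j w => i = j /\ 0 <= w.

Definition wcomp X Y : wrel := fun i j w =>
  exists k a b, [/\ X i k a, Y k j b & a + b <= w].

Definition wor X Y : wrel := fun i j w => X i j w \/ Y i j w.

Fixpoint wpow X n : wrel := if n is m.+1 then wcomp X (wpow X m) else wid.

Definition wstar X : wrel := fun i j w => exists n, wpow X n i j w.

(** Descend [n] levels by [A], move there by [C], come back by [B]. The nested form, rather than a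
    product of three powers, keeps the two crossing points of each level together for the pigeonhole
    argument. *)
Fixpoint nest A B C n : wrel :=
  if n is m.+1 then wcomp A (wcomp (nest A B C m) B) else C.

Definition bnd X (u v : T -> int) := forall i j w, X i j w -> u i <= w + v j.

Definition wbelow X := exists m, forall i j w, X i j w -> m <= w.

Lemma upc_comp X Y : upc (wcomp X Y).
Proof. by move=> i j w w' [k [a [b [? ? ?]]]] ?; exists k, a, b; split=> //; lia. Qed.

Lemma upc_pow X n : upc (wpow X n).
Proof. by case: n => [|n]; [move=> i j w w' [-> ?] ?; split=> //; lia|apply: upc_comp]. Qed.

Lemma upc_star X : upc (wstar X).
Proof. by move=> i j w w' [n] /upc_pow H /H; exists n. Qed.

Lemma upc_nest A B C n : upc C -> upc (nest A B C n).
Proof. by case: n => //= n _; apply: upc_comp. Qed.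

Lemma wcompI X Y i j k a b : X i k a -> Y k j b -> wcomp X Y i j (a + b).
Proof. by exists k, a, b. Qed.

Lemma wcompS X X' Y Y' : wsub X X' -> wsub Y Y' -> wsub (wcomp X Y) (wcomp X' Y').
Proof.
by move=> sX sY i j w [k [a [b [/sX ? /sY ? ?]]]]; exists k, a, b.
Qed.

Lemma wcompAr X Y Z : wsub (wcomp (wcomp X Y) Z) (wcomp X (wcomp Y Z)).
Proof.
move=> i j w [k [a [b [[l [c [d [Xc Yd le_a]]]] Zb le_w]]]].
by exists l, c, (d + b); split=> //; [apply: wcompI Yd Zb|lia].
Qed.

Lemma wpow_add X m n i j k a b w :
  wpow X m i k a -> wpow X n k j b -> a + b <= w -> wpow X (m + n) i j w.
Proof.
elim: m i a w => [|m IHm] i a w /=.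
  by move=> [-> a0] Xb ?; apply: upc_pow Xb _; lia.
move=> [l [c [d [Xc Xd le_a]]]] Xb le_w.
exists l, c, (w - c); split=> //; last by lia.
by apply: IHm Xd Xb _; lia.
Qed.

Lemma wpow_split X m n i j w : wpow X (m + n) i j w ->
  exists k a b, [/\ wpow X m i k a, wpow X n k j b & a + b <= w].
Proof.
elim: m i w => [|m IHm] i w /=.
  by move=> Xw; exists i, 0, w; split=> //; lia.
move=> [l [c [d [Xc /IHm[k [a [b [Xa Xb le_d]]]] le_w]]]].
by exists k, (c + a), b; split=> //; [apply: wcompI Xc Xa|lia].
Qed.

Lemma wpow1 X i j w : X i j w -> wpow X 1 i j w.
Proof. by move=> Xw; exists j, w, 0; split=> //; lia. Qed.

Lemma wpow_mono X Y n : wsub X Y -> wsub (wpow X n) (wpow Y n).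
Proof. by move=> sXY; elim: n => //= n IHn; apply: wcompS. Qed.

Lemma wpow_rcons X n : wsub (wcomp (wpow X n) X) (wpow X n.+1).
Proof.
move=> i j w [k [a [b [Xa /wpow1 Xb le_w]]]].
by rewrite -addn1; apply: wpow_add Xa Xb _.
Qed.

Lemma wpow_unrcons X n : wsub (wpow X n.+1) (wcomp (wpow X n) X).
Proof.
move=> i j w; rewrite -addn1 => /wpow_split[k [a [b [Xa [l [c [d [Xc [<- ?] ?]]]] ?]]]].
by exists k, a, c; split=> //; lia.
Qed.

Lemma wstar_refl X i w : 0 <= w -> wstar X i i w.
Proof. by exists 0%N. Qed.

Lemma wstar1 X : wsub X (wstar X).
Proof. by move=> i j w /wpow1; exists 1%N. Qed.

Lemma wstar_trans X : wsub (wcomp (wstar X) (wstar X)) (wstar X).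
Proof.
move=> i j w [k [a [b [[m Xm] [n Xn] le_w]]]].
by exists (m + n)%N; apply: wpow_add Xm Xn _.
Qed.

Lemma wstar_mono X Y : wsub X Y -> wsub (wstar X) (wstar Y).
Proof. by move=> sXY i j w [n /(wpow_mono sXY) Yn]; exists n. Qed.

(** Applied with [X] and [Y] the excursions of two consecutive depths, this isolates the step of a
    walk that really uses the greater depth. *)
Lemma wstar_split X Y i j w : wstar X i j w ->
  wstar Y i j w \/ exists i' j' a b c,
    [/\ wstar X i i' a, X i' j' b, ~ Y i' j' b, wstar X j' j c & a + b + c <= w].
Proof.
move=> [n]; elim: n i w => [|n IHn] i w /=; first by left; exists 0%N.
move=> [k [a [b [Xa Xb le_w]]]].
case: (classic (Y i k a)) => [Ya|nYa]; last first.
  right; exists i, k, 0, a, b; split=> //; [exact: wstar_refl|by exists n|lia].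
case: (IHn _ _ Xb) => [Yb|[i' [j' [a' [b' [c' [Xa' Xb' nYb' Xc' le_b]]]]]]].
  left; apply: wstar_trans; exists k, a, b; split=> //; exact: wstar1.
right; exists i', j', (a + a'), b', c'; split=> //; last by lia.
by apply: wstar_trans; exists k, a, a'; split=> //; apply: wstar1.
Qed.

Lemma bnd_sub X Y u v : wsub X Y -> bnd Y u v -> bnd X u v.
Proof. by move=> sXY bY i j w /sXY /bY. Qed.

Lemma bnd_id u : bnd wid u u.
Proof. by move=> i j w [-> ?]; lia. Qed.

Lemma bnd_comp X Y u v s : bnd X u v -> bnd Y v s -> bnd (wcomp X Y) u s.
Proof.
by move=> bX bY i j w [k [a [b [/bX ? /bY ? ?]]]]; lia.
Qed.

Lemma bnd_or X Y u v : bnd X u v -> bnd Y u v -> bnd (wor X Y) u v.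
Proof. by move=> bX bY i j w [/bX|/bY]. Qed.

Lemma bnd_pow X u n : bnd X u u -> bnd (wpow X n) u u.
Proof. by move=> bX; elim: n => [|n IHn]; [apply: bnd_id|apply: bnd_comp IHn]. Qed.

Lemma bnd_star X u : bnd X u u -> bnd (wstar X) u u.
Proof. by move=> bX i j w [n]; apply: bnd_pow. Qed.

Lemma nest_split A B C m n i j w : upc C -> nest A B C (m + n) i j w ->
  exists i' j' a b c,
    [/\ wpow A m i i' a, nest A B C n i' j' b, wpow B m j' j c & a + b + c <= w].
Proof.
move=> upC; elim: m i j w => [|m IHm] i j w /=.
  by move=> Nw; exists i, j, 0, w, 0; split=> //; lia.
move=> [k [a [b [Aa [l [c [d [Nc Bd le_b]]]] le_w]]]].
have [i' [j' [a' [b' [c' [Aa' Nb' Bc' le_c]]]]]] := IHm _ _ _ Nc.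
exists i', j', (a + a'), b', (c' + d); split=> //; last by lia.
- exact: wcompI Aa Aa'.
- by apply: wpow_rcons; apply: wcompI Bc' Bd.
Qed.

Lemma nest_join A B C n i i' j' j a b c :
  wpow A n i i' a -> C i' j' b -> wpow B n j' j c -> upc C ->
  nest A B C n i j (a + b + c).
Proof.
move=> + + + upC; elim: n i j a b c => [|n IHn] i j a b c /=.
  by move=> [-> ?] Cb [<- ?]; apply: upC Cb _; lia.
move=> [k [a1 [a2 [Aa1 Aa2 le_a]]]] Cb /(@wpow_unrcons B n)[l [c1 [c3 [Bc1 Bc3 le_c]]]].
exists k, a1, (a2 + b + c1 + c3); split=> //; last by lia.
by apply: wcompI Bc3; apply: IHn.
Qed.

Lemma ler_norm_sum (u : T -> int) k : `|u k| <= \sum_i `|u i|.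
Proof. by rewrite (bigD1 k) //= lerDl sumr_ge0. Qed.

Lemma wbelow_bnd X u : bnd X u u -> wbelow X.
Proof.
move=> bX; exists (- \sum_i `|u i| - \sum_i `|u i|) => i j w /bX.
by move: (ler_norm_sum u i) (ler_norm_sum u j); lia.
Qed.

Lemma wbelow_comp X Y : wbelow X -> wbelow Y -> wbelow (wcomp X Y).
Proof.
move=> [m bX] [n bY]; exists (m + n) => i j w [k [a [b [/bX ? /bY ? ?]]]]; lia.
Qed.

Lemma wbelow_pow X n : wbelow X -> wbelow (wpow X n).
Proof.
move=> bX; elim: n => [|n IHn]; last exact: wbelow_comp.
by exists 0 => i j w [].
Qed.

(* The constant [M] stands in for an upper bound where [Q] gives none. *)
Lemma wsolve X (y : T -> int) (P Q : T -> int -> Prop) (p q : int) :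
  (forall i w, 0 <= w -> X i i w) -> wsub (wcomp X X) X -> bnd X y y ->
  (forall i a, P i a -> a <= p) -> (forall i a, Q i a -> q <= a) ->
  (forall i j a w b, P i a -> X i j w -> Q j b -> a <= w + b) ->
  exists v : {ffun T -> int}, [/\ bnd X v v,
    forall i a, P i a -> a <= v i & forall i a, Q i a -> v i <= a].
Proof.
move=> X_refl X_trans bX Pp Qq PXQ.
have [m Xm] := wbelow_bnd bX.
pose M := `|p| + `|m|.
(* The shortest-path potential: it is the greatest valuation respecting [X], the upper bounds and
   [M], so a lower bound can fail only along a path from [P] to [Q]. *)
pose S i a := exists j w b, [/\ X i j w, Q j b \/ b = M & a = w + b].
have /fin_all_exists[v v_min] i : exists a, S i a /\ forall b, S i b -> a <= b.
  have [||a Sa min_a] := @int_set_min (S i) (m - `|q| - M).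
  - by exists M, i, 0, M; split; [exact: X_refl|right|lia].
  - by move=> _ [j [w [b [/Xm ? [/Qq ?|->] ->]]]]; lia.
  by exists a.
exists [ffun i => v i]; split=> [i j w Xw|i a Pa|i a Qa]; rewrite ?ffunE.
- have [[k [w' [b [Xw' Qb ->]]]] _] := v_min j.
  have [_ ->] // := v_min i; exists k, (w + w'), b; split=> //; last by lia.
  by apply: X_trans; apply: wcompI Xw Xw'.
- have [[k [w' [b [Xw' [Qb|->] ->]]]] _] := v_min i; first exact: PXQ Pa Xw' Qb.
  by move: (Pp _ _ Pa) (Xm _ _ _ Xw'); lia.
- have [_ ->] // := v_min i; exists i, 0, a; split; [exact: X_refl|by left|lia].
Qed.

(* There are |T|^2 pairs of endpoints, so one of them recurs within the first
   |T|^2 levels of a nest. *)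
Lemma nest_repeat A B (S : nat -> wrel) h i j w :
  (forall n i j w, S n.+1 i j w -> exists i1 j1 f g w1,
     [/\ A i i1 f, B j1 j g, S n i1 j1 w1 & f + w1 + g <= w]) ->
  S h i j w -> (#|T| ^ 2 <= h)%N ->
  exists (s : nat -> T * T) (ww : nat -> int) (a b : nat),
    [/\ s 0%N = (i, j), ww 0%N = w,
        (a < b <= #|T| ^ 2)%N /\ s a = s b,
        forall t, (t <= h)%N -> S (h - t)%N (s t).1 (s t).2 (ww t) &
        forall t, (t < h)%N -> exists f g, [/\ A (s t).1 (s t.+1).1 f,
          B (s t.+1).2 (s t).2 g & f + ww t.+1 + g <= ww t]].
Proof.
move=> S_step Sw le_h.
have [s [ww [s0 ww0 Ss links]]] : exists (s : nat -> T * T) (ww : nat -> int),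
  [/\ s 0%N = (i, j), ww 0%N = w,
      forall t, (t <= h)%N -> S (h - t)%N (s t).1 (s t).2 (ww t) &
      forall t, (t < h)%N -> exists f g, [/\ A (s t).1 (s t.+1).1 f,
        B (s t.+1).2 (s t).2 g & f + ww t.+1 + g <= ww t]].
  elim: h i j w Sw {le_h} => [|h IHh] i j w Sw.
    by exists (fun=> (i, j)), (fun=> w); split=> // -[].
  have [i1 [j1 [f [g [w1 [Af Bg /IHh[s [ww [s0 ww0 Ss links]]] le_w]]]]]] := S_step _ _ _ _ Sw.
  exists (fun t => if t is t'.+1 then s t' else (i, j)).
  exists (fun t => if t is t'.+1 then ww t' else w); split=> //.
    by case=> [|t] //= le_t; rewrite subSS; apply: Ss.
  case=> [|t] /= lt_t; last exact: links.
  by exists f, g; rewrite s0 ww0.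
have [a [b [lt_ab le_b eq_ab]]] : exists a b, [/\ (a < b)%N, (b <= #|T| ^ 2)%N & s a = s b].
  by apply: nat_pigeonhole; rewrite card_prod mulnn.
by exists s, ww, a, b; split; rewrite // lt_ab.
Qed.

End WeightedRelations.

(** * Excursions in the unfolding of a balanced constraint *)

Lemma rpow_add N (R : vrel N) m n x x' :
  rpow R (m + n) x x' <-> exists y, rpow R m x y /\ rpow R n y x'.
Proof.
elim: m x => [|m IHm] x /=.
  by split=> [Rx|[y [-> //]]]; exists x.
split=> [[y [Rxy /IHm[z [Ryz Rz]]]]|[z [[y [Rxy Ryz]] Rz]]].
  by exists z; split=> //; exists y.
by exists y; split=> //; apply/IHm; exists z.
Qed.

Lemma rpowSr N (R : vrel N) n x x' :
  rpow R n.+1 x x' <-> exists y, rpow R n x y /\ R y x'.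
Proof.
rewrite -addn1 rpow_add /=; split=> [[y [Ry [z [Ryz <-]]]]|[y [Ry Ryx']]].
  by exists y.
by exists y; split=> //; exists x'.
Qed.

Section Balanced.

Local Open Scope ring_scope.

Variables (N : nat) (R : dbc N).

Definition intra : wrel 'I_N := fun i j w => exists2 c, (inl i, inl j, c) \in R & c <= w.
Definition fwd : wrel 'I_N := fun i j w => exists2 c, (inl i, inr j, c) \in R & c <= w.
Definition bwd : wrel 'I_N := fun i j w => exists2 c, (inr i, inl j, c) \in R & c <= w.

Hypothesis balR : balanced R.

Lemma dbrelE (x x' : vec N) : dbrel R x x' <->
  [/\ bnd intra x x, bnd intra x' x', bnd fwd x x' & bnd bwd x' x].
Proof.
split=> [Rxx'|[Lx Lx' Fx Bx] [i|i] [j|j] c Rc /=].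
  split=> i j w [c Rc le_c]; last 1 first.
  - by have /= := Rxx' _ _ _ Rc; lia.
  - by have /= := Rxx' _ _ _ Rc; lia.
  - by move/balR: Rc => /Rxx' /=; lia.
  - by have /= := Rxx' _ _ _ Rc; lia.
- by have /Lx : intra i j c by [exists c]; lia.
- have /Fx : fwd i j c by [exists c]; lia.
- by have /Bx : bwd i j c by [exists c]; lia.
- by have /Lx' : intra i j c by [exists c => //; apply/balR]; lia.
Qed.

Lemma dbc_below : exists m, forall a, a \in R -> m <= a.2.
Proof.
elim: R => [|a s [m IHs]]; first by exists 0.
exists (Num.min a.2 m) => b; rewrite inE ge_min => /predU1P[->|/IHs ->].
  by rewrite lexx.
by rewrite orbT.
Qed.

Lemma fwd_below : wbelow fwd.
Proof. by have [m Rm] := dbc_below; exists m => i j w [c /Rm /=]; lia. Qed.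

Lemma bwd_below : wbelow bwd.
Proof. by have [m Rm] := dbc_below; exists m => i j w [c /Rm /=]; lia. Qed.

(* [exc h] bounds the paths that leave a layer of the unfolding of R, enter at
   most the h layers after it, and come back to it. By balancedness the atoms
   within a layer do not depend on the layer. *)
Fixpoint exc_gen h : wrel 'I_N :=
  if h is h'.+1 then wor intra (wcomp fwd (wcomp (wstar (exc_gen h')) bwd)) else intra.

Definition exc h := wstar (exc_gen h).

Lemma exc_gen_mono h h' : (h <= h')%N -> wsub (exc_gen h) (exc_gen h').
Proof.
elim: h' h => [|h' IHh'] [|h] //= le_h i j w //; first by left.
case=> [Lw|]; first by left.
move=> H; right; apply: wcompS H => //; apply: wcompS => //.
exact/wstar_mono/IHh'.
Qed.

(** From [x] there are [h] further layers, on which an excursion of depth [h] is a chain of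
    satisfied atoms. For [h] = 0 the power says nothing about [x], whence the separate hypothesis on
    its own layer. *)
Lemma exc_sound h (x x' : vec N) :
  bnd intra x x -> rpow (dbrel R) h x x' -> bnd (exc h) x x.
Proof.
elim: h x => [|h IHh] x Lx /=; first by move=> _; apply: bnd_star.
move=> [y [/dbrelE[_ Ly Fx By] /(IHh _ Ly) Ey]]; apply: bnd_star.
by apply: bnd_or => //; apply: bnd_comp Fx _; apply: bnd_comp By.
Qed.

Let K := (N ^ 2)%N.
Let E := exc K.
(** One crossing to the next layer, or back for [Gs], with excursions of depth at most [K] at both
    ends. *)
Let Fs := wcomp E (wcomp fwd E).
Let Gs := wcomp E (wcomp bwd E).

Lemma exc_refl i w : 0 <= w -> E i i w.
Proof. exact: wstar_refl. Qed.

Lemma exc_up : upc E.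
Proof. exact: upc_star. Qed.

(* [irr h i j]: a path from i to j that needs all of the next h + 1 layers. *)
Let irr h : wrel 'I_N := fun i j w =>
  wcomp fwd (wcomp (exc h) bwd) i j w /\ ~ exc_gen h i j w.

(** If every step of the inner walk had depth [h], the whole path would be shallower than required;
    [wstar_split] finds a step that is not so shallow. The bound on [h] keeps the remaining pieces
    inside [E]. *)
Lemma irr_step h i j w : (h < K)%N -> irr h.+1 i j w -> exists i1 j1 f g w1,
  [/\ wcomp fwd E i i1 f, wcomp E bwd j1 j g, irr h i1 j1 w1 & f + w1 + g <= w].
Proof.
move=> lt_h [[k [a [b [Fa [l [c [d [Ec Bd le_b]]]] le_w]]]] irr_w].
case: (wstar_split (exc_gen h) Ec) => [Ec'|].
  case: irr_w; right; exists k, a, b; split=> //.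
  by exists l, c, d.
move=> [i1 [j1 [c1 [c2 [c3 [Ec1 Xc2 nXc2 Ec3 le_c]]]]]].
have sE : wsub (exc h.+1) E by exact/wstar_mono/exc_gen_mono.
exists i1, j1, (a + c1), (c3 + d), c2; split; last by lia.
- exact: wcompI Fa (sE _ _ _ Ec1).
- exact: wcompI (sE _ _ _ Ec3) Bd.
- split=> //; case: Xc2 => // Lc2; case: nXc2.
  exact: (@exc_gen_mono 0).
Qed.

(* An excursion that is not already a shallow one can be deformed, without
   increasing its weight, into one of any prescribed depth: repeating the loop
   between two occurrences of a pair in [nest_repeat] cannot increase the
   weight, for otherwise cutting it out would give a shallow excursion. *)
Lemma exc_pump d i j w :
  wcomp fwd (wcomp E bwd) i j w -> E i j w \/ nest Fs Gs E d.+1 i j w.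
Proof.
move=> Xw; case: (classic (exc_gen K i j w)) => [Ew|irr_w]; first by left; apply: wstar1.
(* [nest_repeat] asks for a descent at every level while [irr_step] gives it only below [K], so the
   family is made empty above. *)
right; pose S h := if (h <= K)%N then irr h else fun _ _ _ => False.
have [|||s [ww [a [b [s0 ww0 [/andP[lt_ab le_b] eq_s] Ss links]]]]] :=
    @nest_repeat _ (wcomp fwd E) (wcomp E bwd) S K i j w.
- move=> n i1 j1 w1; rewrite /S; case: leqP => // lt_n /(irr_step lt_n).
  by rewrite ltnW.
- by rewrite /S leqnn.
- by rewrite card_ord.
rewrite card_ord in le_b.
have {}Ss t : (t <= K)%N -> irr (K - t)%N (s t).1 (s t).2 (ww t).
  by move=> le_t; move: (Ss t le_t); rewrite /S leq_subr.
have lt_ww : ww a < ww b.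
  rewrite ltNge; apply/negP => le_ww.
  have [_] := Ss a (ltnW (leq_trans lt_ab le_b)); apply.
  (* The path found at [b] has depth [K - b + 1], which is at most [K - a], too shallow for the one
     at [a] to be irreducible. *)
  have [Xb _] := Ss b le_b; apply: (@exc_gen_mono (K - b).+1); first by rewrite /K in le_b *; lia.
  right; rewrite eq_s; exact: upc_comp Xb le_ww.
have wid_l X i1 j1 f : X i1 j1 f -> wcomp E X i1 j1 f.
  by exists i1, 0, f; split=> //; [exact: exc_refl|lia].
have wid_r X i1 j1 f : X i1 j1 f -> wcomp X E i1 j1 f.
  by exists j1, f, 0; split=> //; [exact: exc_refl|lia].
have sFs : wsub (wcomp fwd E) Fs by move=> i1 j1 f /wid_l.
have sGs : wsub (wcomp E bwd) Gs by move=> i1 j1 f /wid_r H; apply: wcompAr.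
suff: forall t, (t < b)%N -> nest Fs Gs E d.+1 (s t).1 (s t).2 (ww t).
  by move/(_ 0%N); rewrite s0 ww0; apply; lia.
elim: d => [|d IHd] t lt_t.
  have [] := Ss t (ltnW (leq_trans lt_t le_b)).
  move=> [k [f [c [Ff [l [e [g [Ee Gg le_c]]]] le_w]]]] _.
  exists k, f, c; split=> //; first by apply/sFs/wid_r.
  exists k, 0, c; split; [exact: exc_refl| |lia].
  apply: sGs; exists l, e, g; split=> //.
  exact: (wstar_mono (@exc_gen_mono (K - t) K (leq_subr _ _))).
have [f [g [Ff Gg le_w]]] := links t (leq_trans lt_t le_b).
exists (s t.+1).1, f, (ww t.+1 + g); split; [exact: sFs| |lia].
exists (s t.+1).2, (ww t.+1), g; split; [|exact: sGs|lia].
have [lt_t1|] := ltnP t.+1 b; first exact: IHd.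
(* At [b] the descent starts again from [a], where the same pair is joined with a smaller weight. *)
move=> le_b'; have -> : t.+1 = b by apply/eqP; rewrite eqn_leq lt_t.
rewrite -eq_s; have := IHd a lt_ab => /=; move/upc_comp; apply; lia.
Qed.

Let Fsp n := wpow Fs n.
Let Gsp n := wpow Gs n.

Lemma rpow_bnd_intra n (x x' : vec N) : (0 < n)%N -> rpow (dbrel R) n x x' ->
  bnd intra x x /\ bnd intra x' x'.
Proof.
case: n => // n _ Rn; split; last first.
  by move/rpowSr: Rn => [y [_ /dbrelE[]]].
by case: Rn => y [/dbrelE[]].
Qed.

Lemma ord_K_gt0 : 'I_N -> (0 < K)%N.
Proof. by case=> i lt_i; rewrite expn_gt0 (leq_ltn_trans _ lt_i). Qed.

Lemma exc_bnd (x x' : vec N) : rpow (dbrel R) K x x' -> bnd E x x.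
Proof.
move=> Rx i j w Ew; apply: (exc_sound _ Rx Ew).
by have [] := rpow_bnd_intra (ord_K_gt0 i) Rx.
Qed.

Lemma rpow_dom m n (x x' : vec N) : (m <= n)%N -> rpow (dbrel R) n x x' ->
  exists y, rpow (dbrel R) m x y.
Proof. by move=> /subnKC <- /rpow_add[y []]; exists y. Qed.

(** Each of the [d] layers before [z] has [K] steps ahead of it, continuing through [z], so the
    excursions [E] are satisfied on all of them. *)
Lemma nest_bnd d (u z z' : vec N) :
  rpow (dbrel R) d u z -> rpow (dbrel R) K z z' -> bnd (nest Gs Fs E d) z z.
Proof.
elim: d z z' => [|d IHd] z z' Rz Kz; first exact: exc_bnd Kz.
move/rpowSr: Rz => [y [Ry Ryz]].
have [y' Ky] : exists y', rpow (dbrel R) K y y'.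
  by apply: (@rpow_dom _ K.+1 _ z') => //; exists z.
have /dbrelE[_ _ Fy By] := Ryz.
have [Ey Ez] := (exc_bnd Ky, exc_bnd Kz).
apply: (bnd_comp (v := y)); first by apply: bnd_comp Ez _; apply: bnd_comp By _.
apply: bnd_comp (IHd _ _ Ry Ky) _.
by apply: bnd_comp Ey _; apply: bnd_comp Fy _.
Qed.

(** * Rebuilding the layers between two given ones *)

Section Between.

Variables (l : nat) (y z : vec N).
Hypotheses (y_dom : exists y', rpow (dbrel R) K y y') (y_ran : exists y', rpow (dbrel R) K y' y).
Hypotheses (z_dom : exists z', rpow (dbrel R) K z z') (z_ran : exists z', rpow (dbrel R) K z' z).
Hypotheses (Fyz : bnd (Fsp l) y z) (Gzy : bnd (Gsp l) z y).

Lemma rpow_ran m n (x x' : vec N) : (m <= n)%N -> rpow (dbrel R) n x x' ->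
  exists y, rpow (dbrel R) m y x'.
Proof. by move=> /subnK <- /rpow_add[v []]; exists v. Qed.

(* The backward counterpart of [exc_pump]; a path that has to be deformed is
   made deep enough to reach the layer of y, but not more than K layers beyond. *)
Lemma nest_bnd_between d : (d <= l)%N -> bnd (nest Gs Fs E d) z z.
Proof.
elim/ltn_ind: d => d IHd le_d.
have [z' Kz] := z_dom; have [u Ku] := z_ran.
have [le_dK|lt_Kd] := leqP d K.
  by have [v Rv] := rpow_ran le_dK Ku; apply: nest_bnd Rv Kz.
move=> i j w Nw.
have [||s [ww [a [b [s0 ww0 [/andP[lt_ab le_b] eq_s] Ss links]]]]] :=
    @nest_repeat _ Gs Fs (nest Gs Fs E) d i j w _ Nw.
- move=> n i1 j1 w1 /= [k [f [c [Gf [k' [e [g [Ne Fg ?]]]] ?]]]].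
  by exists k, k', f, g, e; split=> //; lia.
- by rewrite card_ord ltnW.
rewrite card_ord -/K in le_b.
have wrap n e t : (t + n <= b)%N ->
    nest Gs Fs E e (s (t + n)%N).1 (s (t + n)%N).2 (ww (t + n)%N) ->
    nest Gs Fs E (n + e) (s t).1 (s t).2 (ww t).
  elim: n t => [|n IHn] t; first by rewrite addn0.
  rewrite addnS -addSn => le_t /(IHn _ le_t) Ne.
  have [|f [g [Gf Fg ?]]] := links t; first by lia.
  exists (s t.+1).1, f, (ww t.+1 + g); split=> //; last by lia.
  exact: wcompI Ne Fg.
have upN n : upc (nest Gs Fs E n) by apply/upc_nest/exc_up.
(* If cutting out the loop does not increase the weight, the nest becomes shallower and the
   induction applies; otherwise the loop can be repeated at no cost. *)
have [le_ww|lt_ww] := lerP (ww b) (ww a).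
  have /wrap : nest Gs Fs E (d - b) (s (0 + a)%N).1 (s (0 + a)%N).2 (ww (0 + a)%N).
    by rewrite eq_s; apply: upN (Ss b _) le_ww; lia.
  rewrite s0 ww0 => Nw'; apply: IHd (Nw' _); lia.
have loop m : nest Gs Fs E (d - a + m * (b - a)) (s a).1 (s a).2 (ww a).
  elim: m => [|m IHm]; first by rewrite addn0; apply: Ss; lia.
  have -> : (d - a + m.+1 * (b - a) = (b - a) + (d - a + m * (b - a)))%N by lia.
  apply: wrap; first by lia.
  by rewrite subnKC ?(ltnW lt_ab) // -eq_s; apply: upN IHm (ltW lt_ww).
(* The loop is at most [K] deep, so some number of rounds brings the depth into the window of width
   [K] above [l]. *)
have [m [le_m1 le_m2]] : exists m, (l <= d + m * (b - a) <= l + K)%N /\ true.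
  have q_gt0 : (0 < b - a)%N by rewrite subn_gt0.
  exists ((l - d) %/ (b - a)).+1; split=> //.
  have := divn_eq (l - d) (b - a); have := ltn_pmod (l - d) q_gt0.
  by rewrite mulSn; lia.
have := @wrap a _ 0%N _ (loop m); rewrite add0n s0 ww0 /= => /(_ (ltnW lt_ab)).
have -> : (a + (d - a + m * (b - a)) = l + (d + m * (b - a) - l))%N by lia.
(* The outer [l] levels are bounded by [Gzy] and [Fyz]; what remains goes back from [y] by at most
   [K] layers, which [y] has behind it. *)
move/(nest_split exc_up)=> [i' [j' [f [c [g [/Gzy ? Nc /Fyz ? ?]]]]]].
have [y' Ky] := y_dom; have [v Kv] := y_ran.
have [|v' Rv] := @rpow_ran (d + m * (b - a) - l) K v y _ Kv; first by lia.
have := nest_bnd Rv Ky Nc; lia.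
Qed.

(** The new layer is tied by atoms to [v] and by powers of [Fs] and [Gs] to [z]. A solution exists
    if every path through it with ends in [v] or [z] is respected. From [v] to [v] this is
    [exc_pump], from [z] to [z] it is [nest_bnd_between], and the mixed cases are the hypotheses on
    [v] and [z]. *)
Lemma between_step d (v : vec N) : (d < l)%N ->
  bnd E v v -> bnd (Fsp d.+1) v z -> bnd (Gsp d.+1) z v ->
  exists v' : vec N, [/\ dbrel R v v', bnd E v' v', bnd (Fsp d) v' z & bnd (Gsp d) z v'].
Proof.
move=> lt_d Ev Fv Gv.
have wE : wbelow E := wbelow_bnd Ev.
have [mF wF] := fwd_below; have [mG wG] := bwd_below.
have [mFs wFs] : wbelow (Fsp d).
  by apply/wbelow_pow/wbelow_comp => //; apply: wbelow_comp => //; exists mF.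
have [mGs wGs] : wbelow (Gsp d).
  by apply/wbelow_pow/wbelow_comp => //; apply: wbelow_comp => //; exists mG.
have [M Mv] : exists M, forall k, `|v k| <= M /\ `|z k| <= M.
  exists (\sum_i `|v i| + \sum_i `|z i|) => k.
  by move: (ler_norm_sum v k) (ler_norm_sum z k); lia.
pose P i a := (exists k w, fwd k i w /\ a = v k - w) \/ (exists k w, Gsp d k i w /\ a = z k - w).
pose Q i a := (exists k w, bwd i k w /\ a = w + v k) \/ (exists k w, Fsp d i k w /\ a = w + z k).
have [|||i a|i a|i j a w b|v' [Ev' Pv' Qv']] :=
  @wsolve _ E v P Q (M + `|mF| + `|mGs|) (- M - `|mG| - `|mFs|).
- exact: exc_refl.
- exact: wstar_trans.
- exact: Ev.
- by case=> [[k [w [/wF ? ->]]]|[k [w [/wGs ? ->]]]]; have [] := Mv k; lia.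
- by case=> [[k [w [/wG ? ->]]]|[k [w [/wFs ? ->]]]]; have [] := Mv k; lia.
- have idE k : E k k 0 by apply: exc_refl.
  case=> [[k [f [Ff ->]]]|[k [f [Gf ->]]]] Ew [[k' [g [Bg ->]]]|[k' [g [Fg ->]]]].
  + case: (@exc_pump d k k' (f + (w + g))).
    (* The prescribed depth [d.+1] makes a path that cannot stay shallow turn back exactly on the
       layer of [z]. *)
    * by apply: wcompI Ff _; apply: wcompI Ew Bg.
    * by move/Ev; lia.
    * rewrite -[d.+1]addn0 => /(nest_split exc_up).
      move=> [i' [j' [a' [b' [c' [/Fv ? Eb' /Gv ? ?]]]]]].
      have [z' /exc_bnd Ez] := z_dom; have := Ez _ _ _ Eb'; lia.
  + suff /Fv : Fsp d.+1 k k' (f + w + g) by lia.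
    apply: wcompI Fg; rewrite -[f + w]add0r.
    by apply: wcompI (idE _) _; apply: wcompI Ff Ew.
  + suff /Gv : Gsp d.+1 k k' (f + (w + g)) by lia.
    apply: wpow_rcons; apply: wcompI Gf _.
    apply: wcompI Ew _; rewrite -[g]addr0; exact: wcompI Bg (idE _).
  + by have /nest_bnd_between := nest_join Gf Ew Fg exc_up => /(_ (ltnW lt_d)); lia.
have sL : wsub intra E.
  by move=> i j w Lw; apply: wstar1; apply: (@exc_gen_mono 0).
exists v'; split=> //.
- apply/dbrelE; split; try exact: bnd_sub sL _.
  + move=> i j w Fw; suff: v i - w <= v' j by rewrite lerBlDl.
    by apply: Pv'; left; exists i, w.
  + by move=> i j w Gw; apply: Qv'; left; exists j, w.
- by move=> i j w Fw; apply: Qv'; right; exists j, w.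
- move=> i j w Gw; suff: z i - w <= v' j by rewrite lerBlDl.
  by apply: Pv'; right; exists i, w.
Qed.

Lemma rpow_between : rpow (dbrel R) l y z.
Proof.
have [y' /exc_bnd Ey] := y_dom.
suff: forall d (v : vec N), (d <= l)%N -> bnd E v v -> bnd (Fsp d) v z -> bnd (Gsp d) z v ->
    rpow (dbrel R) d v z by apply.
elim=> [|d IHd] v le_d Ev Fv Gv /=.
  apply/ffunP => i.
  apply/le_anti/andP; split.
  - by have := Fv i i 0 (conj erefl (lexx 0)); rewrite add0r.
  - by have := Gv i i 0 (conj erefl (lexx 0)); rewrite add0r.
have [v' [Rv' Ev' Fv' Gv']] := between_step le_d Ev Fv Gv.
by exists v'; split=> //; apply: IHd => //; apply: ltnW.
Qed.

End Between.


Lemma Rs_bnd (y y' : vec N) : Rs (dbrel R) y y' ->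
  [/\ bnd E y y, bnd fwd y y' & bnd bwd y' y].
Proof.
by move=> [/dbrelE[_ _ Fy By] [[u /exc_bnd Ey] _]].
Qed.

(** [R_s] guarantees excursions only at the source of a step. The excursion that ends each [Fs] is
    thus charged to the following step, and the last one to [z]; this is why the induction carries
    an excursion in front. *)
Lemma Rfw_bnd l (y z : vec N) :
  bnd E z z -> rpow (Rfw (dbrel R)) l y z -> bnd (Fsp l) y z.
Proof.
move=> Ez Ry; suff H : bnd (wcomp E (Fsp l)) y z.
  by move=> i j w Fw; apply: H; exists i, 0, w; split=> //; [exact: exc_refl|lia].
elim: l y Ry => [|l IHl] y; first by move=> /= ->; apply: bnd_comp Ez (bnd_id _).
move=> [y1 [Ry /IHl IH]].
move=> i j w [k [a [b [Ea [k1 [c [d 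
  [[k2 [a2 [b2 [Ea2 [k3 [f [e [Ff Ee le_b2]]]] le_c]]]] Fd le_b]]]] le_w]]]].
have := IH _ _ _ (wcompI Ee Fd).
have : y i - y1 k3 <= a + a2 + f; last by lia.
apply: Ry => u u' /Rs_bnd[Eu Fu _].
move: (Eu _ _ _ Ea) (Eu _ _ _ Ea2) (Fu _ _ _ Ff); lia.
Qed.

(** Here it is the excursion that begins each [Gs] which is charged to the step one layer ahead, and
    the very first one to [z]. *)
Lemma Rbw_bnd l (y z : vec N) :
  bnd E y y -> bnd E z z -> rpow (Rbw (dbrel R)) l y z -> bnd (Gsp l) z y.
Proof.
move=> Ey Ez Ry; suff H : bnd (wcomp (Gsp l) E) z y.
  by move=> i j w Gw; apply: H; exists j, w, 0; split=> //; [exact: exc_refl|lia].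
elim: l y Ry {Ey} => [|l IHl] y; first by move=> /= ->; apply: bnd_comp (bnd_id _) Ez.
move=> [y1 [Ry /IHl IH]].
move=> i j w [k [a [b [/(@wpow_unrcons _ Gs l)
  [k1 [c [d [Gc [k2 [a2 [b2 [Ea2 [k3 [f [e [Gf Ee le_b2]]]] le_d]]]] le_a]]]] Eb le_w]]]].
have := IH _ _ _ (wcompI Gc Ea2).
have : y1 k2 - y j <= f + e + b; last by lia.
apply: Ry => u u' /Rs_bnd[Eu _ Bu].
move: (Eu _ _ _ Ee) (Eu _ _ _ Eb) (Bu _ _ _ Gf); lia.
Qed.

Lemma rpow_closed_core l (y z : vec N) :
  Sfw_set (dbrel R) y -> Sbw_set (dbrel R) y -> Sfw_set (dbrel R) z -> Sbw_set (dbrel R) z ->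
  rpow (Rfw (dbrel R)) l y z -> rpow (Rbw (dbrel R)) l y z -> rpow (dbrel R) l y z.
Proof.
move=> y_dom y_ran z_dom z_ran Fyz Gyz.
have [y' /exc_bnd Ey] := y_dom; have [z' /exc_bnd Ez] := z_dom.
by apply: rpow_between => //; [exact: Rfw_bnd|exact: Rbw_bnd].
Qed.

End Balanced.

(** * Decomposition of the powers beyond [2 * N ^ 2] *)

Lemma rpow_mono N (R R' : vrel N) n x x' :
  (forall u u', R u u' -> R' u u') -> rpow R n x x' -> rpow R' n x x'.
Proof.
move=> sRR'; elim: n x => //= n IHn x [y [/sRR' Rxy /IHn Ry]].
by exists y.
Qed.

(** The prefix slides along with the induction: each step of the middle part ends after at least
    [N ^ 2] steps and starts before at least [N ^ 2] steps. *)
Lemma rpow_Rs N (R : vrel N) l x y z x' :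
  rpow R (N ^ 2) x y -> rpow R l y z -> rpow R (N ^ 2) z x' -> rpow (Rs R) l y z.
Proof.
elim: l x y => // l IHl x y Rx [y1 [Ry Rl]] Rz; exists y1.
have Rx1 : rpow R (N ^ 2).+1 x y1 by apply/rpowSr; exists y.
have [x1 [Rxx1 Rx1y1]] := Rx1.
split; last exact: IHl Rx1y1 Rl Rz.
split=> //; split; last by exists x1.
have : rpow R (1 + (l + N ^ 2)) y x'.
  apply/rpow_add; exists y1; split; first by exists y1.
  by apply/rpow_add; exists z.
by rewrite addnA addnC => /rpow_add[u [Ru _]]; exists u.
Qed.

(** The right-hand side asks only for steps out of [y] and into [z]; the steps into [y] and out of
    [z] that the reconstruction uses are the prefix and the suffix themselves. *)
Lemma rpow_decompose N (R : dbc N) l x x' : balanced R ->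
  rpow (dbrel R) (2 * N ^ 2 + l) x x' <-> exists y z,
    [/\ rpow (dbrel R) (N ^ 2) x y, rpow (dbrel R) (N ^ 2) z x',
        rpow (Rfw (dbrel R)) l y z /\ rpow (Rbw (dbrel R)) l y z &
        Sfw_set (dbrel R) y /\ Sbw_set (dbrel R) z].
Proof.
move=> balR; have -> : 2 * N ^ 2 + l = N ^ 2 + (l + N ^ 2) by lia.
split=> [/rpow_add[y [Rx /rpow_add[z [Ryz Rz]]]]|[y [z [Rx Rz [Fyz Byz] [Sy Sz]]]]].
  have Rs_yz := rpow_Rs Rx Ryz Rz.
  exists y, z; split=> //; first split.
  - by apply: rpow_mono Rs_yz => u u' Ru i j c; apply.
  - by apply: rpow_mono Rs_yz => u u' Ru i j c; apply.
  - split.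
      have : rpow (dbrel R) (l + N ^ 2) y x' by apply/rpow_add; exists z.
      by apply: rpow_dom; lia.
    have : rpow (dbrel R) (N ^ 2 + l) x z by apply/rpow_add; exists y.
    by apply: rpow_ran; lia.
apply/rpow_add; exists y; split=> //; apply/rpow_add; exists z; split=> //.
by apply: rpow_closed_core => //; [exists x|exists x'].
Qed.

(** * Correctness of the constructed formula *)

Lemma teval_ren V W (r : V -> W) t e : teval (tren r t) e = teval t (e \o r).
Proof. by elim: t => //= [t -> u ->|c t ->]. Qed.

Lemma sumf_comp A B C D (h : C -> D) (f : A -> C) (g : B -> C) :
  h \o sumf f g = sumf (h \o f) (h \o g).
Proof. by apply: functional_extensionality => -[]. Qed.

Lemma sumf_lift U W n (r : U -> W) (e : W -> int) (y : 'I_n -> int) :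
  sumf e y \o sumf (inl \o r) inr = sumf (e \o r) y.
Proof. exact: sumf_comp. Qed.

Lemma sat_ren V (f : fml V) W (r : V -> W) (e : W -> int) :
  sat (fren f r) e <-> sat f (e \o r).
Proof.
elim: f W r e => {V} /= [V t u|V f IHf g IHg|V f IHf g IHg|V f IHf|V n f IHf|V n f IHf] W r e.
- by rewrite !teval_ren.
- by rewrite IHf IHg.
- by rewrite IHf IHg.
- by rewrite IHf.
- by split=> -[y] Hy; exists y; move: Hy; rewrite IHf sumf_lift.
- by split=> Hy y; move: (Hy y); rewrite IHf sumf_lift.
Qed.

Lemma sat_and V (f g : fml V) e : sat (FAnd f g) e = (sat f e /\ sat g e).
Proof. by []. Qed.

Lemma sat_foldr_or (I : eqType) V (F : I -> fml V) g (s : seq I) e :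
  sat (foldr (fun i f => FOr (F i) f) g s) e <-> (exists2 i, i \in s & sat (F i) e) \/ sat g e.
Proof.
elim: s => [|i s IHs] /=; first by split=> [|[[]|]]; [right| |].
rewrite IHs; split=> [[Fi|[[j sj Fj]|]]|[[j]|]].
- by left; exists i; rewrite ?mem_head.
- by left; exists j; rewrite // inE sj orbT.
- by right.
- by rewrite inE => /predU1P[->|sj] Fj; [left|right; left; exists j].
- by right; right.
Qed.

Section ClosedForm.

Variables (N : nat) (R : dbc N) (P : nat -> fml (dvar N)) (Ffw Fbw : fml (kvar N)).
Hypothesis balR : balanced R.
Hypothesis defP : forall n, defines (P n) (rpow (dbrel R) n).
Hypotheses (cfF : closed_form (Rfw (dbrel R)) Ffw) (cfB : closed_form (Rbw (dbrel R)) Fbw).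

Lemma sat_Sfw (x : vec N) : sat (Sfw_form P) x <-> Sfw_set (dbrel R) x.
Proof.
rewrite /Sfw_form /=; split=> -[y Hy]; exists y.
  by move: Hy; rewrite sat_ren => /defP.
by rewrite sat_ren; apply/defP.
Qed.

Lemma sat_Sbw (x : vec N) : sat (Sbw_form P) x <-> Sbw_set (dbrel R) x.
Proof.
have eq_env (y : vec N) : sumf x y \o sumf inr inl = sumf y x.
  by apply: functional_extensionality => -[].
rewrite /Sbw_form /=; split=> -[y Hy]; exists y.
  by move: Hy; rewrite sat_ren eq_env => /defP.
by rewrite sat_ren eq_env; apply/defP.
Qed.

Lemma sat_phi l (y z : vec N) : 0 < l ->
  sat (phi_form P Ffw Fbw) (kenv (Posz l) y z) <->
  (rpow (Rfw (dbrel R)) l y z /\ rpow (Rbw (dbrel R)) l y z) /\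
  (Sfw_set (dbrel R) y /\ Sbw_set (dbrel R) z).
Proof.
move=> l_gt0; rewrite -sat_Sfw -sat_Sbw -cfF // -cfB //.
by rewrite /phi_form !sat_and !sat_ren.
Qed.

Lemma sat_psi l (x x' : vec N) : 0 < l ->
  sat (psi_form P Ffw Fbw) (kenv (Posz l) x x') <-> rpow (dbrel R) (2 * N ^ 2 + l) x x'.
Proof.
move=> l_gt0; rewrite rpow_decompose // /psi_form.
set V := (kvar N + 'I_N + 'I_N)%type.
set g1 := fren _ _; set g2 := fren _ _; set g3 := fren _ _.
have sat1 (y z : vec N) : sat g1 (sumf (sumf (kenv (Posz l) x x') y) z) <-> rpow (dbrel R) (N ^ 2) x y.
  by rewrite sat_ren sumf_comp; apply: defP.
have sat2 (y z : vec N) : sat g2 (sumf (sumf (kenv (Posz l) x x') y) z) <-> 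
    sat (phi_form P Ffw Fbw) (kenv (Posz l) y z).
  rewrite sat_ren; set e1 := _ \o _; suff -> : e1 = kenv (Posz l) y z by [].
  by apply: functional_extensionality => -[[]|].
have sat3 (y z : vec N) : sat g3 (sumf (sumf (kenv (Posz l) x x') y) z) <-> rpow (dbrel R) (N ^ 2) z x'.
  by rewrite sat_ren sumf_comp; apply: defP.
move: sat1 sat2 sat3; move: g1 g2 g3 => g1 g2 g3 sat1 sat2 sat3 /=.
split=> [[y [z [[/sat1 Rx /sat2 /(sat_phi _ _ l_gt0)[Ryz S]] /sat3 Rz]]]|].
  by exists y, z.
move=> [y [z [Rx Rz Ryz S]]]; exists y, z; split; last exact/sat3.
by split; [exact/sat1|apply/sat2/sat_phi].
Qed.

Lemma closed_form_Rhat : closed_form (dbrel R) (Rhat P Ffw Fbw).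
Proof.
move=> n n_gt0 x x'; rewrite /Rhat sat_foldr_or.
have sat_step i : sat (Rhat_step P i) (kenv (Posz n) x x') <-> n = i /\ rpow (dbrel R) n x x'.
  rewrite /Rhat_step sat_and sat_ren /=.
  split=> [[[? ?] Pi]|[<- Rn]]; first have <- : n = i by lia.
    by split; [|move/defP: Pi; have <- : n = i by lia].
  by split; [|exact/defP].
have sat_tail : sat (Rhat_tail P Ffw Fbw) (kenv (Posz n) x x') <->
    2 * N ^ 2 < n /\ rpow (dbrel R) n x x'.
  rewrite /Rhat_tail; set g := fren _ _.
  have satg (y : vec 1) : sat g (sumf (kenv (Posz n) x x') y) <->
      sat (psi_form P Ffw Fbw) (kenv (y ord0) x x').
    rewrite sat_ren; set e1 := _ \o _; suff -> : e1 = kenv (y ord0) x x' by [].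
    by apply: functional_extensionality => -[[]|].
  move: satg; move: g => g satg /=; split=> [[y [y_gt0 [[le1 le2] /satg]]]|[lt_n Rn]].
    have -> : y ord0 = Posz (n - 2 * N ^ 2) by lia.
    by rewrite sat_psi ?subnKC; [split=> //| |]; lia.
  exists [ffun=> Posz (n - 2 * N ^ 2)]; rewrite satg !ffunE sat_psi ?subnKC ?(ltnW lt_n) ?subn_gt0 //.
  by split; [lia|split=> //; lia].
split=> [[[i _ /sat_step[]]|/sat_tail[]] //|Rn].
have [le_n|lt_n] := leqP n (2 * N ^ 2); last by right; apply/sat_tail.
by left; exists n; [rewrite mem_iota; lia|apply/sat_step].
Qed.

End ClosedForm.

(** * Walks iterating a single cycle *)

Section Lasso.

Local Open Scope ring_scope.

Variable T : finType.
Implicit Types X : wrel T.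

(** A power records only a bound on the weight. This recovers one sequence of vertices that serves
    all pairs of cut points at once, as pigeonhole arguments require. *)
Lemma wpow_visits X n i j w : wpow X n i j w -> exists v : nat -> T,
  forall s t, (s <= t <= n)%N -> exists a b c,
    [/\ wpow X s i (v s) a, wpow X (t - s) (v s) (v t) b,
        wpow X (n - t) (v t) j c & a + b + c <= w].
Proof.
elim: n i w => [|n IHn] i w.
  move=> Xw; exists (fun=> i) => s t le_st.
  have [-> ->] : s = 0%N /\ t = 0%N by lia.
  by exists 0, 0, w; split=> //; lia.
move=> [k [a0 [b0 [Xa0 Xb0 le_w]]]]; have [v Hv] := IHn _ _ Xb0.
exists (fun t => if t is t'.+1 then v t' else i) => -[|s] [|t] // le_st.
- exists 0, 0, w; split=> //=; last by lia.
  by exists k, a0, b0. 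
- have [|a [b [c [[eq_k a_ge0] Xb Xc ?]]]] := Hv 0%N t; first by lia.
  exists 0, (a0 + b), c; split=> //; last by lia.
  by rewrite !subn0 in Xb *; apply: wcompI Xa0 _; rewrite eq_k.
- have [|a [b [c [Xa Xb Xc ?]]]] := Hv s t; first by lia.
  exists (a0 + a), b, c; split=> //; last by lia.
  exact: wcompI Xa0 Xa.
Qed.

Definition wres (S : {set T}) X : wrel T := fun i j w => [/\ i \in S, j \in S & X i j w].

(** A cycle can be inserted only at a vertex where the walk can be split, so least means are taken
    in the relation restricted to such a set [S]. *)
Lemma wpow_support X n i j w : wpow X n i j w -> exists S : {set T},
  [/\ i \in S, wpow (wres S X) n i j w & forall k, k \in S -> exists m a b,
    [/\ (m <= n)%N, wpow (wres S X) m i k a, wpow (wres S X) (n - m) k j b & a + b <= w]].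
Proof.
elim: n i w => [|n IHn] i w.
  move=> Xw; exists [set i]; split; rewrite ?set11 // => k /set1P ->.
  by exists 0%N, 0, w; split=> //; lia.
move=> [k [a [b [Xa Xkj le_w]]]]; have [S [Sk Xb HS]] := IHn _ _ Xkj.
have sS : wsub (wres S X) (wres (i |: S) X).
  by move=> x y c [Sx Sy Xc]; split; rewrite // inE ?Sx ?Sy orbT.
have Xa' : wres (i |: S) X i k a by split; rewrite ?setU11 // inE Sk orbT.
have Xw : wpow (wres (i |: S) X) n.+1 i j w by exists k, a, b; split=> //; apply: wpow_mono Xb.
exists (i |: S); split; rewrite ?setU11 // => l /setU1P[->|/HS].
  by exists 0%N, 0, w; split=> //; lia.
move=> [m [a' [b' [le_m Xa1 Xb1 le_b]]]]; exists m.+1, (a + a'), b'; split=> //; last by lia.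
- by apply: wcompI Xa' _; apply: wpow_mono Xa1.
- exact: wpow_mono Xb1.
Qed.

Lemma wpow_below X B n i j w : (forall i j w, X i j w -> - B <= w) ->
  wpow X n i j w -> - (B *+ n) <= w.
Proof.
move=> XB; elim: n i w => [|n IHn] i w; first by move=> [_]; rewrite mulr0n oppr0.
by move=> [k [a [b [/XB ? /IHn ? ?]]]]; rewrite mulrS; lia.
Qed.

Lemma min_mean_cycle X : wbelow X ->
  (exists k p w, (0 < p <= #|T|)%N /\ wpow X p k k w) ->
  exists k p w, [/\ (0 < p <= #|T|)%N, wpow X p k k w &
    forall k' p' w', (0 < p' <= #|T|)%N -> wpow X p' k' k' w' -> w * p'%:Z <= w' * p%:Z].
Proof.
move=> [m Xm] [k0 [p0 [w0 [p0P Xw0]]]].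
(* The factorial is a common denominator of all means [w / p] with [p] at most [#|T|], which makes
   them comparable as integers. *)
pose q p := Posz (#|T|`! %/ p).
have qE p : (0 < p <= #|T|)%N -> q p * Posz p = Posz #|T|`!.
  by move=> pP; rewrite /q -PoszM divnK // dvdn_fact.
pose S a := exists k p w, [/\ (0 < p <= #|T|)%N, wpow X p k k w & a = w * q p].
have XB i j w : X i j w -> - `|m| <= w by move/Xm; lia.
have [||_ [k [p [w [pP Xw ->]]]] min_w] := @int_set_min S (- (`|m| * Posz #|T|`!)).
- by exists (w0 * q p0), k0, p0, w0.
- move=> _ [k [p [w [pP /(wpow_below XB) le_w ->]]]].
  rewrite -mulr_natr natz in le_w.
  have q_ge0 : 0 <= q p by [].
  apply: le_trans (ler_wpM2r q_ge0 le_w).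
  by rewrite -(qE p pP) [q p * _]mulrC mulrA mulNr.
exists k, p, w; split=> // k' p' w' pP' Xw'.
have := min_w (w' * q p') (ex_intro _ k' (ex_intro _ p' (ex_intro _ w' (And3 pP' Xw' erefl)))).
have p_gt0 : 0 < Posz p * Posz p' by rewrite mulr_gt0 //; lia.
rewrite -(ler_pM2r p_gt0).
have -> : w * q p * (Posz p * Posz p') = w * p'%:Z * (q p * Posz p) by lia.
have -> : w' * q p' * (Posz p * Posz p') = w' * p%:Z * (q p' * Posz p') by lia.
by rewrite !qE // ler_pM2r // ltz_nat fact_gt0.
Qed.

Section MinMean.

Variables (X : wrel T) (p : nat) (w0 : int).
Hypothesis (p_gt0 : (0 < p)%N).
Hypothesis min_w0 : forall k q w, (0 < q <= #|T|)%N -> wpow X q k k w -> w0 * q%:Z <= w * p%:Z.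

(** A long closed walk repeats a vertex; cutting there leaves a short cycle and a shorter closed
    walk, and the two inequalities add up. *)
Lemma cycle_mean n k w : wpow X n k k w -> w0 * n%:Z <= w * p%:Z.
Proof.
elim/ltn_ind: n w k => n IHn w k Xw.
have [le_n|lt_n] := leqP n #|T|.
  case: n IHn Xw le_n => [|n] _; last by move=> Xw le_n; apply: min_w0 Xw.
  by move=> [_ w_ge0] _; rewrite mulr0 mulr_ge0.
have [v Hv] := wpow_visits Xw.
have [s [t [lt_st le_t eq_v]]] := nat_pigeonhole v (leqnn #|T|).
have [|a [b [c [Xa Xb Xc le_w]]]] := Hv s t; first by lia.
rewrite eq_v in Xa Xb.
have le1 : w0 * (t - s)%:Z <= b * p%:Z by apply: min_w0 Xb; lia.
have le2 : w0 * (s + (n - t))%:Z <= (a + c) * p%:Z.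
  by apply: IHn (wpow_add Xa Xc (lexx _)); lia.
have : (a + b + c) * p%:Z <= w * p%:Z by rewrite ler_wpM2r.
have -> : (n%:Z = (t - s)%:Z + (s + (n - t))%:Z)%R by lia.
by rewrite mulrDr; lia.
Qed.

(** The part cut out is closed and its length is a multiple [p * q], so by [cycle_mean] it weighs at
    least [q] rounds of the optimal cycle, which take its place. *)
Lemma wpow_reduce n i j w : wpow X n i j w -> exists m b w',
  [/\ (m < #|T| * p)%N, n = (m + p * b)%N, wpow X m i j w' & w' + w0 * b%:Z <= w].
Proof.
elim/ltn_ind: n w => n IHn w Xw.
have [lt_n|le_n] := ltnP n (#|T| * p).
  by exists n, 0%N, w; split=> //; lia.
have [v Hv] := wpow_visits Xw.
pose f t := (v t, inord (t %% p) : 'I_p.-1.+1).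
have [|s [t [lt_st le_t [eq_v eq_mod]]]] := @nat_pigeonhole _ (#|T| * p) f.
  by rewrite card_prod card_ord prednK.
have {}eq_mod : (s = t %[mod p])%N.
  have := congr1 (@nat_of_ord _) eq_mod; rewrite !inordK ?prednK ?ltn_pmod //.
have [q def_t] : exists q, t = (s + p * q)%N.
  exists ((t - s) %/ p)%N; rewrite mulnC divnK ?subnKC ?(ltnW lt_st) //.
  by rewrite -eqn_mod_dvd ?(ltnW lt_st) //; apply/eqP.
have q_gt0 : (0 < q)%N by rewrite lt0n; apply/negP => /eqP q0; lia.
have [|a [b [c [Xa Xb Xc le_w]]]] := Hv s t; first by lia.
rewrite eq_v in Xa Xb; have le1 := cycle_mean Xb.
have le2 : w0 * q%:Z <= b.
  rewrite -(@ler_pM2r _ p%:Z) // -mulrA -PoszM mulnC.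
  by move: le1; rewrite def_t addKn.
have lt_nt : (s + (n - t) < n)%N by lia.
have [m [b' [w' [lt_m eq_n Xw' le_w']]]] := IHn _ lt_nt _ (wpow_add Xa Xc (lexx _)).
exists m, (b' + q)%N, w'; split=> //; first by lia.
by rewrite PoszD mulrDr; lia.
Qed.

End MinMean.

(* The iterated cycle is one of least mean weight among the vertices of the walk;
   the rest is shortened by pigeonhole on the pairs (vertex, position modulo the
   length of the cycle). *)
Lemma wpow_lasso X n i j w : wbelow X -> wpow X n i j w ->
  exists p k m1 m2 b w1 w0 w2, [/\ (0 < p <= #|T|)%N,
    [/\ (m1 < #|T| ^ 2)%N, (m2 < #|T| ^ 2)%N & n = (m1 + m2 + p * b)%N],
    wpow X m1 i k w1, wpow X m2 k j w2 &
    (b = 0%N \/ wpow X p k k w0) /\ w1 + w0 * b%:Z + w2 <= w].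
Proof.
move=> [m Xm] Xw; have [S [Si XSw HS]] := wpow_support Xw.
have T_gt0 : (0 < #|T|)%N by rewrite (cardD1 i).
have sX : wsub (wres S X) X by move=> x y a [].
have wS : wbelow (wres S X) by exists m => x y a [_ _ /Xm].
case: (classic (exists k p w, (0 < p <= #|T|)%N /\ wpow (wres S X) p k k w)) => [|no_cyc].
  move/(min_mean_cycle wS) => [k [p [w0 [pP Xw0 min_w0]]]].
  have [p_gt0 le_p] := andP pP.
  have Sk : k \in S by case: p Xw0 p_gt0 {pP min_w0 le_p} => // p [? [? [? [[]]]]].
  have [n1 [a [b [le_n1 Xa Xb le_w]]]] := HS k Sk.
  have [m1 [b1 [w1 [lt_m1 def_n1 Xw1 le_a]]]] := wpow_reduce p_gt0 min_w0 Xa.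
  have [m2 [b2 [w2 [lt_m2 def_n2 Xw2 le_b]]]] := wpow_reduce p_gt0 min_w0 Xb.
  have le_M : (#|T| * p <= #|T| ^ 2)%N by rewrite -mulnn leq_mul2l le_p orbT.
  exists p, k, m1, m2, (b1 + b2)%N, w1, w0, w2; split=> //.
  - by split; [apply: leq_trans le_M|apply: leq_trans le_M|lia].
  - exact: (wpow_mono sX).
  - exact: (wpow_mono sX).
  - split; first by right; apply: (wpow_mono sX).
    by rewrite PoszD mulrDr; lia.
have lt_n : (n < #|T|)%N.
  rewrite ltnNge; apply/negP => le_n; apply: no_cyc.
  have [v Hv] := wpow_visits XSw.
  have [s [t [lt_st le_t eq_v]]] := nat_pigeonhole v (leqnn #|T|).
  have [|a [b [c [_ Xb _ _]]]] := Hv s t; first by lia.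
  by exists (v s), (t - s)%N, b; rewrite {2}eq_v; split=> //; lia.
have le_sq : (#|T| <= #|T| ^ 2)%N by rewrite -mulnn leq_pmulr.
(* Without a cycle the walk is short enough to be the suffix alone; with no round, the cycle and its
   weight are arbitrary. *)
exists 1%N, i, 0%N, n, 0%N, 0, 0, w; split=> //.
- by split; lia.
- by split; [left|lia].
Qed.

End Lasso.

(** * Powers of the forward and backward relations *)

Lemma rpow_map N (R R' : vrel N) (f : vec N -> vec N) n x x' :
  (forall u u', R u u' -> R' (f u) (f u')) -> rpow R n x x' -> rpow R' n (f x) (f x').
Proof.
move=> fR; elim: n x => [|n IHn] x /=; first by move->.
by move=> [y [/fR Rxy /IHn Ry]]; exists (f y).
Qed.

Lemma rpow_rev N (R R' : vrel N) n x x' :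
  (forall u u', R u u' <-> R' u' u) -> rpow R n x x' <-> rpow R' n x' x.
Proof.
move=> revR; elim: n x x' => [|n IHn] x x'; first by split=> ->.
rewrite rpowSr /=; split=> [[y [/IHn Ry /revR Ryx']]|[y [/revR Ryx' /IHn Ry]]]; by exists y.
Qed.

Section Scale.

Local Open Scope ring_scope.

Variables (N : nat) (R : dbc N).

Definition scale (b : int) : dbc N := [seq (a.1.1, a.1.2, a.2 * b) | a <- R].

Lemma dbrel_scale b (x x' : vec N) : dbrel (scale b) x x' <->
  forall u v c, (u, v, c) \in R -> sumf x x' u - sumf x x' v <= c * b.
Proof.
split=> [H u v c Rc|H u v c /mapP[[[u' v'] c'] Rc [-> -> ->]]]; last exact: H.
by apply: H; apply/mapP; exists (u, v, c).
Qed.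

Lemma Rs_map (R1 R2 : vrel N) (f : vec N -> vec N) x x' :
  (forall u u', R1 u u' -> R2 (f u) (f u')) -> Rs R1 x x' -> Rs R2 (f x) (f x').
Proof.
move=> fR [Rx [[y Ry] [z Rz]]]; split; first exact: fR.
by split; [exists (f y)|exists (f z)]; apply: rpow_map fR _.
Qed.

Lemma sumf_ffun (f : int -> int) (x x' : vec N) u :
  sumf [ffun i => f (x i)] [ffun i => f (x' i)] u = f (sumf x x' u).
Proof. by case: u => i /=; rewrite ffunE. Qed.

Lemma Rs_scale_up b (x x' : vec N) : 0 <= b -> Rs (dbrel R) x x' ->
  Rs (dbrel (scale b)) [ffun i => x i * b] [ffun i => x' i * b].
Proof.
move=> b_ge0; apply: (@Rs_map _ _ (fun x => [ffun i => x i * b])) => u u' Ru.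
apply/dbrel_scale => v w c /Ru le_c.
by rewrite !(sumf_ffun (fun a => a * b)) -mulrBl ler_wpM2r.
Qed.

(* Rounding up preserves difference constraints whose bounds are multiples of b. *)
Lemma Rs_scale_down b s (x x' : vec N) : 0 < b -> Rs (dbrel (scale b)) x x' ->
  Rs (dbrel R) [ffun i => - ((s - x i) %/ b)%Z] [ffun i => - ((s - x' i) %/ b)%Z].
Proof.
move=> b_gt0; apply: (@Rs_map _ _ (fun x => [ffun i => - ((s - x i) %/ b)%Z])) => u u'.
move/dbrel_scale=> Ru v w c /Ru le_c.
rewrite !(sumf_ffun (fun a => - ((s - a) %/ b)%Z)).
set q := (X in _ - - X); suff : q - c <= ((s - sumf u u' v) %/ b)%Z by lia.
have le_q : q * b <= s - sumf u u' w by rewrite -lez_divRL.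
by rewrite lez_divRL // mulrBl; lia.
Qed.

Definition Abnd : wrel 'I_N := fun i j c =>
  forall y y', Rs (dbrel R) y y' -> y i - y' j <= c.

(** Rounding relative to [y' j] sends that coordinate to 0 exactly, so the rounded solution still
    shows that [(y i - y' j) / b], rounded up, is at most [c]. *)
Lemma Abnd_scale b (y y' : vec N) : 0 < b -> Rs (dbrel (scale b)) y y' ->
  forall i j c, Abnd i j c -> y i - y' j <= c * b.
Proof.
move=> b_gt0 Ry i j c /(_ _ _ (Rs_scale_down (y' j) b_gt0 Ry)).
rewrite !ffunE subrr div0z oppr0 subr0 => le_c.
have : - c <= ((y' j - y i) %/ b)%Z by lia.
by rewrite lez_divRL // mulNr; lia.
Qed.

Lemma Rfw_attained (x x' : vec N) : Rfw (dbrel R) x x' <->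
  forall i j, exists y y', Rs (dbrel R) y y' /\ x i - x' j <= y i - y' j.
Proof.
split=> [Rx i j|Rx i j c Ac]; last first.
  by have [y [y' [/Ac le_c]]] := Rx i j; lia.
apply: NNPP => no_y.
(* If no solution reached this difference, [R_s] would imply the atom whose bound is one less. *)
have : x i - x' j <= x i - x' j - 1; last by lia.
apply: Rx => y y' Ry; suff : ~ (x i - x' j <= y i - y' j) by lia.
by move=> le_y; apply: no_y; exists y, y'.
Qed.

Lemma Rfw_wpow n (x x' : vec N) : rpow (Rfw (dbrel R)) n x x' -> bnd (wpow Abnd n) x x'.
Proof.
elim: n x => [|n IHn] x /=; first by move=> ->; apply: bnd_id.
move=> [y [Rx /IHn]]; apply: bnd_comp => i j c /Rx; lia.
Qed.

Lemma Abnd_below : (exists y y', Rs (dbrel R) y y') -> wbelow Abnd.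
Proof.
move=> [y [y' Ry]].
exists (- \sum_i `|y i| - \sum_i `|y' i|) => i j c /(_ _ _ Ry).
by move: (ler_norm_sum y i) (ler_norm_sum y' j); lia.
Qed.

(** Forward atoms do not relate variables of the same layer, so the coordinates of an intermediate
    layer are chosen independently, each between its lower and upper bounds: [wsolve] with the
    trivial relation. Satisfiability of [R_s] keeps these bounds finite. *)
Lemma wpow_Rfw n (x x' : vec N) : (exists y y', Rs (dbrel R) y y') -> (0 < n)%N ->
  bnd (wpow Abnd n) x x' -> rpow (Rfw (dbrel R)) n x x'.
Proof.
move=> /Abnd_below wA; case: n => // n _.
elim: n x => [|n IHn] x Ax.
  exists x'; split=> // i j c Ac.
  by have := Ax i j c (wpow1 Ac); lia.
have [m Am] := wA; have [p Ap] := wbelow_pow n.+1 wA.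
have [M Mx] : exists M, forall k, `|x k| <= M /\ `|x' k| <= M.
  exists (\sum_i `|x i| + \sum_i `|x' i|) => k.
  by move: (ler_norm_sum x k) (ler_norm_sum x' k); lia.
pose P i a := exists k c, Abnd k i c /\ a = x k - c.
pose Q i a := exists k c, wpow Abnd n.+1 i k c /\ a = c + x' k.
have [||||||v [_ Pv Qv]] := @wsolve _ (@wid 'I_N) x P Q (M + `|m|) (- M - `|p|).
- by move=> i w.
- by move=> i j w [k [a [b [[-> ?] [-> ?] ?]]]]; split=> //; lia.
- exact: bnd_id.
- by move=> i _ [k [c [/Am ? ->]]]; have [] := Mx k; lia.
- by move=> i _ [k [c [/Ap ? ->]]]; have [] := Mx k; lia.
- move=> i _ _ w _ [k [c [Ac ->]]] [<- ?] [k' [c' [Ac' ->]]].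
  by have := Ax _ _ _ (wcompI Ac Ac'); lia.
exists v; split; last apply: IHn => i j c Ac.
  move=> i j c Ac; rewrite lerBlDr -lerBlDl.
  by apply: Pv; exists i, c.
by apply: Qv; exists j, c.
Qed.

(** A forward power bounds differences only from above, so the coordinates other than [k] can be put
    out of the way, low in [y] and high in [y']. *)
Lemma Rfw_extremal p k c : (exists y y', Rs (dbrel R) y y') -> (0 < p)%N ->
  (forall w, wpow Abnd p k k w -> c <= w) ->
  exists y y', rpow (Rfw (dbrel R)) p y y' /\ y k - y' k = c.
Proof.
move=> ne_R p_gt0 min_c; have [m Am] := wbelow_pow p (Abnd_below ne_R).
pose M := `|c| + `|m|.
exists [ffun i => if i == k then c else - M], [ffun i => if i == k then 0 else M].
rewrite !ffunE eqxx subr0; split=> //; apply: wpow_Rfw => // i j w Aw.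
have le_m := Am _ _ _ Aw; rewrite !ffunE.
case: (i =P k) (j =P k) Aw => [->|_] [->|_]; [by move/min_c; lia| | |]; rewrite /M; lia.
Qed.

End Scale.

Section ForwardPowers.

Local Open Scope ring_scope.

Variables (N : nat) (R : dbc N).

(** For satisfiable [R_s] and nonnegative [b], this amounts to [y k - z k <= w * b] for all weights
    [w] of closed walks of length [p] at [k], with no [w] computed. The case without rounds is
    separate because the rounding argument divides by [b]. *)
Definition loop_fw (b : int) p (k : 'I_N) (y z : vec N) :=
  (b <= 0 /\ y k <= z k) \/
  (1 <= b /\ exists y' z', rpow (Rfw (dbrel (scale R b))) p y' z' /\ y k - z k <= y' k - z' k).

Definition lassos (L : nat -> nat -> 'I_N -> nat -> int -> Prop) n :=
  forall p k m1 m2 b, (0 < p <= N)%N -> (m1 < N ^ 2)%N -> (m2 < N ^ 2)%N ->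
    n = (m1 + m2 + p * b)%N -> L m1 m2 k p (Posz b).

Definition lasso_fw (x x' : vec N) m1 m2 k p b := exists y z,
  [/\ rpow (Rfw (dbrel R)) m1 x y, loop_fw b p k y z & rpow (Rfw (dbrel R)) m2 z x'].

Lemma wpow_iter (X : wrel 'I_N) p b k w :
  wpow X p k k w -> wpow X (p * b) k k (w * b%:Z).
Proof.
move=> Xw; elim: b => [|b IHb]; first by rewrite muln0 mulr0.
by rewrite mulnS; apply: wpow_add Xw IHb _; lia.
Qed.

Lemma wpow_scale b p (y z : vec N) i j w : 0 < b ->
  rpow (Rfw (dbrel (scale R b))) p y z -> wpow (Abnd R) p i j w -> y i - z j <= w * b.
Proof.
move=> b_gt0; elim: p y i w => [|p IHp] y i w /=.
  by move=> -> [-> w_ge0]; rewrite subrr mulr_ge0 // ltW.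
move=> [u [/Rfw_attained Ry Ru]] [k [a [c [Aa Ac le_w]]]].
have le_c := IHp _ _ _ Ru Ac; have [v [v' [Rv le_v]]] := Ry i k.
have le_a := Abnd_scale b_gt0 Rv Aa.
have : (a + c) * b <= w * b by rewrite ler_wpM2r // ltW.
by rewrite mulrDl; lia.
Qed.

Lemma loop_fwI b p k (y z : vec N) : (0 < p)%N -> (exists u u', Rs (dbrel R) u u') ->
  rpow (Rfw (dbrel R)) (p * b) y z -> loop_fw (Posz b) p k y z.
Proof.
move=> p_gt0 ne_R Ryz; case: b Ryz => [|b] Ryz; first by left; rewrite muln0 in Ryz; rewrite Ryz.
right; split=> //; set d := y k - z k.
have b_gt0 : (0 < b.+1%:Z) by [].
(* The quotient of [d] by the number of rounds, rounded up. Repeating a closed walk that often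
   bounds [d], so [c] is below the weight of each of them. *)
pose c := - (- d %/ b.+1%:Z)%Z.
have le_d : d <= c * b.+1%:Z.
  have : (- d %/ b.+1%:Z)%Z * b.+1%:Z <= - d by rewrite -lez_divRL.
  by rewrite /c mulNr; lia.
have [|u [u' [Ru eq_c]]] := @Rfw_extremal _ R p k c ne_R p_gt0.
  move=> w /(wpow_iter b.+1) /(Rfw_wpow Ryz) le_w.
  suff : - w <= (- d %/ b.+1%:Z)%Z by rewrite /c; lia.
  by rewrite lez_divRL // mulNr /d; lia.
exists [ffun i => u i * b.+1%:Z], [ffun i => u' i * b.+1%:Z]; split; last first.
  by rewrite !ffunE -mulrBl eq_c.
move: Ru; apply: (@rpow_map _ _ _ (fun x => [ffun i => x i * b.+1%:Z])) => {eq_c}u {}u'.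
move=> /Rfw_attained Ru; apply/Rfw_attained => i j.
have [v [v' [Rv le_v]]] := Ru i j.
exists [ffun i => v i * b.+1%:Z], [ffun i => v' i * b.+1%:Z].
by split; [exact: Rs_scale_up|rewrite !ffunE -!mulrBl ler_wpM2r].
Qed.

Lemma rpow_lasso_fw n (x x' : vec N) : (0 < n)%N ->
  rpow (Rfw (dbrel R)) n x x' <-> lassos (lasso_fw x x') n.
Proof.
move=> n_gt0; split=> [Rx p k m1 m2 b /andP[p_gt0 _] _ _ def_n|lasso_x].
  have ne_R : exists y y', Rs (dbrel R) y y'.
    case: n n_gt0 Rx {def_n} => // n _ [y [/Rfw_attained/(_ k k)[u [u' [Ru _]]] _]].
    by exists u, u'.
  rewrite def_n addnAC in Rx; move/rpow_add: Rx => [z [/rpow_add[y [Rxy Ryz]] Rzx']].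
  by exists y, z; split=> //; apply: loop_fwI.
have [N0|N_gt0] := posnP N.
  have noI (i : 'I_N) : False by case: i => i; rewrite N0.
  elim: n {n_gt0 lasso_x} x => [|n IHn] x /=; first by apply/ffunP => i; case: (noI i).
  by exists x; split=> [i|]; first case: (noI i).
have N2_gt0 : (0 < N ^ 2)%N by rewrite expn_gt0 N_gt0.
(* The lasso with empty ends and [n] rounds of a cycle of length 1 provides a solution of the scaled
   constraint, which rounds to one of [R_s]. *)
have ne_R : exists y y', Rs (dbrel R) y y'.
  have [||y [z [_ [[? _]|[_ [y' [z' [Ry' _]]]]] _]]] :=
    lasso_x 1%N (Ordinal N_gt0) 0%N 0%N n _ N2_gt0 N2_gt0.
  - by rewrite N_gt0.
  - by rewrite mul1n.
  - by exfalso; lia.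
  - case: Ry' => u [/Rfw_attained/(_ (Ordinal N_gt0) (Ordinal N_gt0)) [v [v' [Rv _]]] _].
    by do 2!eexists; apply: (@Rs_scale_down _ R (Posz n) 0) Rv; lia.
apply: wpow_Rfw => // i j w.
move=> /(wpow_lasso (Abnd_below ne_R)); rewrite card_ord.
move=> [p [k [m1 [m2 [b [w1 [w0 [w2 [pP [lt_m1 lt_m2 def_n] Aw1 Aw2 [Aw0 le_w]]]]]]]]]].
have [y [z [/Rfw_wpow Rx loop_yz /Rfw_wpow Rz]]] := lasso_x p k m1 m2 b pP lt_m1 lt_m2 def_n.
have := Rx _ _ _ Aw1; have := Rz _ _ _ Aw2.
suff : y k - z k <= w0 * b%:Z by lia.
case: loop_yz => [[b_le0 le_yz]|[b_ge1 [y' [z' [Ry' le_yz]]]]].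
  have -> : b = 0%N by lia.
  by rewrite mulr0; lia.
case: Aw0 => [b0|]; first by lia.
have b_gt0 : 0 < Posz b by lia.
by move=> /(wpow_scale b_gt0 Ry'); lia.
Qed.

End ForwardPowers.

Section Backward.

Local Open Scope ring_scope.

Variable N : nat.
Implicit Types R : dbc N.

Definition dvar_swap (u : dvar N) : dvar N := sumf inr inl u.

(** Exchanging primed and unprimed variables turns backward atoms into forward ones, so the backward
    powers follow from the forward analysis with prefix and suffix exchanged. *)
Definition dbc_rev R : dbc N := [seq (dvar_swap a.1.1, dvar_swap a.1.2, a.2) | a <- R].


Lemma sumf_swap (x x' : vec N) u : sumf x x' (dvar_swap u) = sumf x' x u.
Proof. by case: u. Qed.

Lemma dbrel_rev R (x x' : vec N) : dbrel R x x' <-> dbrel (dbc_rev R) x' x.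
Proof.
split=> [Rx u v c /mapP[[[u' v'] c'] Rc [-> -> ->]]|Rx u v c Rc].
  by rewrite !sumf_swap; apply: Rx.
rewrite -!(sumf_swap x'); apply: Rx; apply/mapP; by exists (u, v, c).
Qed.

Lemma Rs_rev R (x x' : vec N) : Rs (dbrel R) x x' <-> Rs (dbrel (dbc_rev R)) x' x.
Proof.
rewrite /Rs -dbrel_rev; split=> [[Rx [[y Ry] [z Rz]]]|[Rx [[y Ry] [z Rz]]]]; do ![split=> //].
- by exists z; rewrite -(rpow_rev _ _ _ (dbrel_rev R)).
- by exists y; rewrite -(rpow_rev _ _ _ (dbrel_rev R)).
- by exists z; rewrite (rpow_rev _ _ _ (dbrel_rev R)).
- by exists y; rewrite (rpow_rev _ _ _ (dbrel_rev R)).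
Qed.

Lemma Rbw_rev R (x x' : vec N) : Rbw (dbrel R) x x' <-> Rfw (dbrel (dbc_rev R)) x' x.
Proof.
split=> Rx i j c le_c; apply: Rx => y y' Ry; apply: le_c.
  by rewrite -Rs_rev.
by rewrite Rs_rev.
Qed.

Lemma scale_rev R b : scale (dbc_rev R) b = dbc_rev (scale R b).
Proof. by rewrite /scale /dbc_rev -!map_comp. Qed.

Lemma Rbw_attained R (x x' : vec N) : Rbw (dbrel R) x x' <->
  forall i j, exists y y', Rs (dbrel R) y y' /\ x' i - x j <= y' i - y j.
Proof.
rewrite Rbw_rev Rfw_attained; split=> Rx i j; have [y [y' [Ry le_y]]] := Rx i j;
  exists y', y; split=> //; by [rewrite -Rs_rev|rewrite Rs_rev].
Qed.

Definition Rdir (dir : bool) R := if dir then Rfw (dbrel R) else Rbw (dbrel R).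

Definition ddiff (dir : bool) (y z : vec N) i j := if dir then y i - z j else z i - y j.

Lemma Rdir_attained dir R (x x' : vec N) : Rdir dir R x x' <->
  forall i j, exists y y', Rs (dbrel R) y y' /\ ddiff dir x x' i j <= ddiff dir y y' i j.
Proof. by case: dir; [apply: Rfw_attained|apply: Rbw_attained]. Qed.

Definition loop_dir dir R (b : int) p (k : 'I_N) (y z : vec N) :=
  (b <= 0 /\ ddiff dir y z k k <= 0) \/
  (1 <= b /\ exists y' z', rpow (Rdir dir (scale R b)) p y' z' /\
                          ddiff dir y z k k <= ddiff dir y' z' k k).

Definition lasso_dir dir R (x x' : vec N) m1 m2 k p b := exists y z,
  [/\ rpow (Rdir dir R) m1 x y, loop_dir dir R b p k y z & rpow (Rdir dir R) m2 z x'].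

Lemma rpow_lasso dir R n (x x' : vec N) : (0 < n)%N ->
  rpow (Rdir dir R) n x x' <-> lassos (lasso_dir dir R x x') n.
Proof.
case: dir => n_gt0.
  rewrite /Rdir rpow_lasso_fw //; split=> Lx p k m1 m2 b pP lt_m1 lt_m2 def_n;
  have [y [z [Rx loop_yz Rz]]] := Lx p k m1 m2 b pP lt_m1 lt_m2 def_n;
  exists y, z; split=> //; (case: loop_yz => [[b0 le_yz]|?]; [left|by right]);
  by split=> //; move: le_yz; rewrite /ddiff; lia.
rewrite /Rdir (rpow_rev _ _ _ (Rbw_rev R)) rpow_lasso_fw //.
split=> Lx p k m1 m2 b pP lt_m1 lt_m2 def_n.
  have [|y [z [Rx loop_yz Rz]]] := Lx p k m2 m1 b pP lt_m2 lt_m1; first by lia.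
  exists z, y; split; try exact/(rpow_rev _ _ _ (Rbw_rev R)).
  case: loop_yz => [[b0 le_yz]|[b1 [y' [z' [Ry' le_yz]]]]]; [left|right]; split=> //.
    by rewrite /ddiff; lia.
  exists z', y'; split=> //; apply/(rpow_rev _ _ _ (Rbw_rev _)); by rewrite -scale_rev.
have [|y [z [Rx loop_yz Rz]]] := Lx p k m2 m1 b pP lt_m2 lt_m1; first by lia.
exists z, y; split; try exact/(rpow_rev _ _ _ (Rbw_rev R)).
case: loop_yz => [[b0 le_yz]|[b1 [y' [z' [Ry' le_yz]]]]]; [left|right]; split=> //.
  by move: le_yz; rewrite /ddiff; lia.
exists z', y'; split=> //; rewrite scale_rev; exact/(rpow_rev _ _ _ (Rbw_rev _)).
Qed.

End Backward.

(** * Existential formulas *)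

Definition FTrue {V} : fml V := FLe (TCst 0) (TCst 0).

Definition bigand V I (s : seq I) (F : I -> fml V) : fml V :=
  foldr (fun i f => FAnd (F i) f) FTrue s.

Definition vof V N (e : V -> int) (x : 'I_N -> V) : vec N := [ffun i => e (x i)].

Definition EqF V N (x y : 'I_N -> V) : fml V :=
  bigand (enum 'I_N) (fun i => FEq (TVar (x i)) (TVar (y i))).

(* [T] is the factor by which the constants of a constraint are multiplied. *)
Definition stepF N := forall V, ('I_N -> V) -> ('I_N -> V) -> lterm V -> fml V.

Definition RF N (R : dbc N) : stepF N := fun V x x' T =>
  bigand R (fun a => FLe (TVar (sumf x x' a.1.1))
                         (TAdd (TVar (sumf x x' a.1.2)) (TMul a.2 T))).

Fixpoint chainF N (F : stepF N) n V (x x' : 'I_N -> V) (T : lterm V) : fml V :=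
  match n with
  | 0 => EqF x x'
  | m.+1 => FEx (n := N) (FAnd (F _ (inl \o x) inr (tren inl T))
                               (chainF F m inr (inl \o x') (tren inl T)))
  end.

(** The copy of [x] makes the layers of the chain, up to its last quantified one, consecutive blocks
    of variables. The numbers of the variables are then affine in the index of the layer, and a loop
    can print the chain. *)
Definition powF N (F : stepF N) n : stepF N := fun V x x' T =>
  FEx (n := N) (FAnd (EqF (inl \o x) inr) (chainF F n inr (inl \o x') (tren inl T))).

Definition RsF N (R : dbc N) : stepF N := fun V x x' T =>
  FAnd (RF R x x' T)
    (FAnd (FEx (n := N) (powF (RF R) (N ^ 2) (inl \o x) inr (tren inl T)))
          (FEx (n := N) (powF (RF R) (N ^ 2) inr (inl \o x') (tren inl T)))).

Definition diffF (dir : bool) V N (x x' y y' : 'I_N -> V) (i j : 'I_N) : fml V :=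
  if dir then FLe (TAdd (TVar (x i)) (TVar (y' j))) (TAdd (TVar (y i)) (TVar (x' j)))
  else FLe (TAdd (TVar (x' i)) (TVar (y j))) (TAdd (TVar (y' i)) (TVar (x j))).

Definition DirF (dir : bool) N (R : dbc N) : stepF N := fun V x x' T =>
  bigand (enum 'I_N) (fun i => bigand (enum 'I_N) (fun j =>
    FEx (n := N) (FEx (n := N)
      (FAnd (RsF R (inl \o inr) inr (tren inl (tren inl T)))
            (diffF dir (inl \o (inl \o x)) (inl \o (inl \o x')) (inl \o inr) inr i j))))).

Definition LoopF (dir : bool) N (R : dbc N) p (k : 'I_N) V (b : V) (y z : 'I_N -> V) : fml V :=
  FOr (FAnd (FLe (TVar b) (TCst 0))
            (if dir then FLe (TVar (y k)) (TVar (z k)) else FLe (TVar (z k)) (TVar (y k))))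
      (FAnd (FLe (TCst 1) (TVar b))
            (FEx (n := N) (FEx (n := N)
              (FAnd (powF (DirF dir R) p (inl \o inr) inr (TVar (inl (inl b))))
                    (diffF dir (inl \o (inl \o y)) (inl \o (inl \o z)) (inl \o inr) inr k k))))).

Definition LassoF (dir : bool) N (R : dbc N) m1 m2 (k : 'I_N) p V (b : V)
    (x x' : 'I_N -> V) : fml V :=
  FEx (n := N) (FEx (n := N)
    (FAnd (powF (DirF dir R) m1 (inl \o (inl \o x)) (inl \o inr) (TCst 1))
    (FAnd (LoopF dir R p k (inl (inl b)) (inl \o inr) inr)
          (powF (DirF dir R) m2 inr (inl \o (inl \o x')) (TCst 1))))).

(* The quotient b of l - m1 - m2 by p is unique, so the lasso condition can be
   guarded by l = m1 + m2 + p b without negation. *)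
Definition GuardF (dir : bool) N (R : dbc N) m1 m2 (k : 'I_N) p V (l : V)
    (x x' : 'I_N -> V) : fml V :=
  let t := TVar (inl l) in
  let pb := TMul (Posz p) (TVar (inr ord0)) in
  FEx (n := 1)
    (FOr (FLe (TAdd t (TCst 1)) (TCst (Posz (m1 + m2))))
    (FOr (FAnd (FLe (TAdd pb (TCst (Posz (m1 + m2 + 1)))) t)
               (FLe (TAdd t (TCst 1)) (TAdd pb (TCst (Posz (m1 + m2 + p))))))
         (FAnd (FEq t (TAdd pb (TCst (Posz (m1 + m2)))))
               (LassoF dir R m1 m2 k p (inr ord0) (inl \o x) (inl \o x'))))).

Definition ClosedF (dir : bool) N (R : dbc N) V (l : V) (x x' : 'I_N -> V) : fml V :=
  bigand (iota 1 N) (fun p => bigand (enum 'I_N) (fun k =>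
    bigand (iota 0 (N ^ 2)) (fun m1 => bigand (iota 0 (N ^ 2)) (fun m2 =>
      GuardF dir R m1 m2 k p l x x')))).

Lemma sat_ex V n (f : fml (V + 'I_n)) e : sat (FEx f) e = exists y : vec n, sat f (sumf e y).
Proof. by []. Qed.

Lemma sat_bigand (I : eqType) V (s : seq I) (F : I -> fml V) e :
  sat (bigand s F) e <-> forall i, i \in s -> sat (F i) e.
Proof.
elim: s => [|i s IHs] /=; first by split.
rewrite IHs; split=> [[Fi Fs] j|Fs]; first by rewrite inE => /predU1P[->|/Fs].
by split=> [|j sj]; apply: Fs; rewrite inE ?eqxx // sj orbT.
Qed.

Lemma vof_inr V N (e : V -> int) (y : vec N) : vof (sumf e y) inr = y.
Proof. by apply/ffunP => i; rewrite ffunE. Qed.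

Lemma vof_lift V N n (e : V -> int) (y : vec n) (x : 'I_N -> V) :
  vof (sumf e y) (inl \o x) = vof e x.
Proof. by []. Qed.

Lemma sat_EqF V N (x y : 'I_N -> V) e : sat (EqF x y) e <-> vof e x = vof e y.
Proof.
rewrite sat_bigand; split=> [eq_xy|eq_xy i _].
  by apply/ffunP => i; rewrite !ffunE; have /= := eq_xy i (mem_enum _ _); lia.
by move/ffunP/(_ i): eq_xy; rewrite !ffunE /= => ->.
Qed.

Definition step_sat N (F : stepF N) (Rel : int -> vrel N) :=
  forall V (x x' : 'I_N -> V) T e,
    sat (F V x x' T) e <-> Rel (teval T e) (vof e x) (vof e x').

Lemma sat_RF N (R : dbc N) : step_sat (RF R) (fun t => dbrel (scale R t)).
Proof.
move=> V x x' T e.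
have sumE u : sumf (vof e x) (vof e x') u = e (sumf x x' u) by case: u => i /=; rewrite ffunE.
rewrite sat_bigand dbrel_scale; split=> [Rx u v c /Rx /=|Rx [[u v] c] /Rx /=].
  by rewrite !sumE; lia.
by rewrite !sumE; lia.
Qed.

Lemma teval_inl V n (T : lterm V) e (y : vec n) : teval (tren inl T) (sumf e y) = teval T e.
Proof. by rewrite teval_ren. Qed.

Lemma sat_chainF N (F : stepF N) Rel n : step_sat F Rel ->
  step_sat (chainF F n) (fun t => rpow (Rel t) n).
Proof.
move=> satF; elim: n => [|n IHn] V x x' T e; first exact: sat_EqF.
rewrite /=; split=> -[y [Ry Rn]]; exists y; move: Ry Rn;
  by rewrite satF IHn !teval_inl !vof_inr.
Qed.

Lemma sat_powF N (F : stepF N) Rel n : step_sat F Rel ->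
  step_sat (powF F n) (fun t => rpow (Rel t) n).
Proof.
move=> satF V x x' T e; rewrite /powF /=; split=> [[y [/sat_EqF eq_y]]|Rn].
  by rewrite (sat_chainF _ satF) teval_inl => Rn; move: eq_y Rn; rewrite !vof_inr => <-.
exists (vof e x); rewrite sat_EqF (sat_chainF _ satF) teval_inl !vof_inr.
by split.
Qed.

Lemma sat_RsF N (R : dbc N) : step_sat (RsF R) (fun t => Rs (dbrel (scale R t))).
Proof.
have sat_pow := sat_powF (N ^ 2) (@sat_RF N R).
move=> V x x' T e; rewrite /RsF 2!sat_and sat_RF /Rs.
have sat1 : sat (FEx (powF (RF R) (N ^ 2) (inl \o x) inr (tren inl T))) e <->
    Sfw_set (dbrel (scale R (teval T e))) (vof e x).
  rewrite sat_ex; split=> -[y Ry]; exists y; move: Ry;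
  by rewrite sat_pow teval_inl vof_inr.
have sat2 : sat (FEx (powF (RF R) (N ^ 2) inr (inl \o x') (tren inl T))) e <->
    Sbw_set (dbrel (scale R (teval T e))) (vof e x').
  rewrite sat_ex; split=> -[y Ry]; exists y; move: Ry;
  by rewrite sat_pow teval_inl vof_inr.
by rewrite sat1 sat2.
Qed.

Lemma sat_diffF dir V N (x x' y y' : 'I_N -> V) i j e :
  sat (diffF dir x x' y y' i j) e <->
  (ddiff dir (vof e x) (vof e x') i j <= ddiff dir (vof e y) (vof e y') i j)%R.
Proof. by case: dir; rewrite /ddiff !ffunE /=; split; lia. Qed.

Lemma sat_DirF dir N (R : dbc N) : step_sat (DirF dir R) (fun t => Rdir dir (scale R t)).
Proof.
move=> V x x' T e; rewrite sat_bigand Rdir_attained.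
split=> [Rx i j|Rx i _].
  have /sat_bigand/(_ j (mem_enum _ _))[y [y' [/sat_RsF Ry /sat_diffF le_y]]] := Rx i (mem_enum _ _).
  by exists y, y'; move: Ry le_y; rewrite !teval_inl !vof_lift !vof_inr.
rewrite sat_bigand => j _; have [y [y' [Ry le_y]]] := Rx i j.
exists y, y'; rewrite sat_and sat_RsF sat_diffF !teval_inl !vof_lift !vof_inr.
by split.
Qed.

Lemma scale1 N (R : dbc N) : scale R 1 = R.
Proof. by rewrite /scale -[RHS]map_id; apply: eq_map => -[[u v] c] /=; rewrite mulr1. Qed.

Lemma sat_LoopF dir N (R : dbc N) p k V (b : V) (y z : 'I_N -> V) e :
  sat (LoopF dir R p k b y z) e <-> loop_dir dir R (e b) p k (vof e y) (vof e z).
Proof.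
have sat_le : sat (if dir then FLe (TVar (y k)) (TVar (z k)) else FLe (TVar (z k)) (TVar (y k))) e
    <-> (ddiff dir (vof e y) (vof e z) k k <= 0)%R.
  by case: dir; rewrite /ddiff !ffunE /=; split; lia.
rewrite /LoopF /loop_dir -sat_le.
have sat_pow := sat_powF p (sat_DirF dir R).
split=> [[[le_b H]|[le_b [y' [z' [/sat_pow Ry' /sat_diffF le_y]]]]]|].
- by left.
- by right; split=> //; exists y', z'; move: Ry' le_y; rewrite /= !vof_lift !vof_inr.
case=> [[le_b H]|[le_b [y' [z' [Ry' le_y]]]]]; first by left.
right; split=> //; exists y', z'; rewrite sat_and sat_pow sat_diffF /= !vof_lift !vof_inr.
by split.
Qed.

Lemma sat_LassoF dir N (R : dbc N) m1 m2 k p V (b : V) (x x' : 'I_N -> V) e :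
  sat (LassoF dir R m1 m2 k p b x x') e <-> lasso_dir dir R (vof e x) (vof e x') m1 m2 k p (e b).
Proof.
have sat_pow m := sat_powF m (sat_DirF dir R).
split=> [[y [z [/sat_pow Rx [/sat_LoopF loop_yz /sat_pow Rz]]]]|[y [z [Rx loop_yz Rz]]]].
  by exists y, z; move: Rx loop_yz Rz; rewrite /= scale1 !vof_lift !vof_inr.
exists y, z; rewrite sat_and sat_pow sat_and sat_LoopF sat_pow /= scale1 !vof_lift !vof_inr.
by split.
Qed.

Lemma sat_GuardF dir N (R : dbc N) m1 m2 k p V (l : V) (x x' : 'I_N -> V) e n :
  e l = Posz n -> 0 < p ->
  sat (GuardF dir R m1 m2 k p l x x') e <->
  forall b, n = m1 + m2 + p * b -> lasso_dir dir R (vof e x) (vof e x') m1 m2 k p (Posz b).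
Proof.
move=> el p_gt0; rewrite /GuardF; set L := LassoF _ _ _ _ _ _ _ _ _.
have satL (c : vec 1) : sat L (sumf e c) <->
    lasso_dir dir R (vof e x) (vof e x') m1 m2 k p (c ord0) by rewrite sat_LassoF.
move: L satL => L satL /=.
split=> [[c +] b def_n|Lx].
  rewrite el; case=> [lt_n|[[lt_b1 lt_b2]|[[le1 le2] /satL]]]; [by exfalso; lia| |].
    (* The second disjunct places [n - m1 - m2] strictly between two consecutive multiples of
       [p]. *)
    have H1 : (0 < Posz p * (Posz b - c ord0))%R by lia.
    have H2 : (Posz p * (Posz b - c ord0) < Posz p * 1)%R by lia.
    rewrite pmulr_rgt0 // in H1; rewrite ltr_pM2l // in H2; exfalso; lia.
  suff -> : c ord0 = Posz b by [].
  have H1 : (Posz p * Posz b = Posz p * c ord0)%R by lia.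
  by apply/esym/(mulfI _ H1); lia.
have [lt_n|le_n] := ltnP n (m1 + m2); first by exists [ffun=> 0%R]; left; rewrite el; lia.
have def_n := divn_eq (n - (m1 + m2)) p; have lt_r := ltn_pmod (n - (m1 + m2)) p_gt0.
set q := (_ %/ _) in def_n; set r := (_ %% _) in def_n lt_r.
exists [ffun=> Posz q]; right; rewrite satL !ffunE el.
have [r0|r_gt0] := posnP r; [right|left]; last by split; nia.
by split; [split; nia|apply: Lx; nia].
Qed.

Lemma sat_ClosedF dir N (R : dbc N) V (l : V) (x x' : 'I_N -> V) e n :
  e l = Posz n -> 0 < n ->
  sat (ClosedF dir R l x x') e <-> rpow (Rdir dir R) n (vof e x) (vof e x').
Proof.
move=> el n_gt0; rewrite rpow_lasso // sat_bigand.
split=> [Lx p k m1 m2 b /andP[p_gt0 le_p] lt_m1 lt_m2 def_n|Lx p].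
  have : p \in iota 1 N by rewrite mem_iota; lia.
  move/Lx/sat_bigand/(_ k (mem_enum _ _))/sat_bigand/(_ m1) => /(_ _)/sat_bigand.
  rewrite !mem_iota => /(_ lt_m1 m2); rewrite mem_iota => /(_ lt_m2).
  by rewrite (sat_GuardF _ _ _ _ _ _ _ el) //; apply.
rewrite mem_iota => pP; apply/sat_bigand => k _; apply/sat_bigand => m1.
rewrite mem_iota => lt_m1; apply/sat_bigand => m2; rewrite mem_iota => lt_m2.
rewrite (sat_GuardF _ _ _ _ _ _ _ el); last by lia.
by move=> b; apply: Lx; lia.
Qed.

Definition Pform N (R : dbc N) n : fml (dvar N) := powF (RF R) n inl inr (TCst 1).

Definition Dform dir N (R : dbc N) : fml (kvar N) :=
  ClosedF dir R None (Some \o inl) (Some \o inr).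

Lemma vof_inl N (x x' : vec N) : vof (sumf x x') inl = x.
Proof. by apply/ffunP => i; rewrite ffunE. Qed.

Lemma defines_Pform N (R : dbc N) n : defines (Pform R n) (rpow (dbrel R) n).
Proof.
move=> x x'; rewrite (sat_powF _ (@sat_RF N R)) /= scale1.
by rewrite vof_inl vof_inr.
Qed.

Lemma closed_form_Dform dir N (R : dbc N) : closed_form (Rdir dir R) (Dform dir R).
Proof.
move=> n n_gt0 x x'; rewrite (@sat_ClosedF _ _ _ _ _ _ _ _ n) //.
have -> : vof (kenv (Posz n) x x') (Some \o inl) = x by apply: vof_inl.
by have -> : vof (kenv (Posz n) x x') (Some \o inr) = x' by apply: vof_inr.
Qed.

Lemma existential_bigand V I (s : seq I) (F : I -> fml V) :
  (forall i, existential (F i)) -> existential (bigand s F).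
Proof. by move=> Fex; elim: s => //= i s ->; rewrite Fex. Qed.

Definition step_existential N (F : stepF N) :=
  forall V (x x' : 'I_N -> V) T, existential (F V x x' T).

Lemma existential_powF N (F : stepF N) n : step_existential F -> step_existential (powF F n).
Proof.
have exE V (x y : 'I_N -> V) : existential (EqF x y) by apply: existential_bigand.
move=> Fex V x x' T; rewrite /= exE /=; move: (inl \o x') (tren _ T) => {}x' {}T.
elim: n (V + 'I_N)%type (inr : 'I_N -> V + 'I_N)%type x' T => [|n IHn] W y x' T //=.
by rewrite Fex IHn.
Qed.

Lemma existential_RF N (R : dbc N) : step_existential (RF R).
Proof. by move=> V x x' T; apply: existential_bigand. Qed.

Lemma existential_and V (f g : fml V) :
  existential f -> existential g -> existential (FAnd f g).
Proof. by move=> /= -> ->. Qed.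

Lemma existential_or V (f g : fml V) :
  existential f -> existential g -> existential (FOr f g).
Proof. by move=> /= -> ->. Qed.

Lemma existential_ex V n (f : fml (V + 'I_n)) : existential (FEx f) = existential f.
Proof. by []. Qed.

Lemma existential_DirF dir N (R : dbc N) : step_existential (DirF dir R).
Proof.
have exP := existential_powF (N ^ 2) (@existential_RF N R).
move=> V x x' T; apply: existential_bigand => i; apply: existential_bigand => j.
rewrite 2!existential_ex; apply: existential_and; last by case: dir.
apply: existential_and; first exact: existential_RF.
by apply: existential_and; rewrite existential_ex; apply: exP.
Qed.

Lemma existential_Dform dir N (R : dbc N) : existential (Dform dir R).
Proof.
have exP m := existential_powF m (@existential_DirF dir N R).
do 4!apply: existential_bigand => ?.
suff exL V (b : V) x x' m1 m2 k p : existential (LassoF dir R m1 m2 k p b x x') by apply: exL.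
rewrite /LassoF 2!existential_ex; apply: existential_and; first exact: exP.
apply: existential_and; last exact: exP.
apply: existential_or; first by case: (dir).
apply: existential_and => //; rewrite 2!existential_ex.
by apply: existential_and; [exact: exP|case: (dir)].
Qed.

Lemma existential_ren V (f : fml V) W (r : V -> W) : existential (fren f r) = existential f.
Proof.
have qf_ren U (g : fml U) W' (s : U -> W') : qfree (fren g s) = qfree g.
  elim: g W' s => //= [U' g IHg h IHh|U' g IHg h IHh] W' s; by rewrite IHg IHh.
elim: f W r => //= [U g IHg h IHh|U g IHg h IHh] W' s; by rewrite IHg IHh.
Qed.

Lemma existential_Rhat N (P : nat -> fml (dvar N)) Ffw Fbw :
  (forall n, existential (P n)) -> existential Ffw -> existential Fbw ->
  existential (Rhat P Ffw Fbw).
Proof.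
move=> exP exF exB; rewrite /Rhat; elim: (iota _ _) => [|i s IHs].
  rewrite [foldr _ _ _]/= /Rhat_tail existential_ex.
  do 2!apply: existential_and => //.
  rewrite existential_ren /psi_form 2!existential_ex.
  apply: existential_and; last by rewrite existential_ren.
  apply: existential_and; rewrite existential_ren //.
  apply: existential_and; first exact: existential_and.
  by apply: existential_and; rewrite existential_ren existential_ex existential_ren.
apply: existential_or => //.
by apply: existential_and; rewrite ?existential_ren.
Qed.

(** * A loop language generating sequences of integers *)

Inductive nexp : Type :=
| NC of nat
| NV of nat
| NAdd of nexp & nexp
| NMul of nexp & nexp.

(* [TkA e o v] is the sum of [e] and of the entry o of the atom whose index is
   held by the variable v. *)
Inductive tok : Type :=
| TkN of nexp
| TkA of nexp & nat & nat.

(** The nesting is fixed and loop bounds are polynomials in the variables, so a single induction on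
    programs gives polynomial time for everything written in this language. *)
Inductive gen : Type :=
| GEmit of seq tok
| GCat of gen & gen
| GFor of nat & nexp & gen.

Definition updn (r : nat -> nat) (v n : nat) : nat -> nat := fun w => if w == v then n else r w.

Fixpoint neval (r : nat -> nat) (e : nexp) : nat :=
  match e with
  | NC n => n
  | NV v => r v
  | NAdd e f => neval r e + neval r f
  | NMul e f => neval r e * neval r f
  end.

Definition teval_tok (r : nat -> nat) (A : nat -> int) (t : tok) : int :=
  match t with
  | TkN e => Posz (neval r e)
  | TkA e o v => (Posz (neval r e) + A (3 * r v + o)%N)%R
  end.

Fixpoint gout (A : nat -> int) (g : gen) (r : nat -> nat) : seq int :=
  match g with
  | GEmit s => map (teval_tok r A) s
  | GCat g h => gout A g r ++ gout A h r
  | GFor v e g => flatten [seq gout A g (updn r v i) | i <- iota 0 (neval r e)]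
  end.

Fixpoint nocc (v : nat) (e : nexp) : bool :=
  match e with
  | NC _ => true
  | NV w => w != v
  | NAdd e f | NMul e f => nocc v e && nocc v f
  end.

Fixpoint lvars (g : gen) : seq nat :=
  match g with
  | GEmit _ => [::]
  | GCat g h => lvars g ++ lvars h
  | GFor v _ g => v :: lvars g
  end.

(** The compiled test evaluates its bound anew in each round, so the loop variable may not occur
    there; an inner loop may not reuse it either, because a loop leaves its variable at 0. *)
Fixpoint gwf (g : gen) : bool :=
  match g with
  | GEmit _ => true
  | GCat g h => gwf g && gwf h
  | GFor v e g => [&& nocc v e, v \notin lvars g & gwf g]
  end.

(* The variable v is held at the negative address - v - 1, the cell of index a
   of the array of the atoms at the address a. *)
Definition gmem (r : nat -> nat) (A : nat -> int) : int -> int :=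
  fun z => match z with Posz a => A a | Negz v => Posz (r v) end.

Definition creg v : expr := EMem (ECst (Negz v)).

Fixpoint cnexp (e : nexp) : expr :=
  match e with
  | NC n => ECst (Posz n)
  | NV v => creg v
  | NAdd e f => EAdd (cnexp e) (cnexp f)
  | NMul e f => EMul (cnexp e) (cnexp f)
  end.

Definition ctok (t : tok) : expr :=
  match t with
  | TkN e => cnexp e
  | TkA e o v => EAdd (cnexp e) (EMem (cnexp (NAdd (NMul (NC 3) (NV v)) (NC o))))
  end.

Definition cset v (e : expr) : cmd := CAssign (ECst (Negz v)) e.

Fixpoint compile (g : gen) : cmd :=
  match g with
  | GEmit s => foldr (fun t => CSeq (CWrite (ctok t))) CSkip s
  | GCat g h => CSeq (compile g) (compile h)
  | GFor v e g =>
      CSeq (CWhile (ESub (cnexp e) (creg v))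
                   (CSeq (compile g) (cset v (EAdd (creg v) (ECst 1)))))
           (cset v (ECst 0))
  end.

Lemma neval_upd r v n e : nocc v e -> neval (updn r v n) e = neval r e.
Proof.
by elim: e => //= [w /negPf|e IHe f IHf /andP[/IHe -> /IHf ->]|e IHe f IHf /andP[/IHe -> /IHf ->]] //;
  rewrite /updn => ->.
Qed.

Lemma eval_cnexp r A e : eval (gmem r A) (cnexp e) = Posz (neval r e).
Proof. by elim: e => //= e -> f ->. Qed.

Lemma eval_ctok r A t : eval (gmem r A) (ctok t) = teval_tok r A t.
Proof. by case: t => [e|e o v] /=; rewrite eval_cnexp. Qed.

Lemma upd_gmem r A v n : upd (gmem r A) (Negz v) (Posz n) = gmem (updn r v n) A.
Proof.
apply: functional_extensionality => -[a|w]; rewrite /upd /updn //=.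
by rewrite (_ : (Negz w == Negz v) = (w == v)) //; case: (w == v).
Qed.

Lemma updn_id r v : updn r v (r v) = r.
Proof. by apply: functional_extensionality => w; rewrite /updn; case: eqP => [->|]. Qed.

Lemma updn_twice r v m n : updn (updn r v m) v n = updn r v n.
Proof. by apply: functional_extensionality => w; rewrite /updn; case: eqP. Qed.

(** * Polynomial cost of the compiled programs *)

Section Polynomial.

Variable X : nat.
Hypothesis X_gt1 : 1 < X.

(** All bounds take the form [X ^ a] with [X] at least 2: constants and sums are absorbed by the
    exponent, and no coefficients have to be tracked. *)
Lemma leq_polyC c : c <= X ^ c.
Proof. exact/ltnW/ltn_expl. Qed.

Lemma leq_polyW m a b : m <= X ^ a -> a <= b -> m <= X ^ b.
Proof. by move=> le_m le_ab; apply: leq_trans le_m _; rewrite leq_exp2l. Qed.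

Lemma leq_polyD m n a b : m <= X ^ a -> n <= X ^ b -> m + n <= X ^ (a + b).+1.
Proof.
move=> le_m le_n; rewrite expnS.
have le1 : m <= X ^ (a + b) by apply: leq_polyW le_m _; apply: leq_addr.
have le2 : n <= X ^ (a + b) by apply: leq_polyW le_n _; apply: leq_addl.
apply: leq_trans (leq_add le1 le2) _; rewrite addnn -mul2n leq_mul2r; lia.
Qed.

Lemma leq_polyM m n a b : m <= X ^ a -> n <= X ^ b -> m * n <= X ^ (a + b).
Proof. by move=> le_m le_n; rewrite expnD leq_mul. Qed.

End Polynomial.

Lemma trunc_log_le n k : n < 2 ^ k.+1 -> trunc_log 2 n <= k.
Proof.
case: n => [|n] lt_n; first by rewrite trunc_log0.
by rewrite -ltnS -(@ltn_exp2l 2) //; apply: leq_ltn_trans lt_n; apply: trunc_logP.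
Qed.

Lemma bits_nat n : bits (Posz n) <= n + 2.
Proof.
rewrite /bits addn2 !ltnS absz_nat; apply: trunc_log_le.
by apply: leq_trans (ltn_expl n (ltnSn 1)) _; rewrite leq_exp2l.
Qed.

Lemma bits_add (a b : int) : bits (a + b)%R <= bits a + bits b.
Proof.
rewrite /bits; set m := trunc_log 2 `|a|%N; set n := trunc_log 2 `|b|%N.
suff : trunc_log 2 `|(a + b)%R|%N <= (m + n).+1 by lia.
apply: trunc_log_le.
have lt_a : `|a|%N < 2 ^ m.+1 by apply: trunc_log_ltn.
have lt_b : `|b|%N < 2 ^ n.+1 by apply: trunc_log_ltn.
have le_m : 2 ^ m.+1 <= 2 ^ (m + n).+1 by rewrite leq_exp2l //; lia.
have le_n : 2 ^ n.+1 <= 2 ^ (m + n).+1 by rewrite leq_exp2l //; lia.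
by rewrite expnS; lia.
Qed.

Lemma cost_cnexp e a : exists K, forall X r A, 1 < X -> (forall v, r v <= X ^ a) ->
  neval r e <= X ^ K /\ cost (gmem r A) (cnexp e) <= X ^ K.
Proof.
have leb X K n : 1 < X -> n <= X ^ K -> bits (Posz n) <= X ^ (K + 2).+1.
  move=> X_gt1 le_n; apply: leq_trans (bits_nat n) _.
  by apply: leq_polyD => //; apply: leq_polyC.
have comb X K1 K2 K b c d : 1 < X -> b <= X ^ (K + 2).+1 -> c <= X ^ K1 -> d <= X ^ K2 ->
    b + (c + d) <= X ^ ((K + 2).+1 + (K1 + K2).+1).+1.
  by move=> X_gt1 *; do !apply: leq_polyD.
elim: e => [n|v|e [K IHe] f [L IHf]|e [K IHe] f [L IHf]].
- exists (n + 2).+1 => X r A X_gt1 _ /=; split.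
    by apply: leq_polyW (leq_polyC X_gt1 n) _ => //; lia.
  by rewrite addn0; apply: leb => //; apply: leq_polyC.
- exists ((a + 2).+1 + v.+3).+1 => X r A X_gt1 le_r /=; split.
    by apply: leq_polyW (le_r v) _ => //; lia.
  apply: leq_polyD => //; first exact: leb.
  rewrite addn0; apply: leq_trans (leq_polyC X_gt1 _).
  rewrite /bits !ltnS; apply: trunc_log_le.
  by apply: leq_trans (ltn_expl v.+1 (ltnSn 1)) _; rewrite leq_exp2l.
- exists (((K + L).+1 + 2).+1 + (K + L).+1).+1 => X r A X_gt1 le_r /=.
  have [le_e cost_e] := IHe X r A X_gt1 le_r; have [le_f cost_f] := IHf X r A X_gt1 le_r.
  have le_ef := leq_polyD X_gt1 le_e le_f.
  split; first by apply: leq_polyW le_ef _ => //; lia.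
  by apply: comb => //; rewrite !eval_cnexp; apply: leb.
- exists (((K + L) + 2).+1 + (K + L).+1).+1 => X r A X_gt1 le_r /=.
  have [le_e cost_e] := IHe X r A X_gt1 le_r; have [le_f cost_f] := IHf X r A X_gt1 le_r.
  have le_ef := leq_polyM le_e le_f.
  split; first by apply: leq_polyW le_ef _ => //; lia.
  by apply: comb => //; rewrite !eval_cnexp -PoszM; apply: leb.
Qed.

Lemma cost_ctok t a : exists K, forall X r A, 1 < X -> (forall v, r v <= X ^ a) ->
  (forall n, bits (A n) <= X) -> cost (gmem r A) (ctok t) <= X ^ K.
Proof.
case: t => [e|e o v]; first have [K cK] := cost_cnexp e a.
  by exists K => X r A X_gt1 le_r _; have [] := cK X r A X_gt1 le_r.
have [K cK] := cost_cnexp e a.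
have [L cL] := cost_cnexp (NAdd (NMul (NC 3) (NV v)) (NC o)) a.
exists (((K + 2).+1 + 1).+1 + (K + (1 + L).+1).+1).+1 => X r A X_gt1 le_r le_A.
have [le_e cost_e] := cK X r A X_gt1 le_r; have [le_i cost_i] := cL X r A X_gt1 le_r.
have leX n : bits (A n) <= X ^ 1 by rewrite expn1.
have := eval_ctok r A (TkA e o v); move: le_i cost_i; rewrite /ctok.
set f := NAdd _ _ => le_i cost_i eval_f.
have costD m g h : cost m (EAdd g h) = bits (eval m (EAdd g h)) + (cost m g + cost m h) by [].
have costM m g : cost m (EMem g) = bits (m (eval m g)) + cost m g by [].
rewrite costD eval_f costM eval_cnexp.
apply: leq_polyD => //.
  apply: leq_trans (bits_add _ _) _; apply: leq_polyD => //.
  by apply: leq_trans (bits_nat _) _; apply: leq_polyD => //; apply: leq_polyC.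
by apply: leq_polyD => //; apply: leq_polyD => //; apply: (leX (neval r f)).
Qed.

Lemma exec_set v e s :
  exec (cset v e) s (1 + bits (Negz v) + cost (st_mem s) e)
    (State (upd (st_mem s) (Negz v) (eval (st_mem s) e)) (st_inp s) (st_out s)).
Proof.
have := ExAssign (ECst (Negz v)) e s; by rewrite /= addn0.
Qed.

Lemma exec_emit s a : exists K, forall X r A inp out, 1 < X -> (forall v, r v <= X ^ a) ->
  (forall n, bits (A n) <= X) -> exists t,
    exec (compile (GEmit s)) (State (gmem r A) inp out) t
         (State (gmem r A) inp (out ++ map (teval_tok r A) s)) /\ t <= X ^ K.
Proof.
elim: s => [|k s [K IHs]].
  by exists 1 => X r A inp out X_gt1 _ _; exists 1; rewrite cats0 expn1 ltnW //; split=> //; apply: ExSkip.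
have [L cL] := cost_ctok k a.
exists ((1 + (1 + L).+1).+1 + K).+1 => X r A inp out X_gt1 le_r le_A.
have [t [exec_s le_t]] := IHs X r A inp (rcons out (teval_tok r A k)) X_gt1 le_r le_A.
exists (1 + (1 + cost (gmem r A) (ctok k)) + t); split.
  rewrite -cat_rcons -(eval_ctok r A) in exec_s *.
  by apply: ExSeq exec_s; apply: (ExWrite (ctok k)).
have le1 := leq_polyC X_gt1 1.
by apply: leq_polyD => //; do 2![apply: leq_polyD => //]; apply: cL.
Qed.

Lemma bits_Negz v : bits (Negz v) <= v.+3.
Proof.
rewrite /bits !ltnS; apply: trunc_log_le.
by apply: leq_trans (ltn_expl v.+1 (ltnSn 1)) _; rewrite leq_exp2l.
Qed.

Lemma cost_test v e a : exists K, forall X r A, 1 < X -> (forall w, r w <= X ^ a) ->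
  r v <= neval r e -> cost (gmem r A) (ESub (cnexp e) (creg v)) <= X ^ K.
Proof.
have [K HK] := cost_cnexp e a; have [L HL] := cost_cnexp (NV v) a.
exists ((K + 2).+1 + (K + L).+1).+1 => X r A X_gt1 le_r le_v.
have [le_e cost_e] := HK X r A X_gt1 le_r; have [_ cost_v] := HL X r A X_gt1 le_r.
rewrite -[cost _ _]/(bits (eval (gmem r A) (cnexp e) - Posz (r v))%R +
  (cost (gmem r A) (cnexp e) + cost (gmem r A) (cnexp (NV v)))) eval_cnexp.
apply: leq_polyD => //; last exact: leq_polyD.
rewrite subzn //; apply: leq_trans (bits_nat _) _; apply: leq_polyD => //.
  by apply: leq_trans le_e; apply: leq_subr.
exact: leq_polyC.
Qed.

Lemma cost_set v e a : exists K, forall X r A, 1 < X -> (forall w, r w <= X ^ a) ->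
  1 + bits (Negz v) + cost (gmem r A) (cnexp e) <= X ^ K.
Proof.
have [K HK] := cost_cnexp e a.
exists ((1 + v.+3).+1 + K).+1 => X r A X_gt1 le_r; have [_ cost_e] := HK X r A X_gt1 le_r.
apply: leq_polyD => //; apply: leq_polyD => //; first exact: leq_polyC.
by apply: leq_trans (bits_Negz v) _; apply: leq_polyC.
Qed.

(** The exponent is chosen before [X] and the memory, from the program and [a] alone; this makes the
    bound uniform over all constraints. *)
Lemma exec_gen g a : gwf g -> exists K, forall X r A inp out,
  1 < X -> (forall v, r v <= X ^ a) -> (forall n, bits (A n) <= X) ->
  (forall v, v \in lvars g -> r v = 0) -> exists t,
    exec (compile g) (State (gmem r A) inp out) t
         (State (gmem r A) inp (out ++ gout A g r)) /\ t <= X ^ K.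
Proof.
elim: g a => [s|g IHg h IHh|v e g IHg] a /=.
- by move=> _; have [K HK] := exec_emit s a; exists K => *; apply: HK.
- case/andP=> wf_g wf_h; have [K HK] := IHg a wf_g; have [L HL] := IHh a wf_h.
  exists ((1 + K).+1 + L).+1 => X r A inp out X_gt1 le_r le_A r0.
  have [|t [exec_g le_t]] := HK X r A inp out X_gt1 le_r le_A.
    by move=> v gv; apply: r0; rewrite mem_cat gv.
  have [|u [exec_h le_u]] := HL X r A inp (out ++ gout A g r) X_gt1 le_r le_A.
    by move=> v hv; apply: r0; rewrite mem_cat hv orbT.
  rewrite catA; exists (1 + t + u); split; first exact: ExSeq exec_g exec_h.
  by apply: leq_polyD => //; apply: leq_polyD => //; apply: leq_polyC.
case/and3P=> ve vg wf_g.
(* Within the body the loop variable can be as large as the bound of the loop, so the induction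
   hypothesis is taken with a larger exponent. *)
have [b cb] := cost_cnexp e a; have [K HK] := IHg (a + b) wf_g.
have [S HS] := cost_test v e (a + b).
have [W HW] := cost_set v (NAdd (NV v) (NC 1)) (a + b).
have [W0 HW0] := cost_set v (NC 0) (a + b).
pose c := ((1 + S).+1 + ((1 + K).+1 + W).+1).+1.
exists ((1 + ((b + 1).+1 + c)).+1 + W0).+1 => X r A inp out X_gt1 le_r le_A r0.
have [le_e _] := cb X r A X_gt1 le_r.
have le_upd i : i <= neval r e -> forall w, updn r v i w <= X ^ (a + b).
  move=> le_i w; rewrite /updn; case: eqP => _.
    by apply: leq_trans le_i _; apply: leq_polyW le_e _ => //; apply: leq_addl.
  by apply: leq_polyW (le_r w) _ => //; apply: leq_addr.
have le1 := leq_polyC X_gt1 1.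
have eval_test i : eval (gmem (updn r v i) A) (ESub (cnexp e) (creg v)) = (Posz (neval r e) - Posz i)%R.
  by rewrite /= eval_cnexp neval_upd // /updn eqxx.
have cost_c i : i <= neval r e -> cost (gmem (updn r v i) A) (ESub (cnexp e) (creg v)) <= X ^ S.
  by move=> le_i; apply: HS => //; [apply: le_upd|rewrite neval_upd // /updn eqxx].
set W1 := CWhile _ _.
have loop k i out' : i + k = neval r e -> exists t,
    exec W1 (State (gmem (updn r v i) A) inp out') t
      (State (gmem (updn r v (neval r e)) A) inp
        (out' ++ flatten [seq gout A g (updn r v j) | j <- iota i k])) /\ t <= k.+1 * X ^ c.
  elim: k i out' => [|k IHk] i out' def_n.
    rewrite addn0 in def_n; exists (1 + cost (gmem (updn r v i) A) (ESub (cnexp e) (creg v))).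
    split; first by rewrite /= cats0 def_n; apply: ExWhileFalse; rewrite eval_test; lia.
    rewrite mul1n; have := cost_c i; rewrite def_n => /(_ (leqnn _)) le_c.
    by apply: leq_polyW (leq_polyD X_gt1 le1 le_c) _ => //; rewrite /c; lia.
  have le_i : i < neval r e by lia.
  have [|tg [exec_g le_tg]] := HK X (updn r v i) A inp out' X_gt1 (le_upd i (ltnW le_i)) le_A.
    by move=> w gw; rewrite /updn; case: eqP => [eq_w|_];
      [by rewrite -eq_w gw in vg|apply: r0; rewrite inE gw orbT].
  have [|tk [exec_k le_tk]] := IHk i.+1 (out' ++ gout A g (updn r v i)); first by lia.
  pose ts := 1 + bits (Negz v) + cost (gmem (updn r v i) A) (cnexp (NAdd (NV v) (NC 1))).
  exists (1 + cost (gmem (updn r v i) A) (ESub (cnexp e) (creg v)) + (1 + tg + ts) + tk); split.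
    apply: ExWhileTrue; first by rewrite eval_test; lia.
      apply: ExSeq exec_g _; exact: (exec_set v (cnexp (NAdd (NV v) (NC 1)))).
    rewrite [st_mem _]/= eval_cnexp upd_gmem updn_twice /= /updn eqxx addn1 -/(updn _ _ _).
    by rewrite catA.
  rewrite mulSn; apply: leq_add le_tk.
  have le_ts : ts <= X ^ W by apply: HW => //; apply: le_upd; lia.
  do !apply: leq_polyD => //; apply: cost_c; lia.
have [|t [exec_t le_t]] := loop (neval r e) 0 out; first by [].
have rv0 : r v = 0 by apply: r0; rewrite mem_head.
have upd0 : updn r v 0 = r by rewrite -rv0 updn_id.
rewrite upd0 in exec_t.
exists (1 + t + (1 + bits (Negz v) + cost (gmem (updn r v (neval r e)) A) (cnexp (NC 0)))); split.
  apply: ExSeq; first exact: exec_t.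
  have := exec_set v (cnexp (NC 0)) (State (gmem (updn r v (neval r e)) A) inp
    (out ++ flatten [seq gout A g (updn r v j) | j <- iota 0 (neval r e)])).
  by rewrite [st_mem _]/= eval_cnexp upd_gmem updn_twice [neval _ _]/= upd0.
apply: leq_polyD => //; last by apply: HW0 => //; apply: le_upd.
apply: leq_polyD => //; apply: leq_trans le_t _; apply: leq_polyM => //.
by rewrite -addn1; apply: leq_polyD.
Qed.

(** * Loading the constraint into memory *)

Definition dbc_data N (R : dbc N) : seq int :=
  flatten [seq [:: Posz (dvar_code a.1.1); Posz (dvar_code a.1.2); a.2] | a <- R].

Definition dbc_regs N (R : dbc N) : nat -> nat := updn (updn (fun=> 0) 0 N) 1 (size R).

Definition dbc_array N (R : dbc N) : nat -> int := fun n => nth 0%R (dbc_data R) n.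

Definition size_data : nexp := NMul (NC 3) (NV 1).

Definition read_array : cmd :=
  CWhile (ESub (cnexp size_data) (creg 2))
         (CSeq (CRead (creg 2)) (cset 2 (cnexp (NAdd (NV 2) (NC 1))))).

Definition read_dbc : cmd :=
  CSeq (CRead (ECst (Negz 0))) (CSeq (CRead (ECst (Negz 1)))
    (CSeq read_array (cset 2 (cnexp (NC 0))))).

Lemma size_dbc_data N (R : dbc N) : size (dbc_data R) = 3 * size R.
Proof. by rewrite /dbc_data; elim: R => // a R IHR /=; rewrite IHR mulnS. Qed.

Lemma size_leq_bits (s : seq int) : 2 * size s <= \sum_(z <- s) bits z.
Proof.
elim: s => [|z s IHs]; first by rewrite big_nil.
by rewrite big_cons /= mulnS leq_add.
Qed.

Lemma mem_leq_bits (s : seq int) z : z \in s -> bits z <= \sum_(y <- s) bits y.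
Proof. by move=> sz; rewrite (big_rem z sz) /= leq_addr. Qed.

Lemma exec_read a s : exec (CRead a) s (1 + cost (st_mem s) a + bits (head 0%R (st_inp s)))
  (State (upd (st_mem s) (eval (st_mem s) a) (head 0%R (st_inp s))) (behead (st_inp s)) (st_out s)).
Proof. exact: ExRead. Qed.

Lemma eval_sub_reg r A e v :
  eval (gmem r A) (ESub (cnexp e) (creg v)) = (Posz (neval r e) - Posz (r v))%R.
Proof. by rewrite /= eval_cnexp. Qed.

Lemma exec_read_dbc : exists K, forall N (R : dbc N), exists t,
  exec read_dbc (State (fun=> 0%R) (enc_dbc R) [::]) t
       (State (gmem (dbc_regs R) (dbc_array R)) [::] [::]) /\ t <= (bin_size R + 2) ^ K.
Proof.
have [S HS] := cost_test 2 size_data 1.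
have [W HW] := cost_set 2 (NAdd (NV 2) (NC 1)) 1.
have [W0 HW0] := cost_set 2 (NC 0) 1.
have [L HL] := cost_cnexp (NV 2) 1.
pose c := ((1 + S).+1 + ((1 + ((1 + L).+1 + 1).+1).+1 + W).+1).+1.
pose d v := ((1 + v.+3).+1 + 1).+1.
exists ((1 + d 0).+1 + ((1 + d 1).+1 + ((1 + ((1 + 1).+1 + c)).+1 + W0).+1).+1).+1 => N R.
set X := bin_size R + 2; have X_gt1 : 1 < X by rewrite /X; lia.
have le1 := leq_polyC X_gt1 1.
have leX n : n <= bin_size R -> n <= X ^ 1 by rewrite expn1 /X; lia.
have le_bits z : z \in enc_dbc R -> bits z <= X ^ 1.
  move=> /mem_leq_bits le_z; apply: leX; apply: leq_trans le_z _.
  by rewrite /bin_size leq_addl.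
have le_3S : 3 * size R <= X ^ 1.
  apply: leX; rewrite /bin_size -size_dbc_data.
  have := size_leq_bits (enc_dbc R); rewrite /= -/(dbc_data R); lia.
have le_N : N <= X ^ 1 by apply: leX; rewrite /bin_size; lia.
have le_regs i : i <= 3 * size R -> forall w, updn (dbc_regs R) 2 i w <= X ^ 1.
  move=> le_i w; rewrite /updn /dbc_regs /updn; case: ifP => _; first exact: leq_trans le_3S.
  by case: ifP => _; [apply: leq_trans le_3S; lia|case: ifP].
pose A i n := if n < i then dbc_array R n else 0%R.
have cost_c v r : 1 + cost r (ECst (Negz v)) <= X ^ (1 + v.+3).+1.
  apply: leq_polyD => //; rewrite /= addn0.
  by apply: leq_trans (bits_Negz v) _; apply: leq_polyC.
have size_dataE i : neval (updn (dbc_regs R) 2 i) size_data = 3 * size R by [].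
have loop k i : i + k = 3 * size R -> exists t,
    exec read_array (State (gmem (updn (dbc_regs R) 2 i) (A i)) (drop i (dbc_data R)) [::]) t
      (State (gmem (updn (dbc_regs R) 2 (3 * size R)) (dbc_array R)) [::] [::]) /\
    t <= k.+1 * X ^ c.
  elim: k i => [|k IHk] i def_n.
    rewrite addn0 in def_n; rewrite def_n -size_dbc_data drop_size.
    have -> : A (size (dbc_data R)) = dbc_array R.
      apply: functional_extensionality => n; rewrite /A /dbc_array.
      by case: ltnP => // le_n; rewrite nth_default.
    rewrite size_dbc_data.
    exists (1 + cost (gmem (updn (dbc_regs R) 2 (3 * size R)) (dbc_array R))
                     (ESub (cnexp size_data) (creg 2))).
    split; first by apply: ExWhileFalse; rewrite eval_sub_reg size_dataE /updn eqxx; lia.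
    rewrite mul1n; have le_c := HS X (updn (dbc_regs R) 2 (3 * size R)) (dbc_array R)
      X_gt1 (le_regs _ (leqnn _)) (leqnn _).
    by apply: leq_polyW (leq_polyD X_gt1 le1 le_c) _ => //; rewrite /c; lia.
  have [|t [exec_t le_t]] := IHk i.+1; first by lia.
  have lt_i : i < 3 * size R by lia.
  set r := updn (dbc_regs R) 2 i.
  pose z := nth 0%R (dbc_data R) i.
  have hd : head 0%R (drop i (dbc_data R)) = z by rewrite -nth0 nth_drop addn0.
  pose tr := 1 + cost (gmem r (A i)) (creg 2) + bits z.
  pose ts := 1 + bits (Negz 2) + cost (gmem r (A i.+1)) (cnexp (NAdd (NV 2) (NC 1))).
  exists (1 + cost (gmem r (A i)) (ESub (cnexp size_data) (creg 2)) + (1 + tr + ts) + t); split.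
    apply: ExWhileTrue exec_t; first by rewrite eval_sub_reg size_dataE /r /updn eqxx; lia.
    have E1 := exec_read (creg 2) (State (gmem r (A i)) (drop i (dbc_data R)) [::]).
    rewrite [st_inp _]/= [st_mem _]/= hd [eval _ _]/= in E1.
    have upd_A : upd (gmem r (A i)) (Posz i) z = gmem r (A i.+1).
      apply: functional_extensionality => -[n|n]; rewrite /upd //=.
      rewrite (_ : (Posz n == Posz i) = (n == i)) // /A.
      case: eqP => [->|/eqP neq_n]; first by rewrite ltnSn.
      by rewrite [n < i.+1]ltnS [n <= i]leq_eqVlt (negPf neq_n).
    have behd : behead (drop i (dbc_data R)) = drop i.+1 (dbc_data R) by rewrite -drop1 drop_drop add1n.
    rewrite [Posz _]/= in E1.
    rewrite upd_A behd in E1; apply: ExSeq E1 _.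
    have E2 := exec_set 2 (cnexp (NAdd (NV 2) (NC 1)))
      (State (gmem r (A i.+1)) (drop i.+1 (dbc_data R)) [::]).
    by rewrite [st_mem _]/= eval_cnexp upd_gmem updn_twice [neval _ _]/= addn1 in E2.
  have le_r := le_regs i (ltnW lt_i).
  have le_z : bits z <= X ^ 1.
    apply: le_bits; rewrite !inE -/(dbc_data R) mem_nth ?orbT // size_dbc_data.
    exact: lt_i.
  rewrite mulSn; apply: leq_add le_t.
  have le_ts : ts <= X ^ W by apply: HW.
  have le_tr : tr <= X ^ ((1 + L).+1 + 1).+1.
    by do 2![apply: leq_polyD => //]; have [] := HL X r (A i) X_gt1 le_r.
  apply: leq_polyD => //; apply: leq_polyD => //; last exact: leq_polyD.
  by apply: HS => //; apply: ltnW.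
have mem0 : (fun=> 0%R) = gmem (fun=> 0) (fun=> 0%R) :> (int -> int).
  by apply: functional_extensionality => -[].
have E1 := exec_read (ECst (Negz 0)) (State (fun=> 0%R) (enc_dbc R) [::]).
rewrite [st_mem _]/= [st_inp _]/= [head _ _]/= [behead _]/= mem0 upd_gmem in E1.
have E2 := exec_read (ECst (Negz 1))
  (State (gmem (updn (fun=> 0) 0 N) (fun=> 0%R)) (behead (enc_dbc R)) [::]).
rewrite [st_mem _]/= [st_inp _]/= [head _ _]/= [behead _]/= upd_gmem in E2.
have [|t [E3 le_t]] := loop (3 * size R) 0; first by [].
have r0 : updn (dbc_regs R) 2 0 = dbc_regs R by rewrite -{2}(updn_id (dbc_regs R) 2).
rewrite r0 drop0 in E3.
have E4 := exec_set 2 (cnexp (NC 0))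
  (State (gmem (updn (dbc_regs R) 2 (3 * size R)) (dbc_array R)) [::] [::]).
rewrite [st_mem _]/= eval_cnexp upd_gmem updn_twice [neval _ _]/= r0 in E4.
rewrite mem0; eexists; split.
  apply: ExSeq; first exact: E1.
  apply: ExSeq; first exact: E2.
  apply: ExSeq; first exact: E3.
  exact: E4.
have le_bits0 : bits (Posz N) <= X ^ 1 by apply: le_bits; rewrite mem_head.
have le_bits1 : bits (Posz (size R)) <= X ^ 1 by apply: le_bits; rewrite !inE eqxx orbT.
apply: leq_polyD => //.
  by apply: leq_polyD => //; apply: leq_polyD => //; apply: cost_c.
apply: leq_polyD => //.
  by apply: leq_polyD => //; apply: leq_polyD => //; apply: cost_c.
apply: leq_polyD => //; last by apply: HW0 => //; apply: le_regs.
apply: leq_polyD => //; apply: leq_trans le_t _; apply: leq_polyM => //.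
by rewrite -addn1; apply: leq_polyD.
Qed.

Lemma gen_polytime (F : forall N, dbc N -> fml (kvar N)) (g : gen) :
  gwf g -> 0 \notin lvars g -> 1 \notin lvars g ->
  (forall N (R : dbc N), gout (dbc_array R) g (dbc_regs R) = enc_kform (F N R)) ->
  polytime F.
Proof.
move=> wf_g no0 no1 gE; have [K HK] := exec_read_dbc; have [L HL] := exec_gen 1 wf_g.
exists (CSeq read_dbc (compile g)), (3 ^ ((1 + K).+1 + L).+1), ((1 + K).+1 + L).+1 => N R _.
have [t [exec_t le_t]] := HK N R.
set X := bin_size R + 2 in le_t; have X_gt1 : 1 < X by rewrite /X; lia.
have [|||u [exec_u le_u]] := HL X (dbc_regs R) (dbc_array R) [::] [::] X_gt1.
- have := size_leq_bits (enc_dbc R); rewrite /= -/(dbc_data R) size_dbc_data => le_S.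
  move=> v; rewrite expn1 /dbc_regs /updn /X /bin_size /=.
  by case: eqP => _; last case: eqP => _; lia.
- move=> n; rewrite /dbc_array /X.
  have [lt_n|le_n] := ltnP n (size (dbc_data R)); last by rewrite nth_default //; rewrite /bits /=; lia.
  apply: leq_trans (leq_addr 2 _); rewrite /bin_size; apply: leq_trans (leq_addl N _).
  by apply: mem_leq_bits; rewrite !inE -/(dbc_data R) mem_nth ?orbT.
- move=> v gv; rewrite /dbc_regs /updn; case: eqP => [eq_v|_]; first by rewrite -eq_v gv in no1.
  by case: eqP => [eq_v|//]; rewrite -eq_v gv in no0.
exists (1 + t + u); eexists; split; first exact: ExSeq exec_t exec_u.
  exact: gE.
have le1 := leq_polyC X_gt1 1.
have le_tu : 1 + t + u <= X ^ ((1 + K).+1 + L).+1 by do 2![apply: leq_polyD => //].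
apply: leq_trans le_tu _; set D := _.+1; rewrite /X.
(* A positive size plus 2 is at most three times the size, hence the constant [3 ^ D]; for size 0
   the summand 1 takes over. *)
have [->|b_gt0] := posnP (bin_size R).
  by rewrite exp0n // muln1 leq_exp2r.
apply: (@leq_trans ((3 * bin_size R) ^ D)); first by rewrite leq_exp2r //; lia.
by rewrite expnMn leq_mul2l leq_addr orbT.
Qed.

(** * Output of the formulas *)

Lemma enc_term_ren V W (r : V -> W) g t : enc_term g (tren r t) = enc_term (g \o r) t.
Proof. by elim: t => //= [t -> u ->|c t ->]. Qed.

Lemma enc_form_ren V (f : fml V) W (r : V -> W) d g :
  enc_form d g (fren f r) = enc_form d (g \o r) f.
Proof.
have lift U n (s : U -> W) (h : W -> nat) (c : 'I_n -> nat) :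
    sumf h c \o sumf (inl \o s) inr = sumf (h \o s) c by apply: sumf_comp.
elim: f W r d g lift => {V} /= [V t u|V f IHf h IHh|V f IHf h IHh|V f IHf|V n f IHf|V n f IHf] W r d g lift.
- by rewrite !enc_term_ren.
- by rewrite IHf ?IHh // => *; apply: sumf_comp.
- by rewrite IHf ?IHh // => *; apply: sumf_comp.
- by rewrite IHf // => *; apply: sumf_comp.
- by rewrite IHf ?lift // => *; apply: sumf_comp.
- by rewrite IHf ?lift // => *; apply: sumf_comp.
Qed.

Lemma enc_form_bigand V I (s : seq I) (F : I -> fml V) d g :
  enc_form d g (bigand s F) =
  flatten [seq 5%Z :: enc_form d g (F i) | i <- s] ++ [:: 4; 1; 0; 1; 0]%Z.
Proof. by elim: s => //= i s ->; rewrite catA. Qed.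

Fixpoint nbelow (v : nat) (e : nexp) : bool :=
  match e with
  | NC _ => true
  | NV w => w < v
  | NAdd e f | NMul e f => nbelow v e && nbelow v f
  end.

Lemma nbelow_le v w e : v <= w -> nbelow v e -> nbelow w e.
Proof.
move=> le_vw; elim: e => //= [u|e IHe f IHf /andP[/IHe -> /IHf ->]|e IHe f IHf /andP[/IHe -> /IHf ->]] //.
by move=> lt_u; apply: leq_trans lt_u le_vw.
Qed.

Lemma nbelow_nocc v e : nbelow v e -> nocc v e.
Proof.
by elim: e => //= [u|e IHe f IHf /andP[/IHe -> /IHf ->]|e IHe f IHf /andP[/IHe -> /IHf ->]] //;
  rewrite neq_ltn => ->.
Qed.

(* [e] has the value [n] and mentions no variable from v on, so that loops over
   these variables do not affect it. *)
Definition ev v (r : nat -> nat) e n := nbelow v e /\ neval r e = n.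

Lemma ev_eq v r e m n : ev v r e m -> m = n -> ev v r e n.
Proof. by move=> Hm <-. Qed.

Lemma ev_up v r e n w i : ev v r e n -> v <= w -> ev w.+1 (updn r w i) e n.
Proof.
move=> [le_e <-] le_vw; have lt_e := nbelow_le le_vw le_e.
split; last by rewrite neval_upd //; apply: nbelow_nocc.
exact: nbelow_le (leqnSn w) lt_e.
Qed.

Lemma ev_up2 v r e n w i w' i' : ev v r e n -> v <= w -> w < w' ->
  ev w'.+1 (updn (updn r w i) w' i') e n.
Proof. by move=> He le_vw lt_w; apply: ev_up lt_w; apply: ev_up He le_vw. Qed.

Lemma ev_C v r n : ev v r (NC n) n. Proof. by []. Qed.

Lemma ev_V v r i : ev v.+1 (updn r v i) (NV v) i.
Proof. by split; rewrite /= ?ltnSn // /updn eqxx. Qed.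

Lemma ev_add v r e f m n : ev v r e m -> ev v r f n -> ev v r (NAdd e f) (m + n).
Proof. by move=> [le_e <-] [le_f <-]; split=> //=; rewrite le_e. Qed.

Lemma ev_mul v r e f m n : ev v r e m -> ev v r f n -> ev v r (NMul e f) (m * n).
Proof. by move=> [le_e <-] [le_f <-]; split=> //=; rewrite le_e. Qed.

Definition tkC n := TkN (NC n).

Definition GTrue : gen := GEmit [:: tkC 4; tkC 1; tkC 0; tkC 1; tkC 0].

Definition nN := NV 0.
Definition nN2 := NMul nN nN.
Definition nadd b k := NAdd b (NMul (NC k) nN).

Definition GEights v : gen := GFor v nN (GEmit [:: tkC 8]).

Definition GAll v (g : gen) : gen := GCat (GFor v nN (GCat (GEmit [:: tkC 5]) g)) GTrue.

Definition GEq v bx by' : gen :=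
  GAll v (GEmit [:: tkC 5; tkC 4; tkC 0; TkN (NAdd bx (NV v)); tkC 0; TkN (NAdd by' (NV v));
                    tkC 4; tkC 0; TkN (NAdd by' (NV v)); tkC 0; TkN (NAdd bx (NV v))]).

Definition GR v b tt tv : gen :=
  GCat (GFor v (NV 1) (GEmit [:: tkC 5; tkC 4; tkC 0; TkA b 0 v; tkC 2; tkC 0; TkA b 1 v;
                                 tkC 3; TkA (NC 0) 2 v; TkN tt; TkN tv])) GTrue.

(** The arguments are the first free loop variable, the number of the first variable of the source
    block, and two tokens for the factor. Two suffice because the factor is always a constant or a
    variable. *)
Definition sgen := nat -> nexp -> nexp -> nexp -> gen.

Definition GChain (sg : sgen) v n b bx' tt tv : gen :=
  GCat (GFor v n (GCat (GEights v.+1) (GCat (GEmit [:: tkC 5])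
                   (sg v.+1 (NAdd b (NMul (NV v) nN)) tt tv))))
       (GEq v (NAdd b (NMul n nN)) bx').

Definition GPow (sg : sgen) v n bx bx' d tt tv : gen :=
  GCat (GEights v) (GCat (GEmit [:: tkC 5]) (GCat (GEq v bx d) (GChain sg v n d bx' tt tv))).

Definition GRs : sgen := fun v b tt tv =>
  GCat (GEmit [:: tkC 5]) (GCat (GR v b tt tv) (GCat (GEmit [:: tkC 5])
    (GCat (GCat (GEights v) (GPow GR v nN2 b (nadd b 2) (nadd b 3) tt tv))
          (GCat (GEights v) (GPow GR v nN2 (nadd b 2) (nadd b 1) (nadd b 3) tt tv))))).

Section Output.

Variables (N : nat) (R : dbc N).

Let A := dbc_array R.

Definition ctx (r : nat -> nat) v := [/\ r 0 = N, r 1 = size R & 1 < v].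

Definition at_ V (g : V -> nat) (x : 'I_N -> V) b := forall i, g (x i) = b + i.

Lemma ctx_up r v w i : ctx r v -> v <= w -> ctx (updn r w i) w.+1.
Proof.
move=> [r0 r1 v_gt1] le_vw; split; last by lia.
  by rewrite /updn; case: eqP => //; lia.
by rewrite /updn; case: eqP => //; lia.
Qed.

Lemma ev_N r v : ctx r v -> ev v r nN N.
Proof. by move=> [r0 _ v_gt1]; split=> //=; lia. Qed.

Lemma ev_N2 r v : ctx r v -> ev v r nN2 (N ^ 2).
Proof. by move=> /ev_N HN; rewrite -mulnn; apply: ev_mul. Qed.

Lemma ev_nadd r v b n k : ctx r v -> ev v r b n -> ev v r (nadd b k) (n + k * N).
Proof. by move=> /ev_N HN Hb; apply: ev_add => //; apply: ev_mul. Qed.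

Lemma out_eights r v : ctx r v -> gout A (GEights v) r = nseq N 8%Z.
Proof.
move=> [r0 _ _]; rewrite -[LHS]/(flatten [seq [:: 8%Z] | _ <- iota 0 (r 0)]) r0.
by move: {r0}(iota 0 N) (size_iota 0 N) => s <-; elim: s => // i s IHs; congr (_ :: _).
Qed.

Lemma out_all r v g V (F : 'I_N -> fml V) d h : ctx r v ->
  (forall i : 'I_N, gout A g (updn r v i) = enc_form d h (F i)) ->
  gout A (GAll v g) r = enc_form d h (bigand (enum 'I_N) F).
Proof.
move=> [r0 _ _] gF; rewrite enc_form_bigand /= r0; congr (flatten _ ++ _).
by rewrite -val_enum_ord -map_comp; apply: eq_map => i /=; rewrite gF.
Qed.

Lemma tok_add r v b bn i n : ev v r b bn -> n = bn + i ->
  Posz (neval (updn r v i) (NAdd b (NV v))) = Posz n.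
Proof.
move=> Hb ->; have [_ <-] := ev_add (ev_up i Hb (leqnn v)) (ev_V v r i).
by [].
Qed.

Lemma out_eq r v bx by' V (x y : 'I_N -> V) d g xn yn : ctx r v ->
  ev v r bx xn -> ev v r by' yn -> at_ g x xn -> at_ g y yn ->
  gout A (GEq v bx by') r = enc_form d g (EqF x y).
Proof.
move=> Hc Hx Hy gx gy; apply: out_all => // i.
have Ex := tok_add Hx (gx i); have Ey := tok_add Hy (gy i).
rewrite -[LHS]/(let a := Posz (neval (updn r v i) (NAdd bx (NV v))) in
  let b := Posz (neval (updn r v i) (NAdd by' (NV v))) in
  [:: 5; 4; 0; a; 0; b; 4; 0; b; 0; a]%Z).
by rewrite Ex Ey.
Qed.

Lemma dbc_arrayE (a0 : atom N) i : i < size R ->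
  [/\ A (3 * i + 0) = dvar_code (nth a0 R i).1.1,
      A (3 * i + 1) = dvar_code (nth a0 R i).1.2 & A (3 * i + 2) = (nth a0 R i).2].
Proof.
rewrite /A /dbc_array /dbc_data; elim: R i => // a s IHs [|i] // lt_i.
have [E0 E1 E2] := IHs i lt_i.
have eq_i k : 3 * i.+1 + k = (3 * i + k).+3 by lia.
by rewrite !eq_i; split; [exact: E0|exact: E1|exact: E2].
Qed.

(** The target block follows the source block and is the last in scope, so [bn] also determines the
    first fresh number [d]. *)
Definition step_out (F : stepF N) (sg : sgen) :=
  forall r v b tt tv V (g : V -> nat) x x' T bn d t1 t2, ctx r v ->
    ev v r b bn -> ev v r tt t1 -> ev v r tv t2 -> d = bn + 2 * N ->
    at_ g x bn -> at_ g x' (bn + N) -> enc_term g T = [:: Posz t1; Posz t2] ->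
    gout A (sg v b tt tv) r = enc_form d g (F V x x' T).

Lemma out_R : step_out (RF R) GR.
Proof.
move=> r v b tt tv V g x x' T bn d t1 t2 [r0 r1 v_gt1] Hb Ht1 Ht2 _ gx gx' ET.
rewrite enc_form_bigand /GR [LHS]/= r1; congr (flatten _ ++ _).
have [->|[a0 _]] : R = [::] \/ exists a0 : atom N, True.
- by case: (R) => [|a0]; [left|right; exists a0].
- by [].
rewrite -[in RHS](mkseq_nth a0 R) /mkseq -map_comp; apply/eq_in_map => i.
rewrite mem_iota /= => lt_i; have [E0 E1 E2] := dbc_arrayE a0 lt_i.
have [_ Eb] := ev_up i Hb (leqnn v); have [_ Et1] := ev_up i Ht1 (leqnn v).
have [_ Et2] := ev_up i Ht2 (leqnn v).
have gE u : g (sumf x x' u) = bn + dvar_code u.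
  by case: u => j; rewrite /= ?gx ?gx' // addnA.
have rv : updn r v i v = i by rewrite /updn eqxx.
rewrite -[LHS]/[:: 5%Z; 4%Z; 0%Z; (Posz (neval (updn r v i) b) + A (3 * updn r v i v + 0))%R;
  2%Z; 0%Z; (Posz (neval (updn r v i) b) + A (3 * updn r v i v + 1))%R;
  3%Z; (0 + A (3 * updn r v i v + 2))%R;
  Posz (neval (updn r v i) tt); Posz (neval (updn r v i) tv)].
rewrite rv E0 E1 E2 Eb Et1 Et2 [RHS]/= ET !gE !PoszD add0r; case: (nth a0 R i) => [[u w] c].
by [].
Qed.

Lemma at_new V (g : V -> nat) d : at_ (sumf g (fun i : 'I_N => d + val i)) inr d.
Proof. by []. Qed.

Lemma at_lift V (g : V -> nat) n (h : 'I_n -> nat) (x : 'I_N -> V) b :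
  at_ g x b -> at_ (sumf g h) (inl \o x) b.
Proof. by []. Qed.

Lemma enc_lift V (g : V -> nat) n (h : 'I_n -> nat) T :
  enc_term (sumf g h) (tren inl T) = enc_term g T.
Proof. exact: enc_term_ren. Qed.

Lemma out_chain F sg : step_out F sg ->
  forall r v n b bx' tt tv V (g : V -> nat) y x' T nn bn xn t1 t2, ctx r v ->
    ev v r n nn -> ev v r b bn -> ev v r bx' xn -> ev v r tt t1 -> ev v r tv t2 ->
    at_ g y bn -> at_ g x' xn -> enc_term g T = [:: Posz t1; Posz t2] ->
    gout A (GChain sg v n b bx' tt tv) r = enc_form (bn + N) g (chainF F nn y x' T).
Proof.
move=> Fsg r v n b bx' tt tv V g y x' T nn bn xn t1 t2 Hc Hn Hb Hx' Ht1 Ht2 gy gx' ET.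
pose body i := gout A (GEights v.+1) (updn r v i) ++
  5%Z :: gout A (sg v.+1 (NAdd b (NMul (NV v) nN)) tt tv) (updn r v i).
rewrite -[LHS]/(flatten [seq body i | i <- iota 0 (neval r n)] ++
  gout A (GEq v (NAdd b (NMul n nN)) bx') r).
have [_ ->] := Hn.
(* One round of the printing loop matches one quantifier block, which enlarges the type of
   variables; hence the generalisation over [W], its numbering and the factor. *)
have loop k m W (h : W -> nat) z z' S : m + k = nn -> at_ h z (bn + m * N) -> at_ h z' xn ->
    enc_term h S = [:: Posz t1; Posz t2] ->
    flatten [seq body i | i <- iota m k] ++ gout A (GEq v (NAdd b (NMul n nN)) bx') r =
    enc_form (bn + m * N + N) h (chainF F k z z' S).
  elim: k m W h z z' S => [|k IHk] m W h z z' S def_nn hz hz' ES.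
    rewrite addn0 in def_nn; rewrite -def_nn in Hn.
    by apply: (out_eq _ Hc _ Hx' hz hz'); apply: ev_add => //; apply: ev_mul => //; apply: ev_N.
  rewrite -[RHS]/(nseq N 8%Z ++ 5%Z :: enc_form (bn + m * N + N + N)
      (sumf h (fun i => bn + m * N + N + val i)) (F _ (inl \o z) inr (tren inl S)) ++
    enc_form (bn + m * N + N + N)
      (sumf h (fun i => bn + m * N + N + val i)) (chainF F k inr (inl \o z') (tren inl S))).
  have Hc' : ctx (updn r v m) v.+1 by apply: ctx_up Hc _.
  rewrite -[flatten _]/(body m ++ flatten [seq body i | i <- iota m.+1 k]).
  rewrite {1}/body (out_eights Hc') -!catA; congr (_ ++ _).
  rewrite cat_cons; congr (_ :: _ ++ _).
    apply: (Fsg _ _ _ _ _ _ _ _ _ _ (bn + m * N) _ t1 t2) => //.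
    - apply: ev_add; first exact: ev_up Hb (leqnn v).
      by apply: ev_mul; [apply: ev_V|apply: ev_N].
    - exact: ev_up Ht1 (leqnn v).
    - exact: ev_up Ht2 (leqnn v).
    - by lia.
    - by rewrite enc_lift.
  have -> : bn + m * N + N + N = bn + m.+1 * N + N by rewrite mulSn; lia.
  apply: IHk; [lia| |exact: at_lift|by rewrite enc_lift].
  by move=> i /=; rewrite mulSn; lia.
rewrite (loop nn 0 V g y x' T) //; first by rewrite mul0n addn0.
by rewrite mul0n addn0.
Qed.

Lemma out_pow F sg : step_out F sg ->
  forall r v n bx bx' e tt tv V (g : V -> nat) x x' T nn xn xn' d t1 t2, ctx r v ->
    ev v r n nn -> ev v r bx xn -> ev v r bx' xn' -> ev v r e d ->
    ev v r tt t1 -> ev v r tv t2 ->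
    at_ g x xn -> at_ g x' xn' -> enc_term g T = [:: Posz t1; Posz t2] ->
    gout A (GPow sg v n bx bx' e tt tv) r = enc_form d g (powF F nn x x' T).
Proof.
move=> Fsg r v n bx bx' e tt tv V g x x' T nn xn xn' d t1 t2 Hc Hn Hx Hx' He Ht1 Ht2 gx gx' ET.
pose g' := sumf g (fun i : 'I_N => d + val i).
rewrite -[LHS]/(gout A (GEights v) r ++ 5%Z :: gout A (GEq v bx e) r ++
  gout A (GChain sg v n e bx' tt tv) r).
rewrite -[RHS]/(nseq N 8%Z ++ 5%Z :: enc_form (d + N) g' (EqF (inl \o x) inr) ++
  enc_form (d + N) g' (chainF F nn inr (inl \o x') (tren inl T))).
rewrite out_eights //; congr (_ ++ _ :: _ ++ _); first by apply: out_eq Hc Hx He _ _.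
apply: (out_chain Fsg (bn := d) (xn := xn') (t1 := t1) (t2 := t2)) => //.
by rewrite enc_lift.
Qed.

Lemma out_Rs : step_out (RsF R) GRs.
Proof.
move=> r v b tt tv V g x x' T bn d t1 t2 Hc Hb Ht1 Ht2 def_d gx gx' ET.
pose g' := sumf g (fun i : 'I_N => d + val i).
rewrite -[RHS]/(5%Z :: enc_form d g (RF R x x' T) ++ 5%Z ::
   ((nseq N 8%Z ++ enc_form (d + N) g' (powF (RF R) (N ^ 2) (inl \o x) inr (tren inl T))) ++
    (nseq N 8%Z ++ enc_form (d + N) g' (powF (RF R) (N ^ 2) inr (inl \o x') (tren inl T))))).
rewrite -[LHS]/(5%Z :: gout A (GR v b tt tv) r ++ 5%Z ::
  ((gout A (GEights v) r ++ gout A (GPow GR v nN2 b (nadd b 2) (nadd b 3) tt tv) r) ++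
   (gout A (GEights v) r ++ gout A (GPow GR v nN2 (nadd b 2) (nadd b 1) (nadd b 3) tt tv) r))).
have H2 : ev v r (nadd b 2) d by rewrite def_d; apply: ev_nadd.
have H3 : ev v r (nadd b 3) (d + N) by apply: (ev_eq (ev_nadd 3 Hc Hb)); lia.
have H1 : ev v r (nadd b 1) (bn + N) by apply: (ev_eq (ev_nadd 1 Hc Hb)); lia.
have HN2 := ev_N2 Hc.
have ET' : enc_term g' (tren inl T) = [:: Posz t1; Posz t2] by rewrite enc_lift.
rewrite !out_eights // (out_R Hc Hb Ht1 Ht2 def_d gx gx' ET).
rewrite (out_pow out_R Hc HN2 Hb H2 H3 Ht1 Ht2 (at_lift _ gx) (at_new g d) ET').
by rewrite (out_pow out_R Hc HN2 H2 H1 H3 Ht1 Ht2 (at_new g d) (at_lift _ gx') ET').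
Qed.

End Output.

(** * Printing the closed forms *)

Definition GDiff (dir : bool) bx bx' by_ by' ei ej : gen :=
  if dir then GEmit [:: tkC 4; tkC 2; tkC 0; TkN (NAdd bx ei); tkC 0; TkN (NAdd by' ej);
                        tkC 2; tkC 0; TkN (NAdd by_ ei); tkC 0; TkN (NAdd bx' ej)]
  else GEmit [:: tkC 4; tkC 2; tkC 0; TkN (NAdd bx' ei); tkC 0; TkN (NAdd by_ ej);
                 tkC 2; tkC 0; TkN (NAdd by' ei); tkC 0; TkN (NAdd bx ej)].

Definition GDir (dir : bool) : sgen := fun v b tt tv =>
  GAll v (GAll v.+1
    (GCat (GEights v.+2) (GCat (GEights v.+2) (GCat (GEmit [:: tkC 5])
      (GCat (GRs v.+2 (nadd b 2) tt tv)
            (GDiff dir b (nadd b 1) (nadd b 2) (nadd b 3) (NV v) (NV v.+1))))))).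

Definition GLoop (dir : bool) v p k nb c : gen :=
  GCat (GEmit [:: tkC 6; tkC 5; tkC 4; tkC 0; TkN nb; tkC 1; tkC 0; tkC 4; tkC 0;
                  TkN (NAdd (if dir then c else nadd c 1) k); tkC 0;
                  TkN (NAdd (if dir then nadd c 1 else c) k);
                  tkC 5; tkC 4; tkC 1; tkC 1; tkC 0; TkN nb])
    (GCat (GEights v) (GCat (GEights v) (GCat (GEmit [:: tkC 5])
      (GCat (GPow (GDir dir) v p (nadd c 2) (nadd c 3) (nadd c 4) (NC 0) nb)
            (GDiff dir c (nadd c 1) (nadd c 2) (nadd c 3) k k))))).

Definition GLasso (dir : bool) v m1 m2 k p nb bx bx' d : gen :=
  GCat (GEights v) (GCat (GEights v) (GCat (GEmit [:: tkC 5])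
    (GCat (GPow (GDir dir) v m1 bx d (nadd d 2) (NC 1) (NC 1))
    (GCat (GEmit [:: tkC 5])
    (GCat (GLoop dir v p k nb d)
          (GPow (GDir dir) v m2 (nadd d 1) bx' (nadd d 2) (NC 1) (NC 1))))))).

Definition GGuard (dir : bool) v m1 m2 k p nl bx bx' d : gen :=
  let m := NAdd m1 m2 in
  let pb := [:: tkC 3; TkN p; tkC 0; TkN d] in
  GCat (GEmit ([:: tkC 8; tkC 6; tkC 4; tkC 2; tkC 0; TkN nl; tkC 1; tkC 1; tkC 1; TkN m;
                   tkC 6; tkC 5; tkC 4; tkC 2] ++ pb ++ [:: tkC 1; TkN (NAdd m (NC 1)); tkC 0; TkN nl;
                   tkC 4; tkC 2; tkC 0; TkN nl; tkC 1; tkC 1; tkC 2] ++ pb ++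
                [:: tkC 1; TkN (NAdd m p); tkC 5; tkC 5; tkC 4; tkC 0; TkN nl; tkC 2] ++ pb ++
                [:: tkC 1; TkN m; tkC 4; tkC 2] ++ pb ++ [:: tkC 1; TkN m; tkC 0; TkN nl]))
       (GLasso dir v m1 m2 k p d bx bx' (NAdd d (NC 1))).

Definition GAnds v n (g : gen) : gen := GCat (GFor v n (GCat (GEmit [:: tkC 5]) g)) GTrue.

Definition GClosed (dir : bool) v nl bx bx' d : gen :=
  GAnds v nN (GAll v.+1 (GAnds v.+2 nN2 (GAnds v.+3 nN2
    (GGuard dir v.+4 (NV v.+2) (NV v.+3) (NV v.+1) (NAdd (NC 1) (NV v)) nl bx bx' d)))).

Section Output.

Variables (N : nat) (R : dbc N).

Let A := dbc_array R.

Lemma out_diff dir r v bx bx' by_ by' ei ej V (x x' y y' : 'I_N -> V) (i j : 'I_N) d g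
    xn xn' yn yn' :
  ev v r bx xn -> ev v r bx' xn' -> ev v r by_ yn -> ev v r by' yn' ->
  ev v r ei i -> ev v r ej j ->
  at_ g x xn -> at_ g x' xn' -> at_ g y yn -> at_ g y' yn' ->
  gout A (GDiff dir bx bx' by_ by' ei ej) r = enc_form d g (diffF dir x x' y y' i j).
Proof.
move=> [_ Hx] [_ Hx'] [_ Hy] [_ Hy'] [_ Hi] [_ Hj] gx gx' gy gy'.
by case: dir; rewrite /GDiff /= Hx Hx' Hy Hy' Hi Hj ?gx ?gx' ?gy ?gy'.
Qed.

Lemma out_Dir dir : step_out R (DirF dir R) (GDir dir).
Proof.
move=> r v b tt tv V g x x' T bn d t1 t2 Hc Hb Ht1 Ht2 def_d gx gx' ET.
apply: (out_all Hc) => i; have Hc1 := ctx_up i Hc (leqnn v).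
apply: (out_all Hc1) => j; have Hc2 := ctx_up j Hc1 (leqnn v.+1).
set r2 := updn _ _ _ in Hc2 *.
pose g1 := sumf g (fun i : 'I_N => d + val i).
pose g2 := sumf g1 (fun i : 'I_N => d + N + val i).
rewrite -[LHS]/(gout A (GEights v.+2) r2 ++ gout A (GEights v.+2) r2 ++ 5%Z ::
  gout A (GRs v.+2 (nadd b 2) tt tv) r2 ++
  gout A (GDiff dir b (nadd b 1) (nadd b 2) (nadd b 3) (NV v) (NV v.+1)) r2).
rewrite -[RHS]/(nseq N 8%Z ++ nseq N 8%Z ++ 5%Z ::
  enc_form (d + N + N) g2 (RsF R (inl \o inr) inr (tren inl (tren inl T))) ++
  enc_form (d + N + N) g2
    (diffF dir (inl \o (inl \o x)) (inl \o (inl \o x')) (inl \o inr) inr i j)).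
have up e n : ev v r e n -> ev v.+2 r2 e n by move=> He; apply: (ev_up2 _ _ He).
have [[Hb' Ht1'] Ht2'] := (up _ _ Hb, up _ _ Ht1, up _ _ Ht2).
have H1 : ev v.+2 r2 (nadd b 1) (bn + N) by apply: (ev_eq (ev_nadd 1 Hc2 Hb')); lia.
have H2 : ev v.+2 r2 (nadd b 2) d by rewrite def_d; apply: (ev_nadd 2 Hc2 Hb').
have H3 : ev v.+2 r2 (nadd b 3) (d + N) by apply: (ev_eq (ev_nadd 3 Hc2 Hb')); lia.
have Hi : ev v.+2 r2 (NV v) i by apply: ev_up (leqnn _); apply: ev_V.
have Hj : ev v.+2 r2 (NV v.+1) j by apply: ev_V.
have ET' : enc_term g2 (tren inl (tren inl T)) = [:: Posz t1; Posz t2] by rewrite !enc_lift.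
rewrite !out_eights //; congr (_ ++ _ ++ _ :: _ ++ _).
  apply: (out_Rs (bn := d) Hc2 H2 Ht1' Ht2' _ _ _ ET') => //; lia.
exact: (out_diff _ _ Hb' H1 H2 H3 Hi Hj).
Qed.

Lemma out_loop dir r v p k nb c V (b : V) (y z : 'I_N -> V) (kn : 'I_N) g pn cn d :
  ctx R r v -> ev v r p pn -> ev v r k kn -> ev v r nb (g b) -> ev v r c cn ->
  d = cn + 2 * N -> at_ g y cn -> at_ g z (cn + N) ->
  gout A (GLoop dir v p k nb c) r = enc_form d g (LoopF dir R pn kn b y z).
Proof.
move=> Hc Hp Hk Hnb Hcn def_d gy gz.
pose g1 := sumf g (fun i : 'I_N => d + val i).
pose g2 := sumf g1 (fun i : 'I_N => d + N + val i).
have H1 : ev v r (nadd c 1) (cn + N) by apply: (ev_eq (ev_nadd 1 Hc Hcn)); lia.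
have H2 : ev v r (nadd c 2) d by rewrite def_d; apply: (ev_nadd 2 Hc Hcn).
have H3 : ev v r (nadd c 3) (d + N) by apply: (ev_eq (ev_nadd 3 Hc Hcn)); lia.
have H4 : ev v r (nadd c 4) (d + N + N) by apply: (ev_eq (ev_nadd 4 Hc Hcn)); lia.
pose yk := Posz (neval r (NAdd (if dir then c else nadd c 1) k)).
pose zk := Posz (neval r (NAdd (if dir then nadd c 1 else c) k)).
pose bk := Posz (neval r nb).
rewrite -[LHS]/([:: 6; 5; 4; 0; bk; 1; 0; 4; 0; yk; 0; zk; 5; 4; 1; 1; 0; bk]%Z ++
  gout A (GEights v) r ++ gout A (GEights v) r ++ 5%Z ::
  gout A (GPow (GDir dir) v p (nadd c 2) (nadd c 3) (nadd c 4) (NC 0) nb) r ++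
  gout A (GDiff dir c (nadd c 1) (nadd c 2) (nadd c 3) k k) r).
have -> : enc_form d g (LoopF dir R pn kn b y z) =
  [:: 6; 5; 4; 0; Posz (g b); 1; 0; 4; 0; Posz (g (if dir then y kn else z kn)); 0;
      Posz (g (if dir then z kn else y kn)); 5; 4; 1; 1; 0; Posz (g b)]%Z ++
  nseq N 8%Z ++ nseq N 8%Z ++ 5%Z ::
  enc_form (d + N + N) g2 (powF (DirF dir R) pn (inl \o inr) inr (TVar (inl (inl b)))) ++
  enc_form (d + N + N) g2
    (diffF dir (inl \o (inl \o y)) (inl \o (inl \o z)) (inl \o inr) inr kn kn).
  by case: (dir).
have Ey : neval r (NAdd c k) = g (y kn) by rewrite gy; have [_ <-] := ev_add Hcn Hk.
have Ez : neval r (NAdd (nadd c 1) k) = g (z kn) by rewrite gz; have [_ <-] := ev_add H1 Hk.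
have -> : yk = Posz (g (if dir then y kn else z kn)) by rewrite /yk; case: (dir); rewrite ?Ey ?Ez.
have -> : zk = Posz (g (if dir then z kn else y kn)) by rewrite /zk; case: (dir); rewrite ?Ey ?Ez.
have -> : bk = Posz (g b) by have [_ Eb] := Hnb; rewrite /bk Eb.
rewrite !out_eights //; congr (_ ++ _ ++ _ ++ _ :: _ ++ _).
  by apply: (out_pow (out_Dir dir) Hc Hp H2 H3 H4 (ev_C v r 0) Hnb).
exact: (out_diff _ _ Hcn H1 H2 H3 Hk Hk).
Qed.

Lemma out_lasso dir r v m1 m2 k p nb bx bx' e V (b : V) (x x' : 'I_N -> V) (kn : 'I_N) g
    m1n m2n pn xn xn' d :
  ctx R r v -> ev v r m1 m1n -> ev v r m2 m2n -> ev v r p pn -> ev v r k kn ->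
  ev v r nb (g b) -> ev v r bx xn -> ev v r bx' xn' -> ev v r e d ->
  at_ g x xn -> at_ g x' xn' ->
  gout A (GLasso dir v m1 m2 k p nb bx bx' e) r =
  enc_form d g (LassoF dir R m1n m2n kn pn b x x').
Proof.
move=> Hc Hm1 Hm2 Hp Hk Hnb Hx Hx' He gx gx'.
pose g1 := sumf g (fun i : 'I_N => d + val i).
pose g2 := sumf g1 (fun i : 'I_N => d + N + val i).
have H1 : ev v r (nadd e 1) (d + N) by apply: (ev_eq (ev_nadd 1 Hc He)); lia.
have H2 : ev v r (nadd e 2) (d + N + N) by apply: (ev_eq (ev_nadd 2 Hc He)); lia.
rewrite -[LHS]/(gout A (GEights v) r ++ gout A (GEights v) r ++ 5%Z ::
  gout A (GPow (GDir dir) v m1 bx e (nadd e 2) (NC 1) (NC 1)) r ++ 5%Z ::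
  gout A (GLoop dir v p k nb e) r ++
  gout A (GPow (GDir dir) v m2 (nadd e 1) bx' (nadd e 2) (NC 1) (NC 1)) r).
rewrite -[RHS]/(nseq N 8%Z ++ nseq N 8%Z ++ 5%Z ::
  enc_form (d + N + N) g2 (powF (DirF dir R) m1n (inl \o (inl \o x)) (inl \o inr) (TCst 1)) ++ 5%Z ::
  enc_form (d + N + N) g2 (LoopF dir R pn kn (inl (inl b)) (inl \o inr) inr) ++
  enc_form (d + N + N) g2 (powF (DirF dir R) m2n inr (inl \o (inl \o x')) (TCst 1))).
rewrite !out_eights //; congr (_ ++ _ ++ _ :: _ ++ _ :: _ ++ _).
- by apply: (out_pow (out_Dir dir) Hc Hm1 Hx He H2 (ev_C v r 1) (ev_C v r 1)).
- by apply: (out_loop _ Hc Hp Hk Hnb He) => //; lia.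
- by apply: (out_pow (out_Dir dir) Hc Hm2 H1 Hx' H2 (ev_C v r 1) (ev_C v r 1)).
Qed.

Lemma out_guard dir r v m1 m2 k p nl bx bx' e V (l : V) (x x' : 'I_N -> V) (kn : 'I_N) g
    m1n m2n pn xn xn' d :
  ctx R r v -> ev v r m1 m1n -> ev v r m2 m2n -> ev v r p pn -> ev v r k kn ->
  ev v r nl (g l) -> ev v r bx xn -> ev v r bx' xn' -> ev v r e d ->
  at_ g x xn -> at_ g x' xn' ->
  gout A (GGuard dir v m1 m2 k p nl bx bx' e) r =
  enc_form d g (GuardF dir R m1n m2n kn pn l x x').
Proof.
move=> Hc Hm1 Hm2 Hp Hk Hl Hx Hx' He gx gx'.
pose g1 := sumf g (fun i : 'I_1 => d + val i).
have He1 : ev v r (NAdd e (NC 1)) (d + 1) by apply: ev_add.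
have Hb : ev v r e (g1 (inr ord0)) by apply: (ev_eq He); rewrite /g1 /= addn0.
have EL : gout A (GLasso dir v m1 m2 k p e bx bx' (NAdd e (NC 1))) r =
  enc_form (d + 1) g1 (LassoF dir R m1n m2n kn pn (inr ord0) (inl \o x) (inl \o x')).
  exact: (out_lasso _ Hc Hm1 Hm2 Hp Hk Hb Hx Hx' He1).
have [[_ E1] [_ E2]] := (Hm1, Hm2); have [[_ Ep] [_ El]] := (Hp, Hl).
have [_ Ee] := Hb.
pose f (m1v m2v pv bv lv : nat) (s : seq int) : seq int :=
  [:: 8; 6; 4; 2; 0; Posz lv; 1; 1; 1; Posz (m1v + m2v); 6; 5; 4; 2; 3; Posz pv; 0; Posz bv;
   1; Posz (m1v + m2v + 1)%N; 0; Posz lv; 4; 2; 0; Posz lv; 1; 1; 2; 3; Posz pv; 0; Posz bv;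
   1; Posz (m1v + m2v + pv)%N; 5; 5; 4; 0; Posz lv; 2; 3; Posz pv; 0; Posz bv;
   1; Posz (m1v + m2v)%N; 4; 2; 3; Posz pv; 0; Posz bv; 1; Posz (m1v + m2v)%N; 0; Posz lv]%Z ++ s.
rewrite -[LHS]/(f (neval r m1) (neval r m2) (neval r p) (neval r e) (neval r nl)
  (gout A (GLasso dir v m1 m2 k p e bx bx' (NAdd e (NC 1))) r)).
by rewrite EL E1 E2 Ep El Ee.
Qed.

Lemma out_ands r v n nn h V (F : nat -> fml V) d g : ev v r n nn ->
  (forall i, gout A h (updn r v i) = enc_form d g (F i)) ->
  gout A (GAnds v n h) r = enc_form d g (bigand (iota 0 nn) F).
Proof.
move=> [_ En] hF; rewrite enc_form_bigand [LHS]/= En; congr (flatten _ ++ _).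
by apply: eq_map => i /=; rewrite hF.
Qed.

Lemma out_closed dir r v nl bx bx' e V (l : V) (x x' : 'I_N -> V) g xn xn' d :
  ctx R r v -> ev v r nl (g l) -> ev v r bx xn -> ev v r bx' xn' -> ev v r e d ->
  at_ g x xn -> at_ g x' xn' ->
  gout A (GClosed dir v nl bx bx' e) r = enc_form d g (ClosedF dir R l x x').
Proof.
move=> Hc Hl Hx Hx' He gx gx'.
have -> : ClosedF dir R l x x' = bigand (iota 0 N) (fun p => bigand (enum 'I_N) (fun k =>
    bigand (iota 0 (N ^ 2)) (fun m1 => bigand (iota 0 (N ^ 2)) (fun m2 =>
      GuardF dir R m1 m2 k p.+1 l x x')))).
  rewrite /ClosedF -[1]/(1 + 0) iotaDl.
  by elim: (iota 0 N) => //= p s ->.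
apply: out_ands => [|p]; first exact: (ev_N Hc).
have Hc1 := ctx_up p Hc (leqnn _).
apply: (out_all Hc1) => k; have Hc2 := ctx_up k Hc1 (leqnn _).
apply: out_ands => [|m1]; first exact: (ev_N2 Hc2).
have Hc3 := ctx_up m1 Hc2 (leqnn _).
apply: out_ands => [|m2]; first exact: (ev_N2 Hc3).
have Hc4 := ctx_up m2 Hc3 (leqnn _).
have up1 w s u n i : ev w s u n -> ev w.+1 (updn s w i) u n by move=> H; apply: ev_up H (leqnn _).
apply: (out_guard _ Hc4 (xn := xn) (xn' := xn')) => //; try (by do 4!apply: (up1)).
- by apply: (up1); apply: ev_V.
- exact: ev_V.
- by apply: (@ev_add _ _ _ _ 1 p) => //; do 3!apply: (up1); apply: ev_V.
- by do 2!apply: (up1); apply: ev_V.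
Qed.

End Output.

(** * Printing the whole formula *)

Lemma enc_foldr_or I V (F : I -> fml V) h (s : seq I) d g :
  enc_form d g (foldr (fun i f => FOr (F i) f) h s) =
  flatten [seq 6%Z :: enc_form d g (F i) | i <- s] ++ enc_form d g h.
Proof. by elim: s => //= i s ->; rewrite catA. Qed.

Definition GP v n bx bx' e : gen := GPow GR v n bx bx' e (NC 1) (NC 1).

Definition GPhi v l y z e : gen :=
  GCat (GEmit [:: tkC 5; tkC 5]) (GCat (GClosed true v l y z e) (GCat (GClosed false v l y z e)
    (GCat (GEmit [:: tkC 5])
      (GCat (GCat (GEights v) (GP v nN2 y e (nadd e 1)))
            (GCat (GEights v) (GP v nN2 e z (nadd e 1))))))).

Definition GPsi v l x x' y z e : gen :=
  GCat (GEights v) (GCat (GEights v) (GCat (GEmit [:: tkC 5; tkC 5])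
    (GCat (GP v nN2 x y e) (GCat (GPhi v l y z e) (GP v nN2 z x' e))))).

(** In this scope [k] is numbered 0, [x] starts at 1, [x'] at [N + 1], the bound variable is
    [2 * N + 1], and the blocks of [psi_form] start at [2 * N + 2]. *)
Definition GTail v : gen :=
  let l := nadd (NC 1) 2 in
  let m := NMul (NC 2) nN2 in
  GCat (GEmit [:: tkC 8; tkC 5; tkC 4; tkC 1; tkC 1; tkC 0; TkN l;
                  tkC 5; tkC 5; tkC 4; tkC 0; tkC 0; tkC 2; tkC 1; TkN m; tkC 0; TkN l;
                  tkC 4; tkC 2; tkC 1; TkN m; tkC 0; TkN l; tkC 0; tkC 0])
       (GPsi v l (NC 1) (nadd (NC 1) 1) (nadd (NC 2) 2) (nadd (NC 2) 3) (nadd (NC 2) 4)).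

Definition GStep v i : gen :=
  GCat (GEmit [:: tkC 6; tkC 5; tkC 5; tkC 4; tkC 0; tkC 0; tkC 1; TkN i;
                  tkC 4; tkC 1; TkN i; tkC 0; tkC 0])
       (GP v i (NC 1) (nadd (NC 1) 1) (nadd (NC 1) 2)).

(** Loop variables begin at 2, since 0 and 1 hold [N] and the number of atoms. *)
Definition GRhat : gen :=
  GCat (GFor 2 (NMul (NC 2) nN2) (GStep 3 (NAdd (NC 1) (NV 2)))) (GTail 2).

Section Output.

Variables (N : nat) (R : dbc N).

Let A := dbc_array R.
Let P := Pform R.
Let Ffw := Dform true R.
Let Fbw := Dform false R.

Lemma out_P r v n bx bx' e nn xn xn' d (g : dvar N -> nat) : ctx R r v ->
  ev v r n nn -> ev v r bx xn -> ev v r bx' xn' -> ev v r e d ->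
  at_ g inl xn -> at_ g inr xn' ->
  gout A (GP v n bx bx' e) r = enc_form d g (P nn).
Proof.
move=> Hc Hn Hx Hx' He gx gx'.
by apply: (out_pow (@out_R N R) Hc Hn Hx Hx' He (ev_C v r 1) (ev_C v r 1)).
Qed.

Lemma out_phi r v l y z e (g : kvar N -> nat) yn zn d : ctx R r v ->
  ev v r l (g None) -> ev v r y yn -> ev v r z zn -> ev v r e d ->
  at_ g (Some \o inl) yn -> at_ g (Some \o inr) zn ->
  gout A (GPhi v l y z e) r = enc_form d g (phi_form P Ffw Fbw).
Proof.
move=> Hc Hl Hy Hz He gy gz.
have He1 : ev v r (nadd e 1) (d + N) by apply: (ev_eq (ev_nadd 1 Hc He)); lia.
have HN2 := ev_N2 Hc.
rewrite -[LHS]/(5%Z :: 5%Z :: gout A (GClosed true v l y z e) r ++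
  gout A (GClosed false v l y z e) r ++ 5%Z ::
  (gout A (GEights v) r ++ gout A (GP v nN2 y e (nadd e 1)) r) ++
  (gout A (GEights v) r ++ gout A (GP v nN2 e z (nadd e 1)) r)).
have -> : enc_form d g (phi_form P Ffw Fbw) =
  5%Z :: 5%Z :: enc_form d g Ffw ++ enc_form d g Fbw ++ 5%Z ::
  enc_form d g (fren (Sfw_form P) (Some \o inl)) ++
  enc_form d g (fren (Sbw_form P) (Some \o inr)) by rewrite catA.
rewrite !enc_form_ren -[enc_form _ _ (Sfw_form P)]/(nseq N 8%Z ++ enc_form (d + N)
  (sumf (g \o (Some \o inl)) (fun i => d + val i)) (fren (P (N ^ 2)) id)).
rewrite -[enc_form _ _ (Sbw_form P)]/(nseq N 8%Z ++ enc_form (d + N)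
  (sumf (g \o (Some \o inr)) (fun i => d + val i)) (fren (P (N ^ 2)) (sumf inr inl))).
rewrite !enc_form_ren !out_eights //.
congr (_ :: _ :: _ ++ _ ++ _ :: (_ ++ _) ++ (_ ++ _)).
- exact: (out_closed true Hc Hl Hy Hz He gy gz).
- exact: (out_closed false Hc Hl Hy Hz He gy gz).
- exact: (out_P Hc HN2 Hy He He1).
- exact: (out_P Hc HN2 He Hz He1).
Qed.

Lemma out_psi r v l x x' y z e (g : kvar N -> nat) xn xn' d : ctx R r v ->
  ev v r l (g None) -> ev v r x xn -> ev v r x' xn' ->
  ev v r y d -> ev v r z (d + N) -> ev v r e (d + N + N) ->
  at_ g (Some \o inl) xn -> at_ g (Some \o inr) xn' ->
  gout A (GPsi v l x x' y z e) r = enc_form d g (psi_form P Ffw Fbw).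
Proof.
move=> Hc Hl Hx Hx' Hy Hz He gx gx'.
have HN2 := ev_N2 Hc.
pose g1 := sumf g (fun i : 'I_N => d + val i).
pose g2 := sumf g1 (fun i : 'I_N => d + N + val i).
rewrite -[LHS]/(gout A (GEights v) r ++ gout A (GEights v) r ++ 5%Z :: 5%Z ::
  gout A (GP v nN2 x y e) r ++ gout A (GPhi v l y z e) r ++ gout A (GP v nN2 z x' e) r).
pose x1 (i : 'I_N) : kvar N + 'I_N + 'I_N := inl (inl (Some (inl i))).
pose x1' (i : 'I_N) : kvar N + 'I_N + 'I_N := inl (inl (Some (inr i))).
pose y1 (i : 'I_N) : kvar N + 'I_N + 'I_N := inl (inr i).
pose z1 (i : 'I_N) : kvar N + 'I_N + 'I_N := inr i.
have -> : enc_form d g (psi_form P Ffw Fbw) = nseq N 8%Z ++ nseq N 8%Z ++ 5%Z :: 5%Z ::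
  enc_form (d + N + N) g2 (fren (P (N ^ 2)) (sumf x1 y1)) ++
  enc_form (d + N + N) g2 (fren (phi_form P Ffw Fbw) (oapp (sumf y1 z1) (inl (inl None)))) ++
  enc_form (d + N + N) g2 (fren (P (N ^ 2)) (sumf z1 x1')).
  by rewrite (catA (enc_form _ g2 _) (enc_form _ g2 _)).
rewrite !enc_form_ren !out_eights //.
congr (_ ++ _ ++ _ :: _ :: _ ++ _ ++ _).
- exact: (out_P Hc HN2 Hx Hy He).
- exact: (out_phi Hc _ Hy Hz He).
- exact: (out_P Hc HN2 Hz Hx' He).
Qed.

Lemma out_Rhat : gout A GRhat (dbc_regs R) = enc_kform (Rhat P Ffw Fbw).
Proof.
pose r := dbc_regs R.
have Hc : ctx R r 2 by [].
pose g : kvar N -> nat := oapp (fun u => (dvar_code u).+1) 0.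
have gx : at_ g (Some \o inl) 1 by [].
have gx' : at_ g (Some \o inr) (1 + N) by [].
rewrite /enc_kform /Rhat enc_foldr_or -/g.
have Hl : ev 2 r (nadd (NC 1) 2) (2 * N).+1 by apply: (ev_nadd 2 Hc (ev_C _ _ 1)).
have Hx' : ev 2 r (nadd (NC 1) 1) (1 + N) by apply: (ev_eq (ev_nadd 1 Hc (ev_C _ _ 1))); lia.
have Hm : ev 2 r (NMul (NC 2) nN2) (2 * N ^ 2) by apply: ev_mul => //; apply: ev_N2 Hc.
rewrite -[LHS]/(flatten [seq gout A (GStep 3 (NAdd (NC 1) (NV 2))) (updn r 2 i) |
  i <- iota 0 (neval r (NMul (NC 2) nN2))] ++ gout A (GTail 2) r).
have [_ ->] := Hm; congr (flatten _ ++ _).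
  rewrite -[iota 1 _]/(iota (1 + 0) _) iotaDl -map_comp; apply: eq_map => i.
  have Hi : ev 3 (updn r 2 i) (NAdd (NC 1) (NV 2)) (1 + i) by apply: ev_add => //; apply: ev_V.
  have Hc' := ctx_up i Hc (leqnn _).
  have {}Hx' := ev_up i Hx' (leqnn _); have {}Hl := ev_up i Hl (leqnn _).
  rewrite -[LHS]/([:: 6; 5; 5; 4; 0; 0; 1; Posz (1 + i)%N; 4; 1; Posz (1 + i)%N; 0; 0]%Z ++
    gout A (GP 3 (NAdd (NC 1) (NV 2)) (NC 1) (nadd (NC 1) 1) (nadd (NC 1) 2)) (updn r 2 i)).
  rewrite -[RHS]/([:: 6; 5; 5; 4; 0; 0; 1; Posz (1 + i)%N; 4; 1; Posz (1 + i)%N; 0; 0]%Z ++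
    enc_form (2 * N).+1 g (fren (P (1 + i)) Some)).
  rewrite enc_form_ren; congr (_ ++ _).
  exact: (out_P Hc' Hi (ev_C _ _ 1) Hx' Hl).
pose g1 := sumf g (fun i : 'I_1 => (2 * N).+1 + val i).
pose f (lv mv : nat) (s : seq int) : seq int :=
  [:: 8; 5; 4; 1; 1; 0; Posz lv; 5; 5; 4; 0; 0; 2; 1; Posz mv; 0; Posz lv;
      4; 2; 1; Posz mv; 0; Posz lv; 0; 0]%Z ++ s.
have [_ El] := Hl; have [_ Em] := Hm.
rewrite -[LHS]/(f (neval r (nadd (NC 1) 2)) (neval r (NMul (NC 2) nN2))
  (gout A (GPsi 2 (nadd (NC 1) 2) (NC 1) (nadd (NC 1) 1) (nadd (NC 2) 2)
     (nadd (NC 2) 3) (nadd (NC 2) 4)) r)) El Em.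
have -> : enc_form (2 * N).+1 g (Rhat_tail P Ffw Fbw) = f ((2 * N).+1 + 0) (2 * N ^ 2)
  (enc_form ((2 * N).+1 + 1) g1
    (fren (psi_form P Ffw Fbw) (oapp (fun u => inl (Some u)) (inr ord0)))) by [].
rewrite addn0 enc_form_ren; congr (f _ _ _).
apply: (out_psi (g := g1 \o _) Hc _ (ev_C _ _ 1) Hx') => //.
- by apply: (ev_eq Hl); rewrite /= addn0.
- by apply: (ev_eq (ev_nadd 2 Hc (ev_C _ _ 2))); lia.
- by apply: (ev_eq (ev_nadd 3 Hc (ev_C _ _ 2))); lia.
- by apply: (ev_eq (ev_nadd 4 Hc (ev_C _ _ 2))); lia.
Qed.

End Output.

Theorem theorem3 :
  (forall (N : nat) (R : dbc N) (P : nat -> fml (dvar N))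
          (Ffw Fbw : fml (kvar N)),
     balanced R ->
     (forall n : nat, defines (P n) (rpow (dbrel R) n)) ->
     closed_form (Rfw (dbrel R)) Ffw ->
     closed_form (Rbw (dbrel R)) Fbw ->
     closed_form (dbrel R) (Rhat P Ffw Fbw))
  /\
  (exists (P : forall N : nat, dbc N -> nat -> fml (dvar N))
          (Ffw Fbw : forall N : nat, dbc N -> fml (kvar N)),
     (forall (N : nat) (R : dbc N), balanced R ->
        [/\ forall n : nat, defines (P N R n) (rpow (dbrel R) n),
            closed_form (Rfw (dbrel R)) (Ffw N R),
            closed_form (Rbw (dbrel R)) (Fbw N R) &
            existential (Rhat (P N R) (Ffw N R) (Fbw N R))])
     /\ polytime (fun (N : nat) (R : dbc N) => Rhat (P N R) (Ffw N R) (Fbw N R))).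
Proof.
split=> [N R P Ffw Fbw balR defP cfF cfB|]; first exact: closed_form_Rhat.
exists Pform, (Dform true), (Dform false); split=> [N R _|].
  split; [exact: defines_Pform|exact: (closed_form_Dform true)|exact: (closed_form_Dform false)|].
  apply: existential_Rhat; [|exact: existential_Dform|exact: existential_Dform].
  by move=> n; apply: existential_powF; apply: existential_RF.
by apply: (gen_polytime (g := GRhat)) => // N R; apply: out_Rhat.
Qed.
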